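(* Let $k,n\ge1$ be integers, let $\tilde Q$ be the quiver with two vertices $0$ and $1$, with two edges from vertex $1$ to itself, $n$ edges from vertex $1$ to vertex $0$ and $n$ edges from vertex $0$ to vertex $1$, let $\mathbf{v}$ be the dimension vector equal to $k$ at vertex $1$ and $1$ at vertex $0$ (so the vector spaces are $\mathbb{C}^k$ and $\mathbb{C}$), and let $\alpha=0$. Then $$\pi_j\left(\mathrm{Rep}(\tilde Q,\mathbf{v})^{\alpha\text{-}st}\right)=0$$ for all $j<2(k-1+n)-1$, and $$\pi_j\left(\mathcal{M}_\alpha(\tilde Q,\mathbf{v})^{st}\right)\cong\pi_{j-1}\left(\mathsf{U}(k)\right)$$ for all $j\geq 1$ with $j<2(k-1+n)-1$.
   Context: For a quiver with vertex set $\mathcal{I}$, edge set $\mathcal{E}$ and head/tail maps $h,t:\mathcal{E}\to\mathcal{I}$, and vector spaces $V_j$ with $\dim_{\mathbb{C}}V_j=v_j$, set $\mathrm{Rep}(\tilde Q,\mathbf{v})=\bigoplus_{a\in\mathcal{E}}\mathrm{Hom}(V_{t(a)},V_{h(a)})$. The group $G_{\mathbf{v}}^{\mathbb{C}}=\prod_j\mathsf{GL}(V_j,\mathbb{C})$ acts by $g\cdot(A_a)_a=(g_{h(a)}A_ag_{t(a)}^{-1})_a$. A subrepresentation of $A=(A_a)_a$ is a choice of subspaces $V_j'\subseteq V_j$ with $A_a(V'_{t(a)})\subseteq V'_{h(a)}$ for all $a$. In general, for a stability parameter $\alpha=(\alpha_j)_{j\in\mathcal{I}}$ of real numbers with $\sum_j\alpha_jv_j=0$,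 set $\mathrm{slope}_\alpha(\mathbf{v'})=\left(\sum_j-\alpha_jv_j'\right)/\sum_jv_j'$; $A$ is $\alpha$-stable if every subrepresentation with dimension vector $\mathbf{v'}\ne\mathbf{0},\mathbf{v}$ satisfies $\mathrm{slope}_\alpha(\mathbf{v'})<\mathrm{slope}_\alpha(\mathbf{v})$. Thus for $\alpha=0$, $A$ is $\alpha$-stable if and only if its only subrepresentations are $0$ and itself. $\mathrm{Rep}(\tilde Q,\mathbf{v})^{\alpha\text{-}st}$ denotes the set of $\alpha$-stable representations and $\mathcal{M}_\alpha(\tilde Q,\mathbf{v})^{st}=\mathrm{Rep}(\tilde Q,\mathbf{v})^{\alpha\text{-}st}/G_{\mathbf{v}}^{\mathbb{C}}$ with the quotient topology. Here $\pi_0=0$ means path-connected, and for $j=1$ the isomorphism is a bijection of pointed sets. *)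

(* Defs.v *)
From HB Require Import structures.
From mathcomp Require Import all_boot all_order all_algebra generic_quotient.
From mathcomp Require Import spectral complex.
From mathcomp Require Import all_classical reals topology normedtype.
From mathcomp Require Import lra.

Set Implicit Arguments.
Unset Strict Implicit.
Unset Printing Implicit Defensive.

Import Order.TTheory GRing.Theory Num.Theory.
Import numFieldNormedType.Exports.

Local Open Scope classical_set_scope.
Local Open Scope ring_scope.
Local Open Scope quotient_scope.
Local Open Scope complex_scope.

(* The topology of [R[i]] is the one of its modulus. *)
HB.instance Definition _ (R : rcfType) := PseudoPointedMetric.copy R[i] R[i]^o.

Section UnitInterval.
Variable R : realType.
Implicit Type s : R.

Lemma itv_flip s : 0 <= s <= 1 -> 0 <= 1 - s <= 1. Proof. by lra. Qed.

Lemma itv_lo s : 0 <= s <= 1 -> s <= 2^-1 -> 0 <= 2 * s <= 1.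
Proof. by lra. Qed.

Lemma itv_hi s : 0 <= s <= 1 -> 2^-1 <= s -> 0 <= 2 * s - 1 <= 1.
Proof. by lra. Qed.

Lemma itv_gt s : ~~ (s <= 2^-1) -> 2^-1 <= s. Proof. by rewrite -ltNge => /ltW. Qed.

Lemma one_gt_half : (1 <= 2^-1 :> R) = false.
Proof. by apply/negbTE; rewrite -ltNge; lra. Qed.

Lemma affine_continuous (a : R) : continuous (fun s : R => 2 * s - a).
Proof.
move=> s; apply: cvgB; last exact: cvg_cst.
by apply: cvgM; [exact: cvg_cst|exact: cvg_id].
Qed.

End UnitInterval.

Section Gluing.
Variables (R : realType) (T X : topologicalType).

Lemma within_comp (S : topologicalType) (A : set T) (B : set S)
    (phi : T -> S) (f : S -> X) :
  continuous phi -> (forall x, A x -> B (phi x)) ->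
  {within B, continuous f} -> {within A, continuous (fun x => f (phi x))}.
Proof.
move=> cphi AB /subspace_continuousP cf; apply/subspace_continuousP => x Ax.
move=> W /(cf _ (AB _ Ax)); rewrite /= /within /= => nW.
have := cphi x _ nW; rewrite /= !nbhs_simpl /=.
by apply: filterS => y yW Ay; apply: yW; apply: AB.
Qed.

Lemma within_eq (A : set T) (f g : T -> X) :
  (forall x, A x -> f x = g x) ->
  {within A, continuous f} -> {within A, continuous g}.
Proof.
move=> fg /subspace_continuousP cf; apply/subspace_continuousP => x Ax.
move=> W nW; have /(cf _ Ax) : nbhs (f x) W by rewrite (fg _ Ax).
rewrite /= /within /= !nbhs_simpl /=.
by apply: filterS => y yW Ay; have := yW Ay; rewrite /from_subspace (fg _ Ay).
Qed.

Lemma within_glue (A : set T) (u : T -> R) (c : R) (g h : T -> X) :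
  closed A -> continuous u ->
  {within A `&` [set x | u x <= c], continuous g} ->
  {within A `&` [set x | c <= u x], continuous h} ->
  (forall x, A x -> u x = c -> g x = h x) ->
  {within A, continuous (fun x => if u x <= c then g x else h x)}.
Proof.
move=> clA cu cg ch gh.
have -> : A = (A `&` [set x | u x <= c]) `|` (A `&` [set x | c <= u x]).
  rewrite -setIUr; apply/seteqP; split=> [x Ax|x []//]; split=> //=.
  by have [|/ltW] := leP (u x) c; [left|right].
apply: withinU_continuous.
- by apply: closedI => //; apply: closed_comp (@closed_le R c) => x _; exact: cu.
- by apply: closedI => //; apply: closed_comp (@closed_ge R c) => x _; exact: cu.
- by apply: within_eq cg => x [_ /= ->].
- apply: within_eq ch => x [Ax /= cx]; case: ifPn => // xc.
  by rewrite gh//; apply/eqP; rewrite eq_le xc cx.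
Qed.

Lemma pair_continuous (S : topologicalType) (f : T -> X) (g : T -> S) :
  continuous f -> continuous g -> continuous (fun x => (f x, g x)).
Proof. by move=> cf cg x; apply: (cvg_pair (cf x) (cg x)). Qed.

Lemma row_continuous n (f : T -> 'rV[R]_n) :
  (forall i, continuous (fun x => f x 0 i)) -> continuous f.
Proof.
move=> cf x W [P fP PW]; apply: filterS (fun y => PW (f y)) _ => /=.
apply: filter_forall => i; apply: filter_forall => j.
by have := fP i j; rewrite (ord1 i) => /cf.
Qed.

End Gluing.

(* [homotopy_group R x j] is pi_j(X, x) for x : X: the maps from the unit cube
   of dimension j to X that send the boundary to x, up to homotopy relative to
   the boundary. For j = 0 the cube is a point with empty boundary, so this is
   the set of path components of X, pointed at the one of x. *)
Section HomotopyGroup.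
Variables (R : realType) (X : topologicalType) (x0 : X).

Section AnyDimension.
Variable j : nat.

Definition cube : set 'rV[R]_j := [set t | forall i, 0 <= t 0 i <= 1].

Definition cube_boundary : set 'rV[R]_j :=
  [set t | cube t /\ exists i, t 0 i = 0 \/ t 0 i = 1].

(* The values of [gloop_fun] outside the cube are irrelevant. *)
Record gloop := Gloop {
  gloop_fun :> 'rV[R]_j -> X;
  gloop_cont : {within cube, continuous gloop_fun};
  gloop_bd : forall t, cube_boundary t -> gloop_fun t = x0 }.

HB.instance Definition _ := gen_eqMixin gloop.
HB.instance Definition _ := gen_choiceMixin gloop.

Definition cylinder : set (R * 'rV[R]_j) :=
  [set p | 0 <= p.1 <= 1 /\ cube p.2].

Definition homotopic (f g : gloop) : Prop :=
  exists H : R * 'rV[R]_j -> X,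
    [/\ {within cylinder, continuous H},
        (forall t, cube t -> H (0, t) = f t),
        (forall t, cube t -> H (1, t) = g t) &
        (forall (s : R) (t : 'rV[R]_j),
          0 <= s <= 1 -> cube_boundary t -> H (s, t) = x0)].

Lemma coord_cont i : continuous (fun t : 'rV[R]_j => t 0 i).
Proof. exact: coord_continuous. Qed.

Lemma closed_cube : closed cube.
Proof.
have -> : cube = \bigcap_(i in [set: 'I_j])
    ([set t : 'rV[R]_j | 0 <= t 0 i] `&` [set t | t 0 i <= 1]).
  apply/seteqP; split=> [t ct i _|t ct i].
    by split=> /=; case/andP: (ct i).
  by have [/= -> ->] := ct i I.
apply: closed_bigI => i _; apply: closedI.
- by apply: closed_comp (@closed_ge R 0) => x _; exact: coord_cont.
- by apply: closed_comp (@closed_le R 1) => x _; exact: coord_cont.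
Qed.

Lemma closed_cylinder : closed cylinder.
Proof.
have -> : cylinder = [set p : R * 'rV[R]_j | 0 <= p.1] `&` [set p | p.1 <= 1]
    `&` [set p | cube p.2].
  apply/seteqP; split=> [p [/andP[? ?] ?]|p [[/= p0 p1] cp]] //.
  by split=> //; rewrite p0 p1.
apply: closedI; [apply: closedI|].
- by apply: closed_comp (@closed_ge R 0) => x _; exact: cvg_fst.
- by apply: closed_comp (@closed_le R 1) => x _; exact: cvg_fst.
- by apply: closed_comp closed_cube => x _; exact: cvg_snd.
Qed.

Lemma homotopic_refl f : homotopic f f.
Proof.
exists (fun p => f p.2); split=> //; last by move=> s t _; exact: gloop_bd.
apply: (@within_comp _ _ _ cylinder cube snd f) (@gloop_cont f) => [x|x []//].
exact: cvg_snd.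
Qed.

Lemma homotopic_sym f g : homotopic f g -> homotopic g f.
Proof.
move=> [H [cH H0 H1 Hb]]; exists (fun p => H (1 - p.1, p.2)).
split=> [|t ct|t ct|s t s01 bt].
- apply: (@within_comp _ _ _ cylinder cylinder (fun p => (1 - p.1, p.2)) H) cH.
    apply: pair_continuous => p; last exact: cvg_snd.
    by apply: cvgB; [exact: cvg_cst|exact: cvg_fst].
  move=> p [/= p01 cp]; split=> //=; exact: itv_flip.
- by rewrite /= subr0 H1.
- by rewrite /= subrr H0.
- by apply: Hb => //; exact: itv_flip.
Qed.

Lemma homotopic_trans f g h : homotopic f g -> homotopic g h -> homotopic f h.
Proof.
move=> [H [cH H0 H1 Hb]] [K [cK K0 K1 Kb]].
exists (fun p => if p.1 <= 2^-1 then H (2 * p.1, p.2) else K (2 * p.1 - 1, p.2)).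
split=> [|t ct|t ct|s t s01 bt].
- apply: (@within_glue R _ _ _ fst); [exact: closed_cylinder|..].
  + by move=> p; exact: cvg_fst.
  + apply: (@within_comp _ _ _ (cylinder `&` _) cylinder (fun p => (2 * p.1, p.2)) H) cH.
      apply: pair_continuous => p; last exact: cvg_snd.
      by apply: cvgM; [exact: cvg_cst|exact: cvg_fst].
    by move=> p [[/= p01 cp] ph]; split=> //=; exact: itv_lo.
  + apply: (@within_comp _ _ _ (cylinder `&` _) cylinder (fun p => (2 * p.1 - 1, p.2)) K) cK.
      apply: pair_continuous => p; last exact: cvg_snd.
      apply: cvgB; last exact: cvg_cst.
      by apply: cvgM; [exact: cvg_cst|exact: cvg_fst].
    by move=> p [[/= p01 cp] ph]; split=> //=; exact: itv_hi.
  + move=> [s t] [/= _ ct] ->; rewrite mulfV ?pnatr_eq0// subrr.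
    by rewrite H1// K0.
- by rewrite /= invr_ge0 ler0n mulr0 H0.
- rewrite /= one_gt_half mulr1 (_ : 2 - 1 = 1) ?K1//.
  by rewrite (natrD _ 1 1) addrK.
- by rewrite /=; case: ifPn => sh; [apply: Hb|apply: Kb] => //;
    [exact: itv_lo|exact/itv_hi/itv_gt].
Qed.

Definition homotopic_rel (f g : gloop) : bool := `[< homotopic f g >].

Lemma homotopic_rel_equiv : equiv_class_of homotopic_rel.
Proof.
split=> [f|f g|g f h].
- exact/asboolP/homotopic_refl.
- by apply/asboolP/asboolP; exact: homotopic_sym.
- by move=> /asboolP fg /asboolP gh; apply/asboolP/(homotopic_trans fg).
Qed.

Canonical homotopic_equiv := EquivRelPack homotopic_rel_equiv.

Definition homotopy_group : Type := {eq_quot homotopic_equiv}.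

Definition homotopy_class (f : gloop) : homotopy_group :=
  \pi_({eq_quot homotopic_equiv}) f.

Lemma homotopy_class_eq f g :
  homotopy_class f = homotopy_class g <-> homotopic f g.
Proof.
split=> [/eqquotP/asboolP//|fg].
by apply/eqquotP/asboolP.
Qed.

Lemma cst_cont : {within cube, continuous (fun=> x0)}.
Proof. by apply/subspace_continuousP => x _; exact: cvg_cst. Qed.

Definition cst_gloop : gloop := Gloop cst_cont (fun _ _ => erefl).

Definition homotopy_one : homotopy_group := homotopy_class cst_gloop.

End AnyDimension.

Section PositiveDimension.
Variable j : nat.

(* [stretch 0] maps the half t_0 <= 1/2 of the cube onto the cube,
   [stretch 1] the half 1/2 <= t_0. *)
Definition stretch (a : R) (t : 'rV[R]_j.+1) : 'rV[R]_j.+1 :=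
  \row_i (if i == 0 then 2 * t 0 i - a else t 0 i).

Definition concat_fun (f g : 'rV[R]_j.+1 -> X) (t : 'rV[R]_j.+1) : X :=
  if t 0 0 <= 2^-1 then f (stretch 0 t) else g (stretch 1 t).

Lemma stretch_continuous a : continuous (stretch a).
Proof.
apply: row_continuous => i; have [i0|i0] := eqVneq i 0.
  rewrite (_ : (fun x => stretch a x 0 i) = (fun t : 'rV[R]_j.+1 => 2 * t 0 i - a)); last first.
    by apply/funext => t; rewrite mxE i0 eqxx.
  move=> t; apply: (@continuous_comp _ _ _ (fun t : 'rV[R]_j.+1 => t 0 i)
    (fun s : R => 2 * s - a)); first exact: coord_cont.
  exact: affine_continuous.
rewrite (_ : (fun x => stretch a x 0 i) = (fun t : 'rV[R]_j.+1 => t 0 i)); last first.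
  by apply/funext => t; rewrite mxE (negbTE i0).
exact: coord_cont.
Qed.

Lemma itv_stretch0 (s : R) : 0 <= s <= 1 -> s <= 2^-1 -> 0 <= 2 * s - 0 <= 1.
Proof. by rewrite subr0; exact: itv_lo. Qed.

Lemma stretch_cube a t : cube t -> 0 <= 2 * t 0 0 - a <= 1 ->
  cube (stretch a t).
Proof. by move=> ct ta i; rewrite mxE; case: eqP => [->|_]; [|exact: ct]. Qed.

Lemma stretch_boundary a t : cube_boundary t -> 0 <= 2 * t 0 0 - a <= 1 ->
  (t 0 0 = 0 -> a = 0) -> (t 0 0 = 1 -> a = 1) -> cube_boundary (stretch a t).
Proof.
move=> [ct [i ti]] ta a0 a1; split; first exact: stretch_cube.
exists i; rewrite mxE; case: eqP => [i0|_ //]; subst i.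
by case: ti => t0; [left; rewrite (a0 t0) t0; lra|right; rewrite (a1 t0) t0; lra].
Qed.

Lemma stretch_half t : cube t -> t 0 0 = 2^-1 ->
  cube_boundary (stretch 0 t) /\ cube_boundary (stretch 1 t).
Proof.
move=> ct t0; split; (split; first by apply: stretch_cube => //; lra);
  exists 0; rewrite mxE eqxx t0; [right|left]; lra.
Qed.

Lemma concat_cont (f g : gloop j.+1) :
  {within @cube j.+1, continuous (concat_fun f g)}.
Proof.
apply: (@within_glue R _ _ (@cube j.+1) (fun t => t 0 0) 2^-1
  (fun t => f (stretch 0 t)) (fun t => g (stretch 1 t))).
- exact: closed_cube.
- exact: coord_cont.
- apply: (@within_comp _ _ _ (@cube j.+1 `&` _) (@cube j.+1) (stretch 0) f) (@gloop_cont _ f).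
    exact: stretch_continuous.
  move=> t [ct /= th]; apply: stretch_cube => //.
  by have := ct 0; lra.
- apply: (@within_comp _ _ _ (@cube j.+1 `&` _) (@cube j.+1) (stretch 1) g) (@gloop_cont _ g).
    exact: stretch_continuous.
  move=> t [ct /= th]; apply: stretch_cube => //.
  by have := ct 0; lra.
- by move=> t ct /(stretch_half ct)[b0 b1]; rewrite !gloop_bd.
Qed.

Lemma concat_bd (f g : gloop j.+1) t :
  cube_boundary t -> concat_fun f g t = x0.
Proof.
move=> bt; have := bt.1 0; rewrite /concat_fun; case: ifPn => th t01;
  by apply: gloop_bd; apply: stretch_boundary => //; lra.
Qed.

Definition concat (f g : gloop j.+1) : gloop j.+1 :=
  Gloop (@concat_cont f g) (@concat_bd f g).

Definition homotopy_mul (c d : homotopy_group j.+1) : homotopy_group j.+1 :=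
  homotopy_class (concat (repr c) (repr d)).

Lemma concat_homotopic (f f' g g' : gloop j.+1) :
  homotopic f f' -> homotopic g g' -> homotopic (concat f g) (concat f' g').
Proof.
move=> [H [cH H0 H1 Hb]] [K [cK K0 K1 Kb]].
exists (fun p : R * 'rV[R]_j.+1 => if p.2 0 0 <= 2^-1 then H (p.1, stretch 0 p.2)
                 else K (p.1, stretch 1 p.2)).
have cs a : continuous (fun p : R * 'rV[R]_j.+1 => (p.1, stretch a p.2)).
  apply: pair_continuous => p; first exact: cvg_fst.
  by apply: (cvg_comp snd (stretch a)); [exact: cvg_snd|exact: stretch_continuous].
split=> [|t ct|t ct|s t s01 bt].
- apply: (@within_glue R _ _ (@cylinder j.+1) (fun p : R * 'rV[R]_j.+1 => p.2 0 0) 2^-1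
    (fun p => H (p.1, stretch 0 p.2)) (fun p => K (p.1, stretch 1 p.2))); [exact: closed_cylinder|..].
  + move=> p; apply: (cvg_comp snd (fun t : 'rV[R]_j.+1 => t 0 0)).
      exact: cvg_snd.
    exact: coord_cont.
  + apply: (@within_comp _ _ _ (@cylinder j.+1 `&` _) (@cylinder j.+1)
      (fun p => (p.1, stretch 0 p.2)) H) cH; first exact: cs.
    move=> -[s t] [[/= s01 ct] th]; split=> //=; apply: stretch_cube => //.
    exact: itv_stretch0 (ct 0) th.
  + apply: (@within_comp _ _ _ (@cylinder j.+1 `&` _) (@cylinder j.+1)
      (fun p => (p.1, stretch 1 p.2)) K) cK; first exact: cs.
    move=> -[s t] [[/= s01 ct] th]; split=> //=; apply: stretch_cube => //.
    exact: itv_hi (ct 0) th.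
  + by move=> [s t] [/= s01 ct] /(stretch_half ct)[b0 b1]; rewrite Hb// Kb.
- rewrite /= /concat_fun; have := ct 0; case: ifPn => th t01.
  + by apply: H0; apply: stretch_cube => //; lra.
  + by apply: K0; apply: stretch_cube => //; lra.
- rewrite /= /concat_fun; have := ct 0; case: ifPn => th t01.
  + by apply: H1; apply: stretch_cube => //; lra.
  + by apply: K1; apply: stretch_cube => //; lra.
- have := bt.1 0; rewrite /=; case: ifPn => th t01.
  + by apply: Hb => //; apply: stretch_boundary => //; lra.
  + by apply: Kb => //; apply: stretch_boundary => //; lra.
Qed.

Lemma homotopy_class_concat (f g : gloop j.+1) :
  homotopy_class (concat f g) =
  homotopy_mul (homotopy_class f) (homotopy_class g).
Proof.
by apply/homotopy_class_eq/concat_homotopic;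
  apply/homotopy_class_eq; rewrite /homotopy_class reprK.
Qed.

End PositiveDimension.

End HomotopyGroup.

Arguments homotopy_group R {X} x0 j.
Arguments homotopy_one R {X} x0 j.

(* Includes non-emptiness of X, so that j = 0 says that X is path-connected. *)
Definition homotopy_trivial (R : realType) (X : topologicalType) (j : nat) :
    Prop :=
  inhabited X /\
  forall (x : X) (c : homotopy_group R x j), c = homotopy_one R x j.

(* Isomorphism of groups between pi_j(X, x) and pi_l(Y, y) when j, l >= 1,
   and bijection of pointed sets when j = 0 or l = 0. *)
Definition homotopy_iso (R : realType) (X Y : topologicalType) (x : X) (y : Y)
    (j l : nat) : Prop :=
  match j, l with
  | j'.+1, l'.+1 =>
      exists phi : homotopy_group R x j'.+1 -> homotopy_group R y l'.+1,
        bijective phi /\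
        {morph phi : c d / homotopy_mul c d >-> homotopy_mul c d}
  | _, _ =>
      exists phi : homotopy_group R x j -> homotopy_group R y l,
        bijective phi /\ phi (homotopy_one R x j) = homotopy_one R y l
  end.

Record quiver := Quiver {
  vertex : finType;
  edge : finType;
  qhead : edge -> vertex;
  qtail : edge -> vertex }.

Lemma invmx_mul (F : fieldType) n (A B : 'M[F]_n) :
  A \in unitmx -> B \in unitmx -> invmx (A *m B) = invmx B *m invmx A.
Proof.
move=> uA uB; have uAB : A *m B \in unitmx by rewrite unitmx_mul uA.
rewrite -[RHS](mulmxK uAB) -(mulmxA (invmx B)) (mulmxA (invmx A)).
by rewrite mulVmx// mul1mx mulVmx// mul1mx.
Qed.

Section Representations.
Variables (R : realType) (Q : quiver) (v : vertex Q -> nat).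

Definition rep : Type :=
  forall a : edge Q, 'M[R[i]]_(v (qhead a), v (qtail a)).

HB.instance Definition _ := Uniform.copy rep
  (prod_topology (fun a : edge Q => 'M[R[i]]_(v (qhead a), v (qtail a)))).

Definition gauge_act (g : forall i, 'M[R[i]]_(v i)) (A : rep) : rep :=
  fun a => g (qhead a) *m A a *m invmx (g (qtail a)).

Definition subrep (A : rep) (V' : forall i, {vspace 'cV[R[i]]_(v i)}) : Prop :=
  forall a (x : 'cV[R[i]]_(v (qtail a))),
    x \in V' (qtail a) -> A a *m x \in V' (qhead a).

Definition slope (alpha : vertex Q -> R) (w : vertex Q -> nat) : R :=
  (\sum_i - alpha i * (w i)%:R) / (\sum_i w i)%:R.

Definition stable (alpha : vertex Q -> R) : set rep :=
  [set A | forall V' : forall i, {vspace 'cV[R[i]]_(v i)},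
    subrep A V' ->
    let w := fun i => \dim (V' i) in
    w <> (fun=> 0%N) -> w <> v -> slope alpha w < slope alpha v].

Variable alpha : vertex Q -> R.

Definition same_orbit (A B : stable alpha) : Prop :=
  exists g : forall i, 'M[R[i]]_(v i),
    (forall i, g i \in unitmx) /\ val B = gauge_act g (val A).

Definition orbit_rel (A B : stable alpha) : bool := `[< same_orbit A B >].

Lemma orbit_rel_equiv : equiv_class_of orbit_rel.
Proof.
have sym A B : same_orbit A B -> same_orbit B A.
  move=> [g [gu gB]]; exists (fun i => invmx (g i)); split=> [i|].
    by rewrite unitmx_inv.
  rewrite gB; apply: functional_extensionality_dep => a; rewrite /gauge_act invmxK.
  by rewrite !mulmxA mulVmx// mul1mx -mulmxA mulVmx// mulmx1.
split=> [A|A B|B A D].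
- apply/asboolP; exists (fun i => 1%:M); split=> [i|]; first exact: unitmx1.
  apply: functional_extensionality_dep => a.
  by rewrite /gauge_act invmx1 mul1mx mulmx1.
- by apply/asboolP/asboolP; exact: sym.
- move=> /asboolP[g [gu gB]] /asboolP[h [hu hD]]; apply/asboolP.
  exists (fun i => h i *m g i); split=> [i|]; first by rewrite unitmx_mul hu gu.
  rewrite hD gB; apply: functional_extensionality_dep => a.
  by rewrite /gauge_act invmx_mul// !mulmxA.
Qed.

Canonical orbit_equiv := EquivRelPack orbit_rel_equiv.

Definition moduli : Type := quotient_topology {eq_quot orbit_equiv}.

HB.instance Definition _ := Topological.on moduli.

End Representations.

Arguments stable R {Q} v alpha.
Arguments moduli R {Q} v alpha.

(* Vertex 1 is [true] and vertex 0 is [false]. The edges are the two loops at 1,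
   the n edges from 1 to 0 and the n edges from 0 to 1, in this order. *)
Definition adhm_quiver (n : nat) : quiver :=
  @Quiver bool ('I_2 + 'I_n + 'I_n)%type
    (fun a => match a with
              | inl (inl _) => true
              | inl (inr _) => false
              | inr _ => true
              end)
    (fun a => match a with
              | inl (inl _) => true
              | inl (inr _) => true
              | inr _ => false
              end).

Definition adhm_dim (k n : nat) : vertex (adhm_quiver n) -> nat :=
  fun i => if i then k else 1%N.
Arguments adhm_dim k n i : clear implicits.

Definition unitary_group (R : realType) (k : nat) : set 'M[R[i]]_k :=
  [set U | U \is unitarymx].
Arguments unitary_group R k : clear implicits.

(* Main.v *)
(* A representation is unstable iff some nonzero subspace of row vectors,
   invariant under the two loops (or under their transposes), is killed by the
   maps into (or out of) vertex 1.  Normalizing that subspace on a maximal minor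
   parametrizes the bounded unstable representations, Lipschitz-continuously, by
   finitely many boxes of dimension at most D = dim - 2(k - 1 + n).  So they are
   covered by O(m^D) cells of size 1/m, and a map from a cube of dimension less
   than 2(k - 1 + n) with stable boundary values is pushed off them, relative to
   the boundary, by a Lipschitz approximation and a small generic translation.
   This is the vanishing of pi_j of the stable representations, and more
   generally the extension of stable maps from the boundary of a cube.

   Since the gauge group at vertex 0 can be absorbed by scalars, the moduli space
   is the quotient by GL_k.  The Gram matrices of the Krylov data of two stable
   representations are equivariant, and invertible on the diagonal; they give a
   coarse parallel transport between nearby orbits, hence liftings to stable
   representations of maps from star-shaped compact sets to the moduli space.
   Lifting a loop of dimension j + 1 relative to all faces but one leaves a map
   from the last face into GL_k, which Gram-Schmidt deforms into U(k).  This
   clutching map is the boundary isomorphism pi_(j+1)(M) -> pi_j(U(k)), whose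
   bijectivity is the extension property above in dimensions j + 1 and j + 2. *)

(* The number 2(k - 1 + n) is the real codimension of the unstable locus. Choosing a subspace of
   dimension d costs d(k - d) complex parameters, while its invariance under two loops and its being
   killed by n vectors impose 2d(k - d) + dn conditions. The complex codimension is thus d(k - d +
   n), which for d between 1 and k is smallest at d = 1. The unstable locus is singular; counting
   cells avoids stratifying it, since only dimension bounds matter. A homotopy costs one more
   dimension, whence the final -1 in both ranges: contracting a j-sphere of stable representations,
   or joining two loops of dimension j in the moduli space, fills a cube of dimension j + 1. No
   slice or local trivialization of the quotient map is constructed. The Gram transport of a point
   depends on its orbit only, so it turns an arbitrary, discontinuous choice of representatives into
   continuous lifts. It also recovers a group element continuously from a point and its translate,
   which makes the clutching map continuous. *)
Require Import Defs.
From mathcomp Require Import all_boot all_order all_algebra generic_quotient.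
From mathcomp Require Import sesquilinear spectral complex.
From mathcomp Require Import all_classical reals topology normedtype realfun.
From mathcomp Require Import lra ring zify.

Set Implicit Arguments.
Unset Strict Implicit.
Unset Printing Implicit Defensive.

Import Order.TTheory GRing.Theory Num.Theory.
Import numFieldNormedType.Exports.

Local Open Scope classical_set_scope.
Local Open Scope ring_scope.
Local Open Scope quotient_scope.
Local Open Scope sesquilinear_scope.

(** * Covering numbers *)

(* Upper Minkowski dimension at most [D], with covers by [O(m ^ D)] pieces. *)
Definition small (R : realType) (T iota : Type) (coord : T -> iota -> R)
    (S : T -> Prop) (D : nat) :=
  exists C : nat, forall m : nat, (0 < m)%N ->
    exists (J : finType) (c : T -> J), (#|J| <= C * m ^ D)%N /\
      forall x y, S x -> S y -> c x = c y ->
      forall i, `|coord x i - coord y i| <= m%:R^-1.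

Section Small.
Variable R : realType.

Lemma cell_code (I : finType) (M m : nat) : (0 < m)%N ->
  exists c : (I -> R) -> {ffun I -> 'I_(2 * M * m).+1},
  forall r r' : I -> R, (forall i, `|r i| <= M%:R) ->
    (forall i, `|r' i| <= M%:R) -> c r = c r' ->
    forall i, `|r i - r' i| <= m%:R^-1.
Proof.
move=> m0; have m0R : 0 < m%:R :> R by rewrite ltr0n.
exists (fun r => [ffun i => inord (Num.truncn ((r i + M%:R) * m%:R))]).
move=> r r' rM rM' /ffunP e i.
have bd (s : I -> R) : (forall i, `|s i| <= M%:R) ->
    0 <= (s i + M%:R) * m%:R /\ (Num.truncn ((s i + M%:R) * m%:R) < (2 * M * m).+1)%N.
  move=> /(_ i); rewrite ler_norml => /andP[s1 s2].
  have s0 : 0 <= (s i + M%:R) * m%:R by apply: mulr_ge0; [lra|exact: ltW].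
  split=> //; rewrite ltnS -(ler_nat R); apply: le_trans (_ : (s i + M%:R) * m%:R <= _).
    by rewrite truncn_le.
  by rewrite !natrM ler_wpM2r ?(ltW m0R)//; lra.
have [r0 rt] := bd r rM; have [r0' rt'] := bd r' rM'.
have := congr1 (@nat_of_ord _) (e i); rewrite !ffunE !inordK// => tt.
have [/andP[a1 a2] /andP[b1 b2]] := (truncn_itv r0, truncn_itv r0').
rewrite tt in a1 a2.
have -> : r i - r' i = ((r i + M%:R) * m%:R - (r' i + M%:R) * m%:R) / m%:R.
  by rewrite -mulrBl mulfK ?gt_eqF//; lra.
rewrite normrM (@ger0_norm _ m%:R^-1) ?invr_ge0 ?ler0n//.
rewrite -[leRHS]mul1r ler_wpM2r ?invr_ge0 ?ler0n// ler_norml.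
move: a1 a2 b1 b2; set N := Num.truncn _ => a1 a2 b1 b2.
have e1 : N.+1%:R = N%:R + 1 :> R by rewrite natr1.
by move: a2 b2; rewrite e1; lra.
Qed.

Lemma card_cells (I : finType) (M m : nat) : (0 < m)%N ->
  (#|{ffun I -> 'I_(2 * M * m).+1}| <= (2 * M).+1 ^ #|I| * m ^ #|I|)%N.
Proof.
move=> m0; rewrite card_ffun card_ord -expnMn.
by case: #|I| => [|n]; rewrite ?expn0// leq_exp2r//; nia.
Qed.

Variables (T iota : Type) (coord : T -> iota -> R).

Lemma small_sub (S S' : T -> Prop) D : (forall x, S x -> S' x) ->
  small coord S' D -> small coord S D.
Proof.
move=> SS [C h]; exists C => m /h[J [c [cJ hc]]]; exists J, c; split=> // x y Sx Sy.
exact: hc (SS _ Sx) (SS _ Sy).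
Qed.

Lemma small_leq (S : T -> Prop) D D' : (D <= D')%N ->
  small coord S D -> small coord S D'.
Proof.
move=> DD [C h]; exists C => m m0; have [J [c [cJ hc]]] := h m m0.
exists J, c; split=> //; apply: leq_trans cJ _.
by rewrite leq_mul2l leq_pexp2l ?orbT.
Qed.

Lemma small_bigcup (I : finType) (S : I -> T -> Prop) D :
  (forall i, small coord (S i) D) -> small coord (fun x => exists i, S i x) D.
Proof.
(* The successor pays for the extra code [None], as [m ^ D] is at least 1. *)
move=> /choice[C h]; exists (\sum_i C i).+1%N => m m0.
have h' i : exists Jc : {J : finType & T -> J}, (#|projT1 Jc| <= C i * m ^ D)%N /\
    forall x y, S i x -> S i y -> projT2 Jc x = projT2 Jc y ->
      forall j, `|coord x j - coord y j| <= m%:R^-1.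
  by have [J [c hc]] := h i m m0; exists (existT _ J c).
have [Jc hJ] := choice h'.
pose pk x : option I := [pick i | `[< S i x >]].
have pkP x : (exists i, S i x) -> exists2 i, pk x = Some i & S i x.
  rewrite /pk; case: pickP => [i /asboolP Si _|no [i Si]]; first by exists i.
  by have := no i; rewrite asboolT.
exists (option {i : I & projT1 (Jc i)}),
  (fun x => omap (fun i => Tagged (fun i => projT1 (Jc i)) (projT2 (Jc i) x)) (pk x)).
split=> [|x y /pkP[i pi Si] /pkP[i' pi' Si']].
  rewrite card_option card_tagged sumnE big_map big_enum /=.
  rewrite mulSn -add1n leq_add ?expn_gt0 ?m0//.
  by rewrite big_distrl /=; apply: leq_sum => i _; case: (hJ i).
rewrite pi pi' /= => -[] ii; subst i' => /eqP; rewrite eq_Tagged /= => /eqP.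
exact: (hJ i).2.
Qed.

(** The source of every dimension bound on unstable sets. The cells are those of the parameters, so
    nothing is asked of [r] beyond boundedness and Lipschitz control of the coordinates. *)
Lemma small_params (I : finType) (S : T -> Prop) (r : T -> I -> R) (M L : nat) :
  (forall x, S x -> forall i, `|r x i| <= M%:R) ->
  (forall x y e, S x -> S y -> 0 <= e -> (forall i, `|r x i - r y i| <= e) ->
    forall i, `|coord x i - coord y i| <= L%:R * e) ->
  small coord S #|I|.
Proof.
move=> rM rL; exists ((2 * M).+1 ^ #|I| * L.+1 ^ #|I|)%N => m m0.
(* Refining the parameter grid by [L.+1] absorbs the Lipschitz constant. *)
have m1 : (0 < L.+1 * m)%N by rewrite muln_gt0.
have [c hc] := cell_code I M m1.
exists {ffun I -> 'I_(2 * M * (L.+1 * m)).+1}, (fun x => c (r x)); split.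
  by apply: leq_trans (card_cells _ _ m1) _; rewrite expnMn mulnA.
move=> x y Sx Sy cc i; have e0 : 0 <= (L.+1 * m)%:R^-1 :> R by rewrite invr_ge0.
apply: le_trans (rL x y _ Sx Sy e0 (hc _ _ (rM x Sx) (rM y Sy) cc) i) _.
rewrite natrM invfM mulrA ler_piMl ?invr_ge0// ler_pdivrMr ?ltr0n// mul1r.
by rewrite ler_nat.
Qed.

End Small.

Lemma box_not_small (R : realType) (E D : nat) (a : R) (S : 'rV[R]_E -> Prop) :
  (D < E)%N -> 0 < a -> (forall p : 'rV_E, (forall i, 0 <= p 0 i <= a) -> S p) ->
  ~ small (fun p : 'rV[R]_E => p 0) S D.
Proof.
move=> DE a0 bS [C h].
(* Pigeonhole: at least [m ^ E] grid points, with spacing [a / m] larger than the cell size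
   [1 / (k m)], against at most [C (k m) ^ D] codes, a number below [m ^ (D + 1)]. *)
pose k := (Num.truncn a^-1).+1; pose m := (C * k.+1 ^ D).+1%N.
have k0 : (0 < k)%N by [].
have ak : a^-1 < k%:R by rewrite truncnS_gt.
have [|J [c [cJ hc]]] := h (k * m)%N _; first by rewrite muln_gt0 k0.
pose p (f : {ffun 'I_E -> 'I_m.+1}) : 'rV[R]_E := \row_i (a * (f i)%:R / m%:R).
have m0 : 0 < m%:R :> R by rewrite ltr0n.
have Sp f : S (p f).
  apply: bS => i; rewrite mxE -mulrA; apply/andP; split.
    by rewrite mulr_ge0 ?(ltW a0)// mulr_ge0// invr_ge0.
  rewrite ger_pMr// ler_pdivrMr// mul1r ler_nat; have := ltn_ord (f i); lia.
suff cinj : injective (c \o p).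
  have := leq_card _ cinj; rewrite card_ffun !card_ord => le1.
  have := leq_trans le1 cJ; apply/negP; rewrite -ltnNge expnMn mulnA.
  apply: (@leq_trans (m * m ^ D)).
    rewrite ltn_pmul2r ?expn_gt0// /m ltnS leq_mul2l.
    by apply/orP; right; case: (D) => // d; rewrite leq_exp2r.
  by rewrite -expnS (@leq_trans (m ^ E))// ?leq_pexp2l// leq_exp2r//; lia.
move=> f g fg; apply/ffunP => i; apply/val_inj/eqP; rewrite /=.
have := hc _ _ (Sp f) (Sp g) fg i; rewrite !mxE; apply: contraTT => ne.
rewrite -ltNge natrM invfM -mulrBl -mulrBr normrM (@ger0_norm _ m%:R^-1) ?invr_ge0//.
rewrite ltr_pM2r ?invr_gt0// normrM gtr0_norm//.
apply: (@lt_le_trans _ _ a).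
  by rewrite invf_plt ?posrE// ltr0n.
have dist u v : (u < v)%N -> 1 <= `|v%:R - u%:R| :> R.
  move=> uv; rewrite -natrB 1?ltnW// normr_nat ler1n; lia.
rewrite ler_peMr ?(ltW a0)//; move: ne; rewrite neq_ltn => /orP[] lt.
  by rewrite distrC; exact: dist.
exact: dist.
Qed.

(** * General position *)

Section MinMax.
Context (R : realType) (T : Type) (F : set_system T) {FF : Filter F}.
Variables (f g : T -> R) (a b : R).
Hypotheses (fa : f x @[x --> F] --> a) (gb : g x @[x --> F] --> b).

Lemma cvg_min : Num.min (f x) (g x) @[x --> F] --> Num.min a b.
Proof.
rewrite minr_absE (_ : (fun x => _) = fun x => (f x + g x - `|f x - g x|) / 2).
  by apply: cvgMr_tmp; apply: cvgB; [exact: cvgD|apply: cvg_norm; exact: cvgB].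
by apply/funext => x; rewrite minr_absE.
Qed.

Lemma cvg_max : Num.max (f x) (g x) @[x --> F] --> Num.max a b.
Proof.
rewrite maxr_absE (_ : (fun x => _) = fun x => (f x + g x + `|f x - g x|) / 2).
  by apply: cvgMr_tmp; apply: cvgD; [exact: cvgD|apply: cvg_norm; exact: cvgB].
by apply/funext => x; rewrite maxr_absE.
Qed.

End MinMax.

(** * Lebesgue numbers and Lipschitz approximation on compact sets *)

Section Lipschitz.
Variables (R : realType) (T : normedModType R).

(** A Lebesgue number for a relation that holds locally. It serves for uniform continuity and for
    the step length of [orbit_lift]. *)
Lemma compact_uniform (K : set T) (P : T -> T -> Prop) : compact K ->
  (forall t0, K t0 -> exists2 U : set T, nbhs t0 U &
     forall t t', U t -> U t' -> K t -> K t' -> P t t') ->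
  exists2 eta : R, 0 < eta &
    forall t t', K t -> K t' -> `|t - t'| < eta -> P t t'.
Proof.
move=> /compact_near_coveringP/near_covering_withinP cK loc.
have := cK R (0^'+) (fun e t => forall t', K t' -> `|t - t'| < e -> P t t') _ _.
case=> [x Kx|].
  have [U /nbhs_ballP[r /= r0 rU] UP] := loc x Kx.
  have r2 : 0 < r / 2 by rewrite divr_gt0.
  exists (ball x (r / 2), [set e | e < r / 2]); first split => /=.
  - exact: nbhsx_ballx.
  - exact: nbhs_right_lt.
  - move=> [t e] /= [xt er] Kt t' Kt' tt'; apply: UP => //; apply: rU.
      by apply: le_ball xt; lra.
    rewrite -ball_normE /= in xt *; rewrite -(subrKA t).
    by apply: le_lt_trans (ler_normD _ _) _; lra.
move=> e /= e0 he; exists (e / 2); first by rewrite divr_gt0.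
move=> t t' Kt Kt' tt'; apply: (he (e / 2)) => //=; last by rewrite divr_gt0.
by rewrite sub0r normrN ger0_norm; lra.
Qed.

(** The approximation is the inf-convolution of [f] with [L] times the distance, which is Lipschitz
    on the whole space and at most [f] on [K]. *)
Lemma lipschitz_approx1 (K : set T) (f : T -> R) (d : R) : compact K ->
  {within K, continuous f} -> 0 < d ->
  exists g : T -> R, (exists2 L, 0 <= L & forall t t', `|g t - g t'| <= L * `|t - t'|) /\
    forall t, K t -> `|g t - f t| <= d.
Proof.
move=> cK cf d0.
have [->|/set0P[a Ka]] := eqVneq K set0.
  exists (fun=> 0); split=> //; exists 0 => // t t'.
  by rewrite subrr normr0 mul0r.
have [eta eta0 unif] : exists2 eta : R, 0 < eta &
    forall t t', K t -> K t' -> `|t - t'| < eta -> `|f t - f t'| <= d.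
  apply: compact_uniform => // t0 Kt0.
  have /subspace_continuousP/(_ t0 Kt0) := cf.
  move/cvgrPdist_lt/(_ (d / 2)); rewrite divr_gt0// => /(_ isT) near_f.
  exists [set t | K t -> `|f t0 - f t| < d / 2]; first exact: near_f.
  move=> t t' /= h h' /h Kt /h' Kt'; rewrite -(subrKA (f t0)).
  apply: le_trans (ler_normD _ _) _; rewrite distrC; lra.
have [M Mf] : exists M, forall t, K t -> `|f t| <= M.
  have /compact_bounded : compact (f @` K) by exact: continuous_compact.
  move=> [N [_ hN]]; exists (N + 1) => t Kt.
  by apply: (hN (N + 1)) => /=; [rewrite ltrDl|exists t].
have M0 : 0 <= M by apply: le_trans (Mf a Ka).
(* Beyond distance [eta] the penalty is at least [2 * M], which bounds the oscillation of [f];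
   closer points are handled by uniform continuity. *)
pose L := 2 * M / eta; have L0 : 0 <= L by rewrite divr_ge0 ?mulr_ge0 ?(ltW eta0).
pose A t := [set f x + L * `|t - x| | x in K].
have lbA t y : A t y -> - M <= y.
  move=> [x Kx <-]; have := Mf x Kx; rewrite ler_norml => /andP[? _].
  by apply: le_trans (_ : f x <= _) => //; rewrite lerDl mulr_ge0.
have infA t : has_inf (A t).
  split; first by exists (f a + L * `|t - a|), a.
  by exists (- M) => y; exact: lbA.
have infle t x : K x -> inf (A t) <= f x + L * `|t - x|.
  by move=> Kx; apply: ge_inf; [exact: (infA t).2|exists x].
have leinf t y : (forall x, K x -> y <= f x + L * `|t - x|) -> y <= inf (A t).
  by move=> h; apply: lb_le_inf; [exact: (infA t).1|move=> _ [x Kx <-]; exact: h].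
exists (fun t => inf (A t)); split.
  exists L => // t t'.
  have half u u' : inf (A u) - L * `|u - u'| <= inf (A u').
    apply: leinf => x Kx; rewrite lerBlDr; apply: le_trans (infle u x Kx) _.
    rewrite -addrA lerD2l -mulrDr ler_wpM2l// [leRHS]addrC -[u - x](subrKA u').
    exact: ler_normD.
  have := half t t'; have := half t' t; rewrite (distrC t' t) ler_norml; lra.
move=> t Kt; rewrite ler_norml; apply/andP; split; last first.
  by have := infle t t Kt; rewrite subrr normr0 mulr0; lra.
rewrite lerBrDl; apply: leinf => x Kx.
have [lt|ge] := ltP `|t - x| eta.
  have := unif t x Kt Kx lt; rewrite ler_norml => /andP[_ ?].
  have : 0 <= L * `|t - x| by rewrite mulr_ge0.
  lra.
have : L * eta <= L * `|t - x| by rewrite ler_wpM2l.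
rewrite /L divfK ?gt_eqF//.
have := Mf x Kx; have := Mf t Kt; rewrite !ler_norml; lra.
Qed.

End Lipschitz.

Section RowNorm.
Variables (R : realType) (E : nat).
Implicit Types x : 'rV[R]_E.

Lemma row_norm_le x (e : R) : 0 <= e -> (forall i, `|x 0 i| <= e) -> `|x| <= e.
Proof.
move=> e0 h; rewrite [leLHS]mx_normrE; apply: bigmax_le => // -[i j] _ /=.
by rewrite (ord1 i).
Qed.

Lemma coord_norm_le x i : `|x 0 i| <= `|x|.
Proof. by rewrite [leRHS]mx_normrE (le_bigmax _ _ (0, i)). Qed.

Lemma row_norm_attained x : `|x| != 0 -> exists i, `|x| = `|x 0 i|.
Proof.
by move=> /mx_norm_neq0[[i j] /= e]; exists j; rewrite [LHS]e (ord1 i).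
Qed.

Lemma lipschitz_approx (T : normedModType R) (K : set T) (f : T -> 'rV[R]_E) (d : R) :
  compact K -> {within K, continuous f} -> 0 < d ->
  exists g : T -> 'rV[R]_E,
    (exists2 L, 0 <= L & forall t t', `|g t - g t'| <= L * `|t - t'|) /\
    forall t, K t -> `|g t - f t| <= d.
Proof.
move=> cK cf d0.
have cfi i : {within K, continuous (fun t => f t 0 i)}.
  apply/subspace_continuousP => t Kt; have /subspace_continuousP/(_ t Kt) cft := cf.
  exact: (continuous_cvg _ (@coord_continuous _ _ _ 0 i (f t)) cft).
have /choice[g hg] i := lipschitz_approx1 cK (cfi i) d0.
have /choice[L hL] i : exists L, 0 <= L /\ forall t t', `|g i t - g i t'| <= L * `|t - t'|.
  by have [[L]] := hg i; exists L.
exists (fun t => \row_i g i t); split; last first.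
  move=> t Kt; apply: row_norm_le => [|i]; first exact: ltW.
  by rewrite !mxE; exact: (hg i).2.
have S0 : 0 <= \sum_i L i by apply: sumr_ge0 => i _; case: (hL i).
exists (\sum_i L i) => // t t'; apply: row_norm_le => [|i]; first exact: mulr_ge0.
rewrite !mxE; apply: le_trans ((hL i).2 t t') _; rewrite ler_wpM2r//.
rewrite (bigD1 i)//= lerDl; apply: sumr_ge0 => j _; by case: (hL j).
Qed.

End RowNorm.

Section GeneralPosition.
Variable R : realType.

Lemma compact_cube e : compact (@cube R e).
Proof.
have := @rV_compact R e (fun=> `[0, 1]%classic) (fun=> @segment_compact R 0 1).
by congr compact; apply/seteqP; split=> t /= h i; have := h i; rewrite /= in_itv.
Qed.

(** On the cube, the sup-norm distance to the boundary. In dimension 0 it is 1/2, in agreement with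
    the empty boundary. *)
Definition depth e (t : 'rV[R]_e) : R := 2^-1 - `|t - const_mx 2^-1|.

Lemma depth_lip e (t t' : 'rV[R]_e) : `|depth t - depth t'| <= `|t - t'|.
Proof.
have -> : depth t - depth t' = `|t' - const_mx 2^-1| - `|t - const_mx 2^-1|.
  by rewrite /depth; lra.
by apply: le_trans (ler_dist_dist _ _) _; rewrite opprB addrA subrK distrC.
Qed.

Lemma depth_ge0 e (t : 'rV[R]_e) : cube t -> 0 <= depth t.
Proof.
move=> ct; rewrite subr_ge0; apply: row_norm_le => [|i]; first by rewrite invr_ge0.
by rewrite !mxE ler_norml; have := ct i; lra.
Qed.

Lemma depth_le1 e (t : 'rV[R]_e) : depth t <= 1.
Proof. by have := normr_ge0 (t - const_mx 2^-1); rewrite /depth; lra. Qed.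

Lemma depth_eq0 e (t : 'rV[R]_e) : cube t -> depth t = 0 -> cube_boundary t.
Proof.
move=> ct /eqP; rewrite subr_eq0 => /eqP d0; split=> //.
have [|i] := @row_norm_attained R e (t - const_mx 2^-1).
  by rewrite -d0 invr_eq0 pnatr_eq0.
rewrite -d0 !mxE => hi; exists i; move: hi.
by have [_|_] := ler0P (t 0 i - 2^-1); [left|right]; lra.
Qed.

Lemma depth_boundary e (t : 'rV[R]_e) : cube_boundary t -> depth t = 0.
Proof.
move=> [ct [i hi]]; apply: le_anti; rewrite depth_ge0// andbT subr_le0.
apply: le_trans (coord_norm_le _ i); rewrite !mxE.
by case: hi => ->; [rewrite sub0r normrN|]; rewrite ger0_norm; lra.
Qed.

Lemma depth_continuous e : continuous (@depth e).
Proof.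
move=> t; apply: (iffRL (@cvgrPdist_lt _ _ _ (nbhs t) (nbhs_filter t) _ _)) => r r0.
apply: filterS (nbhsx_ballx t r r0) => t'; rewrite -ball_normE /=.
exact: le_lt_trans (depth_lip _ _).
Qed.

(* [f] is corrected to [f + theta (g - f) + depth p], with [g] a Lipschitz
   approximation and [theta] vanishing on the boundary. Where the depth is at
   least [eta], the bad vectors are [p = (z - g t) / depth t], and as [z] and
   [t] are described by fewer than [E] real parameters, some [p] in any given
   box is good. *)
Theorem general_position e E D (Z : set 'rV[R]_E) (f : 'rV[R]_e -> 'rV[R]_E) :
  closed Z ->
  (forall M : nat, small (fun p : 'rV[R]_E => p 0)
     (fun z => Z z /\ forall i, `|z 0 i| <= M%:R) D) ->
  (D + e < E)%N ->
  {within @cube R e, continuous f} ->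
  (forall t, cube_boundary t -> ~ Z (f t)) ->
  exists f' : 'rV[R]_e -> 'rV[R]_E,
    [/\ {within @cube R e, continuous f'}, (forall t, cube t -> ~ Z (f' t)) &
        forall t, cube_boundary t -> f' t = f t].
Proof.
move=> clZ smZ DE cf bf.
(* By compactness: at a boundary point [Z] is closed and misses [f t]; at an interior point the
   depth is locally bounded below, so a small [eta] makes the condition vacuous. *)
have [eta eta0 heta] : exists2 eta : R, 0 < eta & forall t, cube t ->
    depth t <= eta -> forall z, `|z - f t| <= eta -> ~ Z z.
  have /compact_near_coveringP/near_covering_withinP cK := @compact_cube e.
  have := cK R (0^'+) (fun eta t => depth t <= eta ->
     forall z, `|z - f t| <= eta -> ~ Z z) _ _.
  case=> [t0 ct0|].
    have := depth_ge0 ct0; rewrite le_eqVlt => /orP[/eqP d0|d0].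
      have nZ : nbhs (f t0) (~` Z).
        by apply: open_nbhs_nbhs; split; [exact: closed_openC|exact/bf/depth_eq0].
      have [r /= r0 rZ] := (nbhs_ballP _ _).1 nZ.
      have /subspace_continuousP/(_ t0 ct0)/cvgrPdist_lt/(_ (r / 2)) := cf.
      rewrite divr_gt0// => /(_ isT) nf.
      exists ([set t | cube t -> `|f t0 - f t| < r / 2], [set e | e < r / 2]).
        by split => /=; [exact: nf|apply: nbhs_right_lt; rewrite divr_gt0].
      move=> [t x] /= [ft xr] ct _ z zf; apply: rZ.
      rewrite -ball_normE /= -(subrKA (f t)); apply: le_lt_trans (ler_normD _ _) _.
      by have := ft ct; rewrite (distrC (f t) z); lra.
    exists ([set t | depth t0 / 2 < depth t], [set e | e < depth t0 / 2]).
      split => /=; last by apply: nbhs_right_lt; rewrite divr_gt0.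
      have /cvgr_gt := @depth_continuous e t0; apply; lra.
    move=> [t x] /= [dt xr] ct; lra.
  move=> x /= x0 hx; exists (x / 2); first by rewrite divr_gt0.
  move=> t ct; apply: (hx (x / 2)) => //=; last by rewrite divr_gt0.
  by rewrite sub0r normrN ger0_norm; lra.
(* Each of the two corrections has norm at most [d], so together they stay in the [eta]-tube where
   [Z] is absent. *)
pose d := eta / 2; have d0 : 0 < d by rewrite divr_gt0.
have [g [[L L0 gL] gf]] := lipschitz_approx (@compact_cube e) cf d0.
pose bad (p : 'rV[R]_E) := exists2 t, cube t /\ eta <= depth t &
  Z (g t + depth t *: p).
have [p pbox pgood] : exists2 p : 'rV[R]_E, (forall i, 0 <= p 0 i <= d) & ~ bad p.
  apply: contrapT => nop.
  have allbad (p : 'rV[R]_E) : (forall i, 0 <= p 0 i <= d) -> bad p.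
    by move=> pb; apply: contrapT => np; apply: nop; exists p.
  pose box (p : 'rV[R]_E) := forall i, 0 <= p 0 i <= d.
  have /choice[tau htau] : forall p : 'rV[R]_E, exists t : 'rV[R]_e, box p ->
      [/\ cube t, eta <= depth t & Z (g t + depth t *: p)].
    move=> p; have [/allbad[t [? ?] ?]|?] := pselect (box p); first by exists t.
    by exists 0.
  pose M := (Num.truncn (`|g 0| + L + d)).+1.
  have zM p : box p -> forall i, `|(g (tau p) + depth (tau p) *: p) 0 i| <= M%:R.
    move=> bp i; have [ct _ _] := htau p bp.
    apply: (@le_trans _ _ (`|g 0| + L + d)); last by rewrite ltW// truncnS_gt.
    rewrite mxE [_ 0 i in X in _ + X]mxE; apply: le_trans (ler_normD _ _) (lerD _ _).
      apply: le_trans (coord_norm_le _ _) _; rewrite -{1}[g _](subrK (g 0)) addrC.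
      apply: le_trans (ler_normD _ _) _; rewrite lerD2l.
      apply: le_trans (gL _ _) _; rewrite subr0 ler_piMr//.
      by apply: row_norm_le => // j; rewrite ger0_norm; have := ct j; lra.
    have /andP[p0 pd] := bp i.
    rewrite normrM (ger0_norm (depth_ge0 ct)) (ger0_norm p0).
    by apply: le_trans pd; rewrite ler_piMl// depth_le1.
  (* A Lipschitz constant of [p] as a function of [z] and [t]: subtracting the equations for [p] and
     [p'] leaves [depth * (p - p')], and the depth is at least [eta]. *)
  pose K := (Num.truncn ((1 + L + d) / eta)).+1.
  have K0 : (0 < K)%N by [].
  have Kb : (1 + L + d) / eta <= K%:R by rewrite ltW// truncnS_gt.
  apply: (@box_not_small R E (D + e) d box DE d0) => //.
  have [C hC] := smZ M.
  exists (C * K ^ D * ((2 * 1).+1 ^ e * K ^ e))%N => m m0.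
  have Km : (0 < K * m)%N by rewrite muln_gt0 K0.
  have [J [c [cJ hc]]] := hC _ Km.
  have [c' hc'] := cell_code R 'I_e 1 Km.
  exists (J * {ffun 'I_e -> 'I_(2 * 1 * (K * m)).+1})%type,
    (fun p => (c (g (tau p) + depth (tau p) *: p), c' (fun i => tau p 0 i))); split.
    rewrite card_prod; have := card_cells 'I_e 1 Km; rewrite card_ord => c'J.
    apply: leq_trans (leq_mul cJ c'J) _.
    by rewrite !expnMn expnD; apply: eq_leq; ring.
  move=> p p' bp bp' [cc cc'] i.
  have [ct dt Zt] := htau p bp; have [ct' dt' Zt'] := htau p' bp'.
  have eps0 : 0 <= (K * m)%:R^-1 :> R by rewrite invr_ge0.
  have tt : `|tau p - tau p'| <= (K * m)%:R^-1.
    apply: row_norm_le => // j; rewrite !mxE; apply: hc' cc' j => j.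
      by rewrite ger0_norm; have := ct j; lra.
    by rewrite ger0_norm; have := ct' j; lra.
  have zz := hc _ _ (conj Zt (zM p bp)) (conj Zt' (zM p' bp')) cc i.
  have gg : `|g (tau p) 0 i - g (tau p') 0 i| <= L * (K * m)%:R^-1.
    have := coord_norm_le (g (tau p) - g (tau p')) i; rewrite !mxE => h.
    by apply: le_trans h (le_trans (gL _ _) _); rewrite ler_wpM2l.
  have dd := le_trans (depth_lip (tau p) (tau p')) tt.
  move: zz; rewrite !mxE; have /andP[p0 pd] := bp' i.
  set q := p 0 i; set q' := p' 0 i in p0 pd *; set ep := _^-1 in eps0 tt gg dd *.
  move: gg dd dt; set a := g _ 0 i; set a' := g _ 0 i; set r := depth _; set r' := depth _.
  move=> gg dd dt zz.
  have e1 : r * (q - q') = (a + r * q - (a' + r' * q')) - (a - a') - q' * (r - r').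
    by ring.
  have b1 : `|r * (q - q')| <= ep + L * ep + d * ep.
    rewrite e1; apply: le_trans (ler_normB _ _) (lerD _ _); last first.
      by rewrite normrM; apply: ler_pM => //; rewrite ger0_norm.
    by apply: le_trans (ler_normB _ _) (lerD _ _).
  have r0 : 0 < r by apply: lt_le_trans dt.
  have b2 : eta * `|q - q'| <= (1 + L + d) * ep.
    apply: le_trans (_ : `|r * (q - q')| <= _); last by move: b1; lra.
    by rewrite normrM (gtr0_norm r0) ler_wpM2r.
  have b3 : `|q - q'| <= (1 + L + d) / eta * ep.
    by rewrite mulrAC ler_pdivlMr// mulrC.
  apply: le_trans b3 _; apply: le_trans (ler_wpM2r eps0 Kb) _.
  by rewrite /ep natrM invfM mulrA divff ?mul1r// pnatr_eq0.
exists (fun t => f t + Num.min 1 (depth t / eta) *: (g t - f t) + depth t *: p).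
split.
- apply/subspace_continuousP => t ct.
  have /subspace_continuousP/(_ t ct) cft := cf.
  have cd : depth x @[x --> within (@cube R e) (nbhs t)] --> depth t.
    exact: cvg_within_filter (@depth_continuous e t).
  have cg : g x @[x --> within (@cube R e) (nbhs t)] --> g t.
    apply: cvg_within_filter; apply/cvgrPdist_lt => r r0.
    have r1 : 0 < r / (L + 1) by rewrite divr_gt0// ltr_wpDl.
    apply: filterS (nbhsx_ballx t _ r1) => t'; rewrite -ball_normE /= => tt.
    apply: le_lt_trans (gL _ _) _; apply: le_lt_trans (_ : (L + 1) * `|t - t'| < _).
      by rewrite ler_wpM2r// lerDl.
    by rewrite mulrC -ltr_pdivlMr// ltr_wpDl.
  apply: cvgD; first apply: cvgD => //.
    apply: cvgZ; last exact: cvgB.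
    by apply: cvg_min; [exact: cvg_cst|apply: cvgMr_tmp].
  by apply: cvgZ => //; exact: cvg_cst.
- move=> t ct; have := depth_ge0 ct => dt0.
  have np : `|p| <= d.
    apply: row_norm_le => [|i]; first exact: ltW.
    by rewrite ler_norml; have := pbox i; lra.
  have [lt|ge] := leP (depth t) eta.
    apply: (heta t ct lt); rewrite -[X in X - _]addrA (addrC (f t)) addrK.
    apply: le_trans (ler_normD _ _) _; rewrite !normrZ.
    set mn := Num.min _ _; have /andP[m0 m1] : 0 <= mn <= 1.
      by rewrite le_min ler01 divr_ge0 ?(ltW eta0)//= ge_min lexx.
    rewrite (ger0_norm m0) (ger0_norm dt0).
    have -> : eta = 1 * d + 1 * d by rewrite /d; lra.
    by apply: lerD; apply: ler_pM => //; [exact: gf|exact: depth_le1].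
  move=> Zt; apply: pgood; exists t; first by split=> //; exact: ltW.
  move: Zt; rewrite min_l; last by rewrite ler_pdivlMr// mul1r ltW.
  by rewrite scale1r (addrC (f t)) subrK.
- by move=> t bt; rewrite (depth_boundary bt) mul0r min_r// !scale0r !addr0.
Qed.
End GeneralPosition.

(** * Gram matrices of Krylov data *)

Section Gram.
Variables (C : numClosedFieldType) (k n : nat).

Definition triple : Type := 'M[C]_k * 'M[C]_k * 'M[C]_(k, n).
Implicit Types x y : triple.

Definition triple_act (g : 'M[C]_k) x : triple :=
  (g *m x.1.1 *m invmx g, g *m x.1.2 *m invmx g, g *m x.2).

(** For [x = (A, B, I)] and [y = (A', B', I')], the sum over words [w] of length at most [l] of
    [w(A, B) I] times the adjoint of [w(A', B') I']. The recursion peels off the first letter. *)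
Fixpoint gram x y l : 'M[C]_k :=
  x.2 *m y.2^t* + if l is l'.+1 then
    x.1.1 *m gram x y l' *m y.1.1^t* + x.1.2 *m gram x y l' *m y.1.2^t*
  else 0.

Lemma adjmx_mul p q r (A : 'M[C]_(p, q)) (B : 'M_(q, r)) :
  (A *m B)^t* = B^t* *m A^t*.
Proof. by rewrite trmx_mul map_mxM. Qed.

Lemma adjmx_unit (g : 'M[C]_k) : g \in unitmx -> g^t* \in unitmx.
Proof. by move=> gu; rewrite map_unitmx unitmx_tr. Qed.

Lemma adjmx_inv (g : 'M[C]_k) : (invmx g)^t* = invmx (g^t*).
Proof. by rewrite trmx_inv map_invmx. Qed.

Lemma gram_act g h x y l : g \in unitmx -> h \in unitmx ->
  gram (triple_act g x) (triple_act h y) l = g *m gram x y l *m h^t*.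
Proof.
move=> gu hu; have hu' := adjmx_unit hu.
elim: l => [|l /= ->]; rewrite /= ?addr0 !adjmx_mul ?adjmx_inv.
  by rewrite !mulmxA.
rewrite !mulmxDr !mulmxDl !mulmxA !mulmxKV//.
by rewrite !(mulmxK hu').
Qed.

Definition degenerate x := exists U : 'M[C]_k,
  [/\ U != 0, U *m x.2 = 0, (U *m x.1.1 <= U)%MS & (U *m x.1.2 <= U)%MS].

Lemma gram_psd x l (v : 'rV[C]_k) : 0 <= (v *m gram x x l *m v^t*) 0 0.
Proof.
have pos m (w : 'rV[C]_m) : 0 <= (w *m w^t*) 0 0 by rewrite -dotmxE dnorm_ge0.
elim: l v => [|l IH] v /=.
  by rewrite addr0 mulmxA -[_ *m _ *m v^t*]mulmxA -adjmx_mul.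
rewrite !mulmxDr !mulmxDl [in leRHS]mxE addr_ge0//.
  by rewrite mulmxA -[_ *m _ *m v^t*]mulmxA -adjmx_mul.
rewrite [in leRHS]mxE addr_ge0//.
  by rewrite !mulmxA -[_ *m _ *m v^t*]mulmxA -adjmx_mul.
by rewrite !mulmxA -[_ *m _ *m v^t*]mulmxA -adjmx_mul.
Qed.

(* The row vectors killed by [w(A, B) I] for all words [w] of length at most [l]. *)
Fixpoint unobservable x l : 'M[C]_k :=
  if l is l'.+1 then
    (kermx x.2 :&: (kermx (x.1.1 *m cokermx (unobservable x l')) :&:
                    kermx (x.1.2 *m cokermx (unobservable x l'))))%MS
  else kermx x.2.

Lemma unobservableS x l m (V : 'M[C]_(m, k)) :
  (V <= unobservable x l.+1)%MS =
  [&& V *m x.2 == 0, (V *m x.1.1 <= unobservable x l)%MS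
    & (V *m x.1.2 <= unobservable x l)%MS].
Proof. by rewrite /= !sub_capmx !sub_kermx ![(_ *m _ <= unobservable _ _)%MS]submxE !mulmxA. Qed.

(** The quadratic form is a sum of squared norms of the vectors [v w(A, B) I], so it vanishes only
    if each of them does. *)
Lemma gram_unobservable x l (v : 'rV[C]_k) :
  (v *m gram x x l *m v^t*) 0 0 = 0 -> (v <= unobservable x l)%MS.
Proof.
have eq0 m (w : 'rV[C]_m) : (w *m w^t*) 0 0 = 0 -> w = 0.
  by rewrite -dotmxE => /eqP; rewrite dnorm_eq0 => /eqP.
have pos m (w : 'rV[C]_m) : 0 <= (w *m w^t*) 0 0 by rewrite -dotmxE dnorm_ge0.
elim: l v => [|l IH] v.
  rewrite /= addr0 mulmxA -[_ *m _ *m v^t*]mulmxA -adjmx_mul => /eq0 v0.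
  by rewrite sub_kermx v0.
rewrite unobservableS /= !mulmxDr !mulmxDl !mulmxA.
rewrite -[_ *m v^t*]mulmxA -adjmx_mul -[_ *m v^t*]mulmxA -adjmx_mul.
rewrite -[X in _ + (_ + X)]mulmxA -adjmx_mul.
set a := v *m x.2; set b := v *m x.1.1; set c := v *m x.1.2.
rewrite [LHS]mxE [X in _ + X]mxE => /eqP.
rewrite paddr_eq0 ?pos ?addr_ge0 ?gram_psd// => /andP[/eqP a0].
rewrite paddr_eq0 ?gram_psd// => /andP[/eqP b0 /eqP c0].
by rewrite (eq0 _ _ a0) eqxx (IH _ b0) (IH _ c0).
Qed.

Lemma unobservable_decr x l : (unobservable x l.+1 <= unobservable x l)%MS.
Proof.
elim: l => [|l IH]; first by rewrite /= capmxSl.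
have := submx_refl (unobservable x l.+2).
rewrite (unobservableS x l.+1) => /and3P[e1 e2 e3].
rewrite (unobservableS x l (unobservable x l.+2)) e1.
by rewrite (submx_trans e2) ?(submx_trans e3).
Qed.

(** If the decreasing chain stalls at a nonzero space, that space is invariant and killed by [x.2],
    a degeneracy. Otherwise the rank drops at every step, so [k] steps exhaust it. *)
Lemma nondegenerate_unobservable x : ~ degenerate x -> unobservable x k = 0.
Proof.
move=> nd; apply/eqP; rewrite -mxrank_eq0 -leqn0 -(subnn k).
have step l : (\rank (unobservable x l) <= k - l)%N; last exact: step.
elim: l => [|l IH]; first by rewrite subn0 rank_leq_row.
have [U0|U0] := eqVneq (unobservable x l) 0.
  have := unobservable_decr x l; rewrite U0 submx0 => /eqP ->.
  by rewrite mxrank0.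
suff lt : (unobservable x l.+1 < unobservable x l)%MS.
  have := rank_ltmx lt; lia.
rewrite /ltmx unobservable_decr /=; apply/negP => le; apply: nd.
exists (unobservable x l).
by move: le; rewrite unobservableS => /and3P[/eqP ? ? ?]; split.
Qed.

Lemma nondegenerate_gram x : ~ degenerate x -> gram x x k \in unitmx.
Proof.
move=> /nondegenerate_unobservable U0; rewrite -row_free_unit -kermx_eq0.
apply/rowV0P => v /sub_kermxP v0; apply/eqP; rewrite -submx0 -U0.
by apply: gram_unobservable; rewrite v0 mul0mx mxE.
Qed.

End Gram.

(** * Covering numbers of unstable representations *)

Section MaximalMinor.
Variable F : numFieldType.

(** The cofactors along column [i] do not involve that column, so they are those of the identity. *)
Lemma det_id_but_col d (M : 'M[F]_d) (i : 'I_d) :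
  (forall a b, b != i -> M a b = (a == b)%:R) -> \det M = M i i.
Proof.
move=> hM; have adj1 : \adj 1%:M = 1%:M :> 'M[F]_d.
  by rewrite -[LHS]mul1mx mul_mx_adj det1.
have cof a : cofactor M a i = (i == a)%:R.
  have <- : (\adj 1%:M : 'M[F]_d) i a = (i == a)%:R by rewrite adj1 mxE.
  rewrite mxE /cofactor.
  congr (_ * \det _); apply/matrixP => c b.
  by rewrite !mxE hM// eq_sym neq_lift.
rewrite (expand_det_col _ i) (bigD1 i)//= cof eqxx mulr1 big1 ?addr0// => a ai.
by rewrite cof eq_sym (negbTE ai) mulr0.
Qed.

(* Normalizing [U] on the columns of a maximal minor bounds its entries by 1,
   each of them being a quotient of two minors. *)
Lemma bounded_frame d k (U : 'M[F]_(d, k)) : row_free U ->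
  exists (f : {ffun 'I_d -> 'I_k}) (g : 'M[F]_d),
    [/\ injective f, colsub f (g *m U) = 1%:M &
        forall i j, `|(g *m U) i j| <= 1].
Proof.
move=> Ufree; have rfT : row_full U^T by rewrite /row_full mxrank_tr.
pose F0 (f : {ffun 'I_d -> 'I_k}) := `|\det (colsub f U)|.
pose f0 : {ffun 'I_d -> 'I_k} := fullrankfun rfT.
have [|f _ fmax] := @real_arg_maxP F {ffun 'I_d -> 'I_k} f0 xpredT F0 isT.
  by move=> f _; exact: normr_real.
have d0 : F0 f0 != 0.
  rewrite normr_eq0 -unitfE -[_ \in _]/(colsub f0 U \in unitmx) -unitmx_tr.
  by rewrite trmx_mxsub; exact: fullrowsub_unit.
have fu : colsub f U \in unitmx.
  rewrite unitmxE unitfE -normr_eq0 gt_eqF//; apply: lt_le_trans (fmax f0 isT).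
  by rewrite lt_def d0 normr_ge0.
pose g := invmx (colsub f U); pose W := g *m U.
have fW : colsub f W = 1%:M.
  by rewrite /W -mulmx_colsub mulVmx.
exists f, g; split=> // [i j ij|i j].
  have /matrixP/(_ i i) := fW; have /matrixP/(_ i j) := fW.
  rewrite !mxE -ij eqxx => ->; case: eqP => // _ /eqP.
  by rewrite eq_sym oner_eq0.
(* Exchanging column [f i] for column [j] multiplies the minor by [W i j]; maximality bounds this
   factor by 1. *)
pose f' := [ffun a => if a == i then j else f a].
have /= := fmax f' isT; rewrite /F0 (_ : colsub f' U = colsub f U *m colsub f' W); last first.
  by rewrite mulmx_colsub /W mulKVmx.
rewrite det_mulmx normrM ger_pMr ?normr_gt0 -?unitfE -?unitmxE//.
rewrite (@det_id_but_col _ _ i) ?mxE ?ffunE ?eqxx// => a b bi.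
rewrite mxE ffunE (negbTE bi).
by have /matrixP/(_ a b) := fW; rewrite !mxE.
Qed.

End MaximalMinor.

(** * Normalized frames of invariant subspaces *)

Section FramedSubspace.
Variables (C : numClosedFieldType) (k n : nat).

(** Since [U] is the identity on the columns [f], the coordinates in [U] of a vector of its span are
    its entries there. The last two equations are thus invariance with explicit coefficients. *)
Definition frame (x : triple C k n) d (f : 'I_d -> 'I_k) (U : 'M[C]_(d, k)) :=
  [/\ colsub f U = 1%:M, forall i j, `|U i j| <= 1, U *m x.2 = 0,
      U *m x.1.1 = colsub f (U *m x.1.1) *m U &
      U *m x.1.2 = colsub f (U *m x.1.2) *m U].

Lemma degenerate_frame (x : triple C k n) : degenerate x ->
  exists (d : 'I_k.+1) (f : {ffun 'I_d -> 'I_k}),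
    [/\ (0 < d)%N, injective f & exists U : 'M[C]_(d, k), frame x f U].
Proof.
move=> [V [V0 VI VA VB]]; have Vfree := row_base_free V.
have [f [g [finj fW Wle]]] := bounded_frame Vfree.
set W := g *m row_base V in fW Wle.
have dk : (\rank V < k.+1)%N by rewrite ltnS rank_leq_row.
exists (Ordinal dk), f; split=> //; first by rewrite lt0n mxrank_eq0.
exists W; have gu : g \in unitmx.
  have := fW; rewrite /W -mulmx_colsub => /mulmx1_unit[].
  by [].
have WV : (W :=: V)%MS.
  apply: eqmx_trans (eq_row_base V); apply/eqmxP; rewrite submxMl /=.
  by rewrite -{1}(mulKmx gu (row_base V)) submxMl.
have inv (A : 'M[C]_k) : (V *m A <= V)%MS -> W *m A = colsub f (W *m A) *m W.
  move=> VAV; have : (W *m A <= W)%MS.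
    by rewrite WV; apply: submx_trans VAV; rewrite submxMr// WV.
  move=> /submxP[X eX]; rewrite {2}eX -mulmx_colsub fW mulmx1; exact: eX.
split=> //; [|exact: inv|exact: inv].
have : (W *m x.2 <= V *m x.2)%MS by rewrite submxMr// WV.
by rewrite VI => /submx0null.
Qed.

End FramedSubspace.

Section Smallness.
Local Open Scope complex_scope.
Variables (R : realType) (k n p q : nat) (T : Type).
Local Notation C := R[i].
Variables (a b : T -> 'M[C]_k) (c : T -> 'M[C]_(k, n)) (e : T -> 'M[C]_(p, q)).

(** Valued in [R], unlike the norm of [R[i]], and directly comparable with real coordinates. *)
Definition abs1 (z : C) : R := `|complex.Re z| + `|complex.Im z|.

Lemma abs1D z w : abs1 (z + w) <= abs1 z + abs1 w.
Proof.
rewrite /abs1 raddfD raddfD /= addrACA; apply: lerD; exact: ler_normD.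
Qed.

Lemma abs10 : abs1 0 = 0. Proof. by rewrite /abs1 /= normr0 addr0. Qed.

Lemma abs1N z : abs1 (- z) = abs1 z.
Proof. by rewrite /abs1 raddfN raddfN !normrN. Qed.

Lemma abs1B z w : abs1 (z - w) <= abs1 z + abs1 w.
Proof. by rewrite -(abs1N w) abs1D. Qed.

Lemma abs1_ge0 z : 0 <= abs1 z. Proof. by rewrite addr_ge0. Qed.

Lemma abs1M z w : abs1 (z * w) <= abs1 z * abs1 w.
Proof.
case: z w => [z1 z2] [w1 w2]; rewrite /abs1 /=.
have := ler_normB (z1 * w1) (z2 * w2); have := ler_normD (z1 * w2) (z2 * w1).
rewrite !normrM; lra.
Qed.

Lemma abs1_BB z z' w w' : abs1 (z - w - (z' - w')) <= abs1 (z - z') + abs1 (w - w').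
Proof.
have -> : z - w - (z' - w') = (z - z') - (w - w') by ring.
exact: abs1B.
Qed.

Lemma abs1_sum I r (P : pred I) (F : I -> C) :
  abs1 (\sum_(i <- r | P i) F i) <= \sum_(i <- r | P i) abs1 (F i).
Proof.
elim/big_rec2: _ => [|i x y _ h]; first by rewrite abs10.
by apply: le_trans (abs1D _ _) _; rewrite lerD2l.
Qed.

Lemma abs1_norm_le1 z : `|z| <= 1 -> abs1 z <= 2.
Proof.
move=> z1; have : (complex.Re z ^+ 2 + complex.Im z ^+ 2)%:C <= 1%:C.
  by rewrite add_Re2_Im2 expr_le1.
rewrite lecR /abs1 => h.
have : `|complex.Re z| <= 1 by rewrite ler_norml; nra.
by have : `|complex.Im z| <= 1 by [rewrite ler_norml; nra]; lra.
Qed.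

Lemma abs1_mulB (z w z' w' : C) (M eps : R) : abs1 z <= M -> abs1 w' <= M ->
  abs1 (z - z') <= eps -> abs1 (w - w') <= eps -> abs1 (z * w - z' * w') <= 2 * (M * eps).
Proof.
move=> zM wM zz ww.
have -> : z * w - z' * w' = z * (w - w') + (z - z') * w' by ring.
apply: le_trans (abs1D _ _) _; rewrite mulr_natl mulr2n; apply: lerD.
  by apply: le_trans (abs1M _ _) _; apply: ler_pM => //; exact: abs1_ge0.
apply: le_trans (abs1M _ _) _; rewrite mulrC.
by apply: ler_pM => //; exact: abs1_ge0.
Qed.

Lemma abs1_sum_mulB (I : finType) (P : pred I) (z w z' w' : I -> C) (M eps : R) N :
  (#|I| <= N)%N -> 0 <= M -> 0 <= eps ->
  (forall i, P i -> [/\ abs1 (z i) <= M, abs1 (w' i) <= M, abs1 (z i - z' i) <= eps &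
     abs1 (w i - w' i) <= eps]) ->
  abs1 (\sum_(i | P i) z i * w i - \sum_(i | P i) z' i * w' i) <= N%:R * (2 * (M * eps)).
Proof.
move=> IN M0 e0 h; rewrite -sumrB; apply: le_trans (abs1_sum _ _ _) _.
apply: le_trans (_ : \sum_(i : I | P i) 2 * (M * eps) <= _).
  by apply: ler_sum => i /h[? ? ? ?]; exact: abs1_mulB.
rewrite sumr_const -[leLHS]mulr_natl ler_wpM2r ?mulr_ge0// ler_nat.
by apply: leq_trans IN; exact: max_card.
Qed.

(** The block [e] is unconstrained by degeneracy. The section is applied twice, with framing and
    coframing exchanging the roles of [c] and [e]. *)
Definition entry_index := ('I_k * 'I_k + 'I_k * 'I_k + 'I_k * 'I_n + 'I_p * 'I_q)%type.

Definition entry (x : T) (s : entry_index) : C :=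
  match s with
  | inl (inl (inl ij)) => a x ij.1 ij.2
  | inl (inl (inr ij)) => b x ij.1 ij.2
  | inl (inr ij) => c x ij.1 ij.2
  | inr ij => e x ij.1 ij.2
  end.

Definition re_im (z : C) (t : bool) : R := if t then complex.Re z else complex.Im z.

Definition entry_coord (x : T) (s : entry_index * bool) : R :=
  re_im (entry x s.1) s.2.

(** Twice the number of complex parameters: [U] off its normalized columns; for each loop, its
    matrix on the span of [U] and its rows off [f]; the rows of [c] off [f]; all of [e]. *)
Definition frame_dim d := (2 * (d * (k - d) + d * d + (k - d) * k + d * d
  + (k - d) * k + (k - d) * n + p * q))%N.

Section OneFrame.
Variables (d : nat) (f : 'I_d -> 'I_k).
Hypothesis finj : injective f.

Local Notation off := {i : 'I_k | i \notin codom f}.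

(* The rows of [A] with index in the image of [f] are determined by the other
   ones, by [U], and by the action of [A] on the span of [U]. *)
Lemma frame_row m (A : 'M[C]_(k, m)) (U : 'M[C]_(d, k)) r l : colsub f U = 1%:M ->
  A (f r) l = (U *m A) r l - \sum_(i | i \notin codom f) U r i * A i l.
Proof.
move=> fU; rewrite mxE (bigID (mem (codom f)))/= addrK.
rewrite (bigD1 (f r)) ?codom_f//= big1 ?addr0.
  by have /matrixP/(_ r r) := fU; rewrite !mxE eqxx => ->; rewrite mul1r.
move=> i /andP[/codomP[s ->] sr]; have /matrixP/(_ r s) := fU.
rewrite !mxE => ->; rewrite (_ : r == s = false) ?mul0r//.
by apply/negbTE; apply: contra sr => /eqP ->.
Qed.

Definition param_index := ('I_d * off + 'I_d * 'I_d + off * 'I_k + 'I_d * 'I_d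
  + off * 'I_k + off * 'I_n + 'I_p * 'I_q)%type.

Lemma card_param_index : (#|{: param_index * bool}| = frame_dim d)%N.
Proof.
have coff : #|{: off}| = (k - d)%N.
  have := cardC (mem (codom f)); rewrite card_codom// !card_ord => kE.
  apply: (@addnI d); rewrite subnKC; last by have := leq_card f finj; rewrite !card_ord.
  by rewrite -[RHS]kE card_sig; congr addn; apply: eq_card.
by rewrite !(card_prod, card_sum) !card_ord coff card_bool mulnC.
Qed.

(** The rows off [f] are parameters. The remaining ones follow from [frame_row], where [U *m A] is a
    product of parameters by invariance and [U *m c] is 0; all these expressions are Lipschitz on
    bounded sets. *)
Lemma small_frame (M : nat) :
  small entry_coord (fun x =>
    (exists U, frame (a x, b x, c x) f U) /\ forall s, `|entry_coord x s| <= M%:R)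
    (frame_dim d).
Proof.
rewrite -card_param_index.
(* The choice of a frame for each point may be discontinuous: only pairs of points with close
   parameters are compared, and [U] is part of the parameters. *)
have [U hU] : exists U : T -> 'M[C]_(d, k),
    forall x, (exists U, frame (a x, b x, c x) f U) -> frame (a x, b x, c x) f (U x).
  have h x : exists U : 'M[C]_(d, k),
      (exists U, frame (a x, b x, c x) f U) -> frame (a x, b x, c x) f U.
    have [[U hU]|no] := pselect (exists U, frame (a x, b x, c x) f U).
      by exists U.
    by exists 0.
  by have [U hU] := choice h; exists U.
pose par (x : T) (s : param_index) : C := match s with
  | inl (inl (inl (inl (inl (inl rj))))) => U x rj.1 (val rj.2)
  | inl (inl (inl (inl (inl (inr rj))))) => (U x *m a x) rj.1 (f rj.2)
  | inl (inl (inl (inl (inr rj)))) => a x (val rj.1) rj.2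
  | inl (inl (inl (inr rj))) => (U x *m b x) rj.1 (f rj.2)
  | inl (inl (inr rj)) => b x (val rj.1) rj.2
  | inl (inr rj) => c x (val rj.1) rj.2
  | inr rj => e x rj.1 rj.2 end.
(* It dominates the three bounds that occur: 2 for entries of [U], [2 * M] for matrix entries, and
   [k] products of the two for entries of [U *m A]. *)
pose N := (4 * k * M + 2 * M + 2)%N.
have dk : (d <= k)%N by have := leq_card f finj; rewrite !card_ord.
have N2 : 2 <= N%:R :> R by rewrite /N ler_nat leq_addl.
have NM : 2 * M%:R <= N%:R :> R by rewrite /N -natrM ler_nat; lia.
have cM x u : (forall s, `|entry_coord x s| <= M%:R) -> abs1 (entry x u) <= 2 * M%:R.
  move=> xM; have := xM (u, true); have := xM (u, false).
  by rewrite /entry_coord/= /abs1; lra.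
have NUA x (A : 'M[C]_k) : (exists U, frame (a x, b x, c x) f U) ->
    (forall i l, abs1 (A i l) <= 2 * M%:R) -> forall r l, abs1 ((U x *m A) r l) <= N%:R.
  move=> /hU[_ U1 _ _ _] AM r l; rewrite mxE; apply: le_trans (abs1_sum _ _ _) _.
  apply: le_trans (_ : \sum_(i < k) 2 * (2 * M%:R) <= _).
    apply: ler_sum => i _; apply: le_trans (abs1M _ _) _.
    by apply: ler_pM; rewrite ?abs1_ge0 ?abs1_norm_le1.
  rewrite sumr_const card_ord -!natrM -[leLHS]mulr_natl -natrM ler_nat /N; lia.
apply: (@small_params R T _ entry_coord _ _ (fun x s => re_im (par x s.1) s.2) N
  (8 * k * N + 2)).
- move=> x [xf xM] [s t].
  have [fU U1 UI UA UB] := hU x xf.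
  have cpar : abs1 (par x s) <= N%:R.
    case: s => [[[[[[s|s]|s]|s]|s]|s]|s] /=.
    + by apply: le_trans N2; exact: abs1_norm_le1.
    + by apply: NUA => // i l; exact: (cM x (inl (inl (inl (i, l))))).
    + by apply: le_trans NM; exact: (cM x (inl (inl (inl (val s.1, s.2))))).
    + by apply: NUA => // i l; exact: (cM x (inl (inl (inr (i, l))))).
    + by apply: le_trans NM; exact: (cM x (inl (inl (inr (val s.1, s.2))))).
    + by apply: le_trans NM; exact: (cM x (inl (inr (val s.1, s.2)))).
    + by apply: le_trans NM; exact: (cM x (inr (s.1, s.2))).
  apply: le_trans cpar; rewrite /abs1 /re_im /=; case: t; rewrite ?lerDl ?lerDr//.
- move=> x y eps [xf xM] [yf yM] eps0 par_eps [s t].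
  have [fU U1 UI UA UB] := hU x xf; have [fV V1 VI VA VB] := hU y yf.
  (* Real and imaginary parts each contribute [eps]. *)
  pose ee := 2 * eps; have ee0 : 0 <= ee by rewrite mulr_ge0.
  have close u : abs1 (par x u - par y u) <= ee.
    have := par_eps (u, true); have := par_eps (u, false).
    rewrite /abs1 /re_im /= !raddfB /= /ee; lra.
  have N0 : 0 <= N%:R :> R by [].
  have cMy u : abs1 (entry y u) <= N%:R by apply: le_trans NM; exact: cM.
  have cU r i : abs1 (U x r i) <= N%:R by apply: le_trans N2; exact: abs1_norm_le1.
  have cV r i : abs1 (U y r i) <= N%:R by apply: le_trans N2; exact: abs1_norm_le1.
  have Ueps r i : abs1 (U x r i - U y r i) <= ee.
    have [/codomP[l ->]|io] := boolP (i \in codom f).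
      have /matrixP/(_ r l) := fU; have /matrixP/(_ r l) := fV.
      by rewrite !mxE => -> ->; rewrite subrr abs10.
    by have := close (inl (inl (inl (inl (inl (inl (r, exist _ i io))))))).
  have offeps m (A B : 'M[C]_(k, m)) r l :
      (forall i, i \notin codom f -> abs1 (B i l) <= N%:R /\ abs1 (A i l - B i l) <= ee) ->
      abs1 (\sum_(i | i \notin codom f) U x r i * A i l -
          \sum_(i | i \notin codom f) U y r i * B i l) <= k%:R * (2 * (N%:R * ee)).
    move=> h; apply: abs1_sum_mulB; rewrite ?card_ord//.
    by move=> i /h[? ?]; split=> //; exact: Ueps.
  have rowA (A B : 'M[C]_k) i l :
      U x *m A = colsub f (U x *m A) *m U x -> U y *m B = colsub f (U y *m B) *m U y ->
      (forall r s, abs1 ((U x *m A) r (f s)) <= N%:R) ->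
      (forall r s, abs1 ((U x *m A) r (f s) - (U y *m B) r (f s)) <= ee) ->
      (forall i, i \notin codom f -> abs1 (B i l) <= N%:R /\ abs1 (A i l - B i l) <= ee) ->
      abs1 (A i l - B i l) <= 2 * k%:R * (2 * (N%:R * ee)) + ee.
    move=> eA eB hN hc hoff.
    have pos : 0 <= k%:R * (2 * (N%:R * ee)) :> R by rewrite !mulr_ge0.
    have [/codomP[r ->]|io] := boolP (i \in codom f); last first.
      by have := (hoff i io).2; lra.
    rewrite (frame_row A r l fU) (frame_row B r l fV) eA eB.
    have colE (M0 : 'M[C]_(d, k)) (V : 'M[C]_(d, k)) :
        (colsub f M0 *m V) r l = \sum_s M0 r (f s) * V s l.
      by rewrite mxE; apply: eq_bigr => u _; rewrite mxE.
    rewrite !colE; apply: le_trans (abs1_BB _ _ _ _) _.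
    have := offeps k A B r l hoff.
    suff : abs1 (\sum_s (U x *m A) r (f s) * U x s l - \sum_s (U y *m B) r (f s) * U y s l)
        <= k%:R * (2 * (N%:R * ee)) by lra.
    apply: abs1_sum_mulB => [|//|//|u _]; first by rewrite card_ord.
    by split; [exact: hN|exact: cV|exact: hc|exact: Ueps].
  have last_step z w : abs1 (z - w) <= 2 * k%:R * (2 * (N%:R * ee)) + ee ->
      `|re_im z t - re_im w t| <= (8 * k * N + 2)%:R * eps.
    rewrite natrD !natrM /ee => h; apply: le_trans (_ : abs1 (z - w) <= _); last first.
      by move: h; set kN := k%:R; nra.
    by rewrite /re_im /abs1; case: t; rewrite !raddfB /= ?lerDl ?lerDr.
  rewrite /entry_coord /=; apply: last_step; case: s => [[[[i l]|[i l]]|[i l]]|[i l]] /=.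
  - apply: rowA => // [r s|r s|j jo].
    + by apply: NUA => // u v; exact: (cM x (inl (inl (inl (u, v))))).
    + exact: (close (inl (inl (inl (inl (inl (inr (r, s)))))))).
    + split; first exact: (cMy (inl (inl (inl (j, l))))).
      exact: (close (inl (inl (inl (inl (inr (exist _ j jo, l))))))).
  - apply: rowA => // [r s|r s|j jo].
    + by apply: NUA => // u v; exact: (cM x (inl (inl (inr (u, v))))).
    + exact: (close (inl (inl (inl (inr (r, s)))))).
    + split; first exact: (cMy (inl (inl (inr (j, l))))).
      exact: (close (inl (inl (inr (exist _ j jo, l))))).
  - have hoff j : j \notin codom f -> abs1 (c y j l) <= N%:R /\ abs1 (c x j l - c y j l) <= ee.
      move=> jo; split; first exact: (cMy (inl (inr (j, l)))).
      exact: (close (inl (inr (exist _ j jo, l)))).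
    have pos : 0 <= k%:R * (2 * (N%:R * ee)) :> R by rewrite !mulr_ge0.
    have [/codomP[r ->]|io] := boolP (i \in codom f); last first.
      by have := (hoff i io).2; lra.
    rewrite (frame_row _ r l fU) (frame_row _ r l fV) UI VI !mxE !sub0r opprK addrC.
    rewrite -opprB abs1N.
    by have := offeps n (c x) (c y) r l hoff; lra.
  - have pos : 0 <= k%:R * (2 * (N%:R * ee)) :> R by rewrite !mulr_ge0.
    have := close (inr (i, l)); rewrite /=; lra.
Qed.
End OneFrame.

Lemma small_degenerate (M D : nat) :
  (forall d, (0 < d <= k)%N -> (frame_dim d <= D)%N) ->
  small entry_coord (fun x => degenerate (a x, b x, c x) /\
    forall s, `|entry_coord x s| <= M%:R) D.
Proof.
move=> dimD; pose I := {d : 'I_k.+1 & {ffun 'I_d -> 'I_k}}.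
pose S (i : I) x := ((0 < tag i)%N /\ injective (tagged i)) /\
  ((exists U, frame (a x, b x, c x) (tagged i) U) /\
   forall s, `|entry_coord x s| <= M%:R).
apply: (@small_sub _ _ _ _ _ (fun x => exists i : I, S i x)) => [x [degx xM]|].
  have [d [f [d0 finj fU]]] := degenerate_frame degx.
  by exists (Tagged (fun d : 'I_k.+1 => {ffun 'I_d -> 'I_k}) f).
apply: small_bigcup => -[d f]; have [[d0 finj]|no] := pselect ((0 < d)%N /\ injective f).
  apply: small_leq (dimD d _) _; first by rewrite d0 -ltnS ltn_ord.
  by have := small_frame finj M; apply: small_sub => x [].
(* For a zero [d] or a non-injective [f] the piece is empty, and one code suffices. *)
exists 1 => m m0; exists unit, (fun=> tt); split=> [|x y []//].
by rewrite card_unit mul1n expn_gt0 m0.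
Qed.

(** After halving, the difference of the two sides is (d - 1)(k - d + n - 1), a product of
    nonnegative factors. *)
Lemma frame_dim_codim d : (0 < n)%N -> (0 < d <= k)%N ->
  (frame_dim d + 2 * (k - 1 + n) <= 2 * (k * k + k * k + k * n + p * q))%N.
Proof.
move=> n0 /andP[d0 dk]; rewrite /frame_dim -mulnDr leq_mul2l /=.
have [r ->] : exists r, k = (d + r)%N by exists (k - d)%N; rewrite subnKC.
case: d d0 {dk} => // d _; rewrite addKn; nia.
Qed.

End Smallness.

(** * Topology of complex matrices *)

Section ComplexTopology.
Local Open Scope complex_scope.
Variables (R : realType).
Local Notation C := R[i].
Context (T : Type) (F : set_system T) {FF : Filter F}.

Lemma cvg_near_eq (S : topologicalType) (f g : T -> S) (a : S) :
  F [set x | f x = g x] -> f x @[x --> F] --> a -> g x @[x --> F] --> a.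
Proof.
move=> fg fa W nW; have FW : F [set x | W (f x)] := fa W nW.
change (F [set x | W (g x)]); apply: filterS2 fg FW => x /= e.
by rewrite e.
Qed.

Lemma cvgC_mul (f g : T -> C) (a b : C) : f x @[x --> F] --> a -> g x @[x --> F] --> b ->
  f x * g x @[x --> F] --> a * b.
Proof. exact: (@cvgM C). Qed.

Lemma cvgC_add (f g : T -> C) (a b : C) : f x @[x --> F] --> a -> g x @[x --> F] --> b ->
  f x + g x @[x --> F] --> a + b.
Proof. exact: (@cvgD C C^o). Qed.

Lemma cvgC_inv (f : T -> C) (a : C) : a != 0 -> f x @[x --> F] --> a ->
  (f x)^-1 @[x --> F] --> a^-1.
Proof. exact: (@cvgV C). Qed.

Lemma cvgCP (f : T -> C) (a : C) :
  (forall e : R, 0 < e -> \forall x \near F, `|f x - a| < e%:C) <-> f x @[x --> F] --> a.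
Proof.
split=> [h|h].
  apply/(@cvgrPdist_lt C C^o) => e e0.
  have er : e = (complex.Re e)%:C.
    by rewrite RRe_real// gtr0_real.
  rewrite er ltcR in e0 *; apply: filterS (h _ e0) => x; by rewrite distrC.
move=> e e0; have e0' : 0 < e%:C :> C by rewrite ltcR.
by have /(@cvgrPdist_lt C C^o)/(_ _ e0') := h; apply: filterS => x; rewrite distrC.
Qed.


Lemma cvg_conjC (f : T -> C) (a : C) : f x @[x --> F] --> a ->
  (f x)^* @[x --> F] --> a^*.
Proof.
move=> /cvgCP fa; apply/cvgCP => e e0; apply: filterS (fa e e0) => x.
by rewrite -raddfB /= normcJ.
Qed.

Lemma normc_ge_Im (z : C) : `|complex.Im z|%:C <= `|z|.
Proof.
have := normc_ge_Re (z * 'i); rewrite ReiNIm normrN normrM (_ : `|'i| = 1) ?mulr1//.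
by rewrite normc_def /= expr0n expr1n add0r sqrtr1.
Qed.

Lemma cvg_Re (f : T -> C) (a : C) : f x @[x --> F] --> a ->
  complex.Re (f x) @[x --> F] --> complex.Re a.
Proof.
move=> /cvgCP fa; apply/cvgrPdist_lt => e e0; apply: filterS (fa e e0) => x.
by rewrite distrC -raddfB -ltcR /=; exact: le_lt_trans (normc_ge_Re _).
Qed.

Lemma cvg_Im (f : T -> C) (a : C) : f x @[x --> F] --> a ->
  complex.Im (f x) @[x --> F] --> complex.Im a.
Proof.
move=> /cvgCP fa; apply/cvgrPdist_lt => e e0; apply: filterS (fa e e0) => x.
by rewrite distrC -raddfB -ltcR /=; exact: le_lt_trans (normc_ge_Im _).
Qed.

Lemma cvg_real_complex (f : T -> R) (a : R) : f x @[x --> F] --> a ->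
  (f x)%:C @[x --> F] --> a%:C.
Proof.
move=> /cvgrPdist_lt fa; apply/cvgCP => e e0; apply: filterS (fa e e0) => x.
rewrite -(rmorphB (real_complex R)) normc_def /= expr0n addr0 sqrtr_sqr ltcR.
by rewrite distrC.
Qed.

Lemma cvg_complex (f g : T -> R) (a b : R) : f x @[x --> F] --> a ->
  g x @[x --> F] --> b -> (f x +i* g x) @[x --> F] --> (a +i* b).
Proof.
move=> fa gb; rewrite [a +i* b]complexE /=.
rewrite (_ : (fun x => _) = fun x => (f x)%:C + 'i * (g x)%:C); last first.
  by apply/funext => x; rewrite [LHS]complexE.
apply: cvgC_add; first exact: cvg_real_complex.
by apply: cvgC_mul; [exact: cvg_cst|exact: cvg_real_complex].
Qed.

Lemma cvgC_sum I (r : seq I) (P : pred I) (f : I -> T -> C) (a : I -> C) :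
  (forall i, P i -> f i x @[x --> F] --> a i) ->
  \sum_(i <- r | P i) f i x @[x --> F] --> \sum_(i <- r | P i) a i.
Proof.
move=> h; elim: r => [|i r IH].
  by rewrite big_nil (_ : (fun x => _) = fun=> 0) ?funeqE => [|x]; [exact: cvg_cst|rewrite big_nil].
rewrite big_cons (_ : (fun x => _) = fun x =>
  if P i then f i x + \sum_(j <- r | P j) f j x else \sum_(j <- r | P j) f j x).
  by case: ifP => Pi; [apply: cvgC_add; [exact: h|exact: IH]|exact: IH].
by apply/funext => x; rewrite big_cons.
Qed.

Lemma cvgC_prod I (r : seq I) (P : pred I) (f : I -> T -> C) (a : I -> C) :
  (forall i, P i -> f i x @[x --> F] --> a i) ->
  \prod_(i <- r | P i) f i x @[x --> F] --> \prod_(i <- r | P i) a i.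
Proof.
move=> h; elim: r => [|i r IH].
  by rewrite big_nil (_ : (fun x => _) = fun=> 1) ?funeqE => [|x]; [exact: cvg_cst|rewrite big_nil].
rewrite big_cons (_ : (fun x => _) = fun x =>
  if P i then f i x * \prod_(j <- r | P j) f j x else \prod_(j <- r | P j) f j x).
  by case: ifP => Pi; [apply: cvgC_mul; [exact: h|exact: IH]|exact: IH].
by apply/funext => x; rewrite big_cons.
Qed.

Lemma cvg_mxP (S : ptopologicalType) m n (f : T -> 'M[S]_(m, n)) (A : 'M[S]_(m, n)) :
  (forall i j, f x i j @[x --> F] --> A i j) <-> f x @[x --> F] --> A.
Proof.
split=> [h W [P fP PW]|h i j W nW].
  apply: filterS (fun y => PW (f y)) _ => /=.
  apply: filter_forall => i; apply: filter_forall => j.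
  exact: h (fP i j).
apply: (h [set B : 'M[S]_(m, n) | W (B i j)]).
exists (fun i' j' => [set y | (i', j') = (i, j) -> W y]) => [i' j'|B hB /=].
  have [[-> ->]|ne] := eqVneq (i', j') (i, j); first by apply: filterS nW => y Wy _.
  by apply: filterS filterT => y _ e; rewrite e eqxx in ne.
exact: (hB i j).
Qed.

Lemma cvg_mulmx m n p (f : T -> 'M[C]_(m, n)) (g : T -> 'M[C]_(n, p))
    (A : 'M[C]_(m, n)) (B : 'M[C]_(n, p)) :
  f x @[x --> F] --> A -> g x @[x --> F] --> B ->
  f x *m g x @[x --> F] --> A *m B.
Proof.
move=> /cvg_mxP fA /cvg_mxP gB; apply/cvg_mxP => i j; rewrite mxE.
rewrite (_ : (fun x => _) = fun x => \sum_l f x i l * g x l j); last first.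
  by apply/funext => x; rewrite mxE.
by apply: cvgC_sum => l _; exact: cvgC_mul (fA i l) (gB l j).
Qed.

Lemma cvg_addmx m n (f g : T -> 'M[C]_(m, n)) (A B : 'M[C]_(m, n)) :
  f x @[x --> F] --> A -> g x @[x --> F] --> B ->
  f x + g x @[x --> F] --> A + B.
Proof.
move=> /cvg_mxP fA /cvg_mxP gB; apply/cvg_mxP => i j; rewrite mxE.
rewrite (_ : (fun x => _) = fun x => f x i j + g x i j); last first.
  by apply/funext => x; rewrite mxE.
exact: cvgC_add (fA i j) (gB i j).
Qed.

Lemma cvg_scalemx m n (f : T -> C) (g : T -> 'M[C]_(m, n))
    (a : C) (B : 'M[C]_(m, n)) :
  f x @[x --> F] --> a -> g x @[x --> F] --> B ->
  f x *: g x @[x --> F] --> a *: B.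
Proof.
move=> fa /cvg_mxP gB; apply/cvg_mxP => i j; rewrite mxE.
rewrite (_ : (fun x => _) = fun x => f x * g x i j); last first.
  by apply/funext => x; rewrite mxE.
exact: cvgC_mul fa (gB i j).
Qed.

Lemma cvg_oppmx m n (f : T -> 'M[C]_(m, n)) (A : 'M[C]_(m, n)) :
  f x @[x --> F] --> A -> - f x @[x --> F] --> - A.
Proof.
move=> fA; rewrite -scaleN1r (_ : (fun x => - f x) = fun x => -1 *: f x); last first.
  by apply/funext => x; rewrite scaleN1r.
by apply: cvg_scalemx fA; exact: cvg_cst.
Qed.

Lemma cvg_trmx m n (f : T -> 'M[C]_(m, n)) (A : 'M[C]_(m, n)) :
  f x @[x --> F] --> A -> (f x)^T @[x --> F] --> A^T.
Proof.
move=> /cvg_mxP fA; apply/cvg_mxP => i j; rewrite mxE.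
rewrite (_ : (fun x => _) = fun x => f x j i); first exact: fA.
by apply/funext => x; rewrite mxE.
Qed.

Lemma cvg_adjmx m n (f : T -> 'M[C]_(m, n)) (A : 'M[C]_(m, n)) :
  f x @[x --> F] --> A -> (f x)^t* @[x --> F] --> A^t*.
Proof.
move=> /cvg_mxP fA; apply/cvg_mxP => i j; rewrite !mxE.
rewrite (_ : (fun x => _) = fun x => (f x j i)^*); first exact: cvg_conjC (fA j i).
by apply/funext => x; rewrite !mxE.
Qed.

Lemma cvg_det n (f : T -> 'M[C]_n) (A : 'M[C]_n) :
  f x @[x --> F] --> A -> \det (f x) @[x --> F] --> \det A.
Proof.
move=> /cvg_mxP fA; rewrite /determinant; apply: cvgC_sum => s _.
apply: cvgC_mul; first exact: cvg_cst.
by apply: cvgC_prod => i _; exact: fA.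
Qed.

Lemma near_unitmx n (f : T -> 'M[C]_n) (A : 'M[C]_n) : A \in unitmx ->
  f x @[x --> F] --> A -> F [set x | f x \in unitmx].
Proof.
move=> uA /cvg_det dA; have d0 : \det A != 0 by move: uA; rewrite unitmxE unitfE.
have d1 : 0 < complex.Re `|\det A| by rewrite -ltcR RRe_real ?normr_real// normr_gt0.
have /cvgCP/(_ _ d1) := dA; apply: filterS => x.
rewrite RRe_real ?normr_real// => lt; rewrite /= unitmxE unitfE; apply: contraTneq lt => ->.
by rewrite sub0r normrN ltxx.
Qed.

Lemma cvg_invmx n (f : T -> 'M[C]_n) (A : 'M[C]_n) : A \in unitmx ->
  f x @[x --> F] --> A -> invmx (f x) @[x --> F] --> invmx A.
Proof.
move=> uA fA; have dA := cvg_det fA.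
have d0 : \det A != 0 by move: uA; rewrite unitmxE unitfE.
have nunit := near_unitmx uA fA.
(* [invmx] is the identity on singular matrices, so the adjugate formula holds only near the
   limit. *)
apply: (@cvg_near_eq _ (fun x => (\det (f x))^-1 *: \adj (f x))).
  by apply: filterS nunit => x /= ux; rewrite /invmx ux.
rewrite /invmx uA; apply: cvg_scalemx; first exact: cvgC_inv d0 dA.
apply/(cvg_mxP (fun x => \adj (f x)) (\adj A)) => i j; rewrite mxE.
rewrite (_ : (fun x => _) = fun x => cofactor (f x) j i); last first.
  by apply/funext => x; rewrite mxE.
apply: cvgC_mul; first exact: cvg_cst.
apply: cvg_det; apply/cvg_mxP => a b; rewrite !mxE.
rewrite (_ : (fun x => _) = fun x => f x (lift j a) (lift i b)).
  by have /cvg_mxP := fA; apply.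
by apply/funext => x; rewrite !mxE.
Qed.

End ComplexTopology.

Lemma cvg_initialP (T : Type) (F : set_system T) {FF : Filter F} (S : choiceType)
    (X : topologicalType) (p : S -> X) (f : T -> S) (a : S) :
  f x @[x --> F] --> (a : initial_topology p) <-> p (f x) @[x --> F] --> p a.
Proof.
split=> [fa W nW|fa W].
  by apply: (fa (p @^-1` W)); exact: (@initial_continuous S X p a W nW).
rewrite nbhsE => -[U [[V oV VU] Ua] UW].
have nV : nbhs (p a) V by apply: open_nbhs_nbhs; split=> //; rewrite -VU in Ua.
have FV : F [set x | V (p (f x))] := fa V nV.
change (F (f @^-1` W)); apply: filterS FV => x Vx; apply: UW; rewrite -VU.
exact: Vx.
Qed.

Lemma cvg_set_typeP (T : Type) (F : set_system T) {FF : Filter F}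
    (X : topologicalType) (S : set X) (f : T -> S) (a : S) :
  f x @[x --> F] --> a <-> val (f x) @[x --> F] --> val a.
Proof. exact: cvg_initialP. Qed.

Lemma cvg_repP (R : realType) (Q : quiver) (v : vertex Q -> nat)
    (T : Type) (F : set_system T) {FF : Filter F} (f : T -> rep R v) (A : rep R v) :
  (forall a, f x a @[x --> F] --> A a) <-> f x @[x --> F] --> A.
Proof.
pose K (a : edge Q) := 'M[R[i]]_(v (qhead a), v (qtail a)).
pose TS (a : edge Q) := Topological.class (initial_topology (fun f : (forall a, K a) => f a)).
have H := @cvg_sup (prod_topology K) (edge Q) TS (f x @[x --> F]) A _.
split=> [h|h a].
  have : forall a, f x @[x --> F] --> (A : Topological.Pack (TS a)).
    by move=> a; apply/cvg_initialP; exact: h.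
  move=> /H; exact: id.
have /H/(_ a)/cvg_initialP := h.
exact: id.
Qed.

(** * Gram-Schmidt retraction on the unitary group *)

Section GramSchmidt.
Local Open Scope complex_scope.
Variables (R : realType) (k : nat).
Local Notation C := R[i].
Implicit Types g : 'M[C]_k.

Definition before (i : 'I_k) : 'I_i -> 'I_k := widen_ord (ltnW (ltn_ord i)).

Definition rows_before g (i : 'I_k) : 'M[C]_(i, k) := rowsub (@before i) g.

(* The residual of row [i] after orthogonal projection onto the span of the
   previous rows is [gs_coef g i *m g]. *)
Definition gs_coef g (i : 'I_k) : 'rV[C]_k :=
  delta_mx 0 i - row i g *m (rows_before g i)^t* *m
    invmx (rows_before g i *m (rows_before g i)^t*) *m rows_before 1%:M i.

Definition gs_scal g (i : 'I_k) : R :=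
  (Num.sqrt (complex.Re ((gs_coef g i *m g *m (gs_coef g i *m g)^t*) 0 0)))^-1.

Definition gs_trig g : 'M[C]_k := \matrix_i ((gs_scal g i)%:C *: gs_coef g i).

Definition gs g := gs_trig g *m g.

Lemma adjmx_scale (r : R) p q (A : 'M[C]_(p, q)) : (r%:C *: A)^t* = r%:C *: A^t*.
Proof.
apply/matrixP => i j; rewrite !mxE rmorphM /= conj_Creal//.
by apply/complex_realP; exists r.
Qed.

Lemma rows_beforeE g i : rows_before g i = rows_before 1%:M i *m g.
Proof. by rewrite /rows_before mul_rowsub_mx mul1mx. Qed.

Lemma mulmx_adj_eq0 m (w : 'rV[C]_m) : (w *m w^t*) 0 0 = 0 -> w = 0.
Proof. by rewrite -dotmxE => /eqP; rewrite dnorm_eq0 => /eqP. Qed.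

Lemma rows_before_unit g i : g \in unitmx ->
  rows_before g i *m (rows_before g i)^t* \in unitmx.
Proof.
move=> gu; rewrite -row_free_unit -kermx_eq0; apply/rowV0P => v /sub_kermxP v0.
have : v *m rows_before g i = 0.
  by apply: mulmx_adj_eq0; rewrite adjmx_mul mulmxA -[v *m _ *m _]mulmxA v0 mul0mx mxE.
rewrite rows_beforeE mulmxA => /(congr1 (mulmx^~ (invmx g))).
rewrite mulmxK// mul0mx => /rowP v1; apply/rowP => j; have := v1 (before j).
rewrite !mxE (bigD1 j)//= !mxE eqxx mulr1 big1 ?addr0// => l lj.
by rewrite !mxE -val_eqE /= val_eqE (negbTE lj) mulr0.
Qed.

Lemma gs_coef_diag g i : gs_coef g i 0 i = 1.
Proof.
rewrite !mxE !eqxx big1 ?subr0// => l _.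
rewrite !mxE (_ : before l == i = false) ?mulr0//.
by apply/negbTE; rewrite -val_eqE /= neq_ltn ltn_ord.
Qed.

Lemma gs_coef_above g (i j : 'I_k) : (i < j)%N -> gs_coef g i 0 j = 0.
Proof.
move=> ij; rewrite !mxE /= -val_eqE /= gtn_eqF// add0r big1 ?oppr0// => l _.
rewrite !mxE (_ : before l == j = false) ?mulr0//.
by apply/negbTE; rewrite -val_eqE /= neq_ltn (ltn_trans (ltn_ord l)).
Qed.

Lemma gs_res_orth g (i j : 'I_k) : g \in unitmx -> (j < i)%N ->
  (gs_coef g i *m g *m g^t*) 0 j = 0.
Proof.
move=> gu ji; have : gs_coef g i *m g *m (rows_before g i)^t* = 0.
  rewrite mulmxBl -rowE mulmxBl -[_ *m rows_before 1%:M i *m g]mulmxA -rows_beforeE.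
  by rewrite -[X in _ - X]mulmxA mulmxKV ?subrr// rows_before_unit.
set w := gs_coef g i *m g.
move=> /matrixP/(_ 0 (Ordinal ji)); rewrite !mxE => e; rewrite -[RHS]e; apply: eq_bigr => l _.
by rewrite !mxE; congr (_ * (g _ _)^*); apply: val_inj.
Qed.

(** Residual [j] is a combination of the rows of [g] up to [j], all of them before [i] and hence
    orthogonal to residual [i]. *)
Lemma gs_orth g (i j : 'I_k) : g \in unitmx -> (j < i)%N ->
  gs_coef g i *m g *m (gs_coef g j *m g)^t* = 0.
Proof.
move=> gu ji; rewrite adjmx_mul mulmxA; apply/matrixP => a b; rewrite !ord1.
have orth (l : 'I_k) : (l < i)%N -> _ := gs_res_orth gu.
have above (l : 'I_k) : (j < l)%N -> _ := @gs_coef_above g j l.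
move: (gs_coef g j) above (gs_coef g i *m g *m g^t*) orth => c above w orth.
rewrite !mxE big1// => l _; have [li|il] := ltnP l i; first by rewrite orth// mul0r.
by rewrite !mxE above ?conjC0 ?mulr0// (leq_trans ji).
Qed.

Lemma gs_norm g i : g \in unitmx ->
  exists2 r : R, 0 < r & (gs_coef g i *m g *m (gs_coef g i *m g)^t*) 0 0 = r%:C.
Proof.
move=> gu; set w := gs_coef g i *m g.
have w0 : 0 < (w *m w^t*) 0 0.
  rewrite -dotmxE dnorm_gt0; apply: contraTneq isT => /(congr1 (mulmx^~ (invmx g))).
  rewrite mulmxK// mul0mx => /rowP/(_ i); rewrite gs_coef_diag mxE => /eqP.
  by rewrite oner_eq0.
exists (complex.Re ((w *m w^t*) 0 0)); last by rewrite RRe_real// gtr0_real.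
by rewrite -ltcR RRe_real// gtr0_real.
Qed.

Lemma gs_scal_gt0 g i : g \in unitmx -> 0 < gs_scal g i.
Proof.
by move=> /(gs_norm i)[r r0 e]; rewrite /gs_scal e invr_gt0 sqrtr_gt0.
Qed.

Lemma row_gs g i : row i (gs g) = (gs_scal g i)%:C *: (gs_coef g i *m g).
Proof. by rewrite row_mul rowK scalemxAl. Qed.

Lemma gs_unitary g : g \in unitmx -> gs g \is unitarymx.
Proof.
move=> gu; apply/row_unitarymxP => i j; rewrite !row_gs dotmxE.
rewrite adjmx_scale -scalemxAl -scalemxAr.
have dotE (x y : C) (A : 'M[C]_1) : (x *: (y *: A)) 0 0 = x * (y * A 0 0).
  by rewrite !mxE.
rewrite dotE; have [->|ij] := eqVneq i j.
  have [r r0 e] := gs_norm j gu; rewrite /gs_scal !e /= -!rmorphM.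
  by rewrite mulrA -invfM -expr2 sqr_sqrtr ?(ltW r0)// mulVf ?gt_eqF.
have W0 : gs_coef g i *m g *m (gs_coef g j *m g)^t* = 0.
  move: ij; rewrite neq_ltn => /orP[] lt; last exact: gs_orth.
  by rewrite -[gs_coef g i *m g]trmxCK -adjmx_mul gs_orth// trmx0 map_mx0.
have W00 : _ = 0 := etrans (congr1 (fun A : 'M[C]_1 => A 0 0) W0) (mxE _ _ _ _).
apply: etrans (congr1 (fun z => _ * (_ * z)) W00) _.
exact: etrans (congr1 ( *%R _) (mulr0 _)) (mulr0 _).
Qed.

Lemma gs_id g : g \is unitarymx -> gs g = g.
Proof.
move=> gU; have gu := unitarymx_unit gU.
have orth (i j : 'I_k) : row i g *m (row j g)^t* = (i == j)%:R%:M.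
  apply/matrixP => a b; rewrite !ord1 -dotmxE.
  by have /row_unitarymxP -> := gU; rewrite mxE eqxx.
have coef i : gs_coef g i = delta_mx 0 i.
  rewrite /gs_coef (_ : row i g *m _ = 0) ?mul0mx ?subr0//.
  apply/rowP => j; have neq : i == before j = false.
    by apply/negbTE; rewrite -val_eqE /= neq_ltn ltn_ord orbT.
  have /matrixP/(_ 0 0) := orth i (before j); rewrite !mxE neq mul0rn => e.
  by rewrite -[RHS]e; apply: eq_bigr => l _; rewrite !mxE.
rewrite /gs (_ : gs_trig g = 1%:M) ?mul1mx//; apply/row_matrixP => i.
rewrite rowK coef /gs_scal coef -rowE orth eqxx mxE eqxx mulr1n /=.
by rewrite sqrtr1 invr1 scale1r rowE mulmx1.
Qed.

Lemma gs_trig1 : gs_trig 1%:M = 1%:M.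
Proof.
by rewrite -[LHS]mulmx1; apply: gs_id; apply/unitarymxP; rewrite mul1mx trmx1 map_mx1.
Qed.

Lemma gs_trigE g i j : gs_trig g i j = (gs_scal g i)%:C * gs_coef g i 0 j.
Proof. by rewrite /gs_trig; move: (gs_coef g) => c; rewrite !mxE. Qed.

(** Lower triangular matrices with positive diagonal form a convex set of invertible matrices. The
    segment from [gs_trig g] to 1 is what deforms [gs g] to [g] inside the general linear group. *)
Lemma gs_trig_convex g (s : R) : g \in unitmx -> 0 <= s <= 1 ->
  (1 - s)%:C *: gs_trig g + s%:C *: 1%:M \in unitmx.
Proof.
move=> gu s01; have above (i j : 'I_k) : (i < j)%N -> gs_trig g i j = 0.
  by move=> ij; rewrite gs_trigE gs_coef_above// mulr0.
have diag (i : 'I_k) : exists2 a : R, 0 < a & gs_trig g i i = a%:C.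
  exists (gs_scal g i); first exact: gs_scal_gt0.
  by rewrite gs_trigE gs_coef_diag mulr1.
move: (gs_trig g) above diag => A above diag.
rewrite unitmxE unitfE det_trig; last first.
  apply/is_trig_mxP => i j ij; rewrite !mxE above// mulr0 add0r.
  by rewrite -val_eqE /= ltn_eqF// mulr0.
apply/prodf_neq0 => i _; rewrite !mxE; have [a a0 ->] := diag i.
rewrite eqxx !mulr1 -rmorphM -rmorphD.
rewrite /= (_ : 0 = 0%:C) // (inj_eq (@complexI _)) gt_eqF//.
have [->|s0] := eqVneq s 0; first by rewrite subr0 mul1r addr0.
have : 0 <= (1 - s) * a by apply: mulr_ge0; [lra|exact: ltW].
have : 0 < s by rewrite lt_def s0; case/andP: s01.
lra.
Qed.

Lemma gs_trig_unit g : g \in unitmx -> gs_trig g \in unitmx.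
Proof.
move=> gu; have := @gs_trig_convex g 0 gu; rewrite subr0 scale1r scale0r addr0; apply.
by rewrite lexx ler01.
Qed.

Context (T : Type) (F : set_system T) {FF : Filter F}.

Lemma cvg_gs_trig (f : T -> 'M[C]_k) (g : 'M[C]_k) : g \in unitmx -> f x @[x --> F] --> g ->
  gs_trig (f x) @[x --> F] --> gs_trig g.
Proof.
move=> gu fg; have fgij := iffRL (cvg_mxP _ _) fg.
have cb i : rows_before (f x) i @[x --> F] --> rows_before g i.
  apply/cvg_mxP => a b; rewrite !mxE.
  rewrite (_ : (fun x => _) = fun x => f x (before a) b); first exact: fgij.
  by apply/funext => x; rewrite mxE.
have cc i : gs_coef (f x) i @[x --> F] --> gs_coef g i.
  apply: cvg_addmx; first exact: cvg_cst.
  apply: cvg_oppmx.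
  apply: cvg_mulmx; last exact: cvg_cst.
  apply: cvg_mulmx; first apply: cvg_mulmx.
  - apply/cvg_mxP => a b; rewrite !mxE.
    rewrite (_ : (fun x => _) = fun x => f x i b); first exact: fgij.
    by apply/funext => x; rewrite mxE.
  - exact: cvg_adjmx.
  - apply: cvg_invmx; first exact: rows_before_unit.
    by apply: cvg_mulmx => //; exact: cvg_adjmx.
have cn i : gs_coef (f x) i *m f x @[x --> F] --> gs_coef g i *m g by exact: cvg_mulmx.
have cs i : gs_scal (f x) i @[x --> F] --> gs_scal g i.
  have [r r0 e] := gs_norm i gu.
  rewrite /gs_scal; apply: cvgV; first by rewrite e gt_eqF// sqrtr_gt0.
  have cw : gs_coef (f x) i *m f x *m (gs_coef (f x) i *m f x)^t* @[x --> F]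
      --> gs_coef g i *m g *m (gs_coef g i *m g)^t*.
    by apply: cvg_mulmx (cn i) _; exact: cvg_adjmx.
  have cR := cvg_Re (iffRL (cvg_mxP _ _) cw 0 0).
  exact: (continuous_cvg _ (@sqrt_continuous R _) (cR FF FF)).
have key i j : gs_trig (f x) i j @[x --> F] --> gs_trig g i j.
  have -> : (fun x => gs_trig (f x) i j) = fun x => (gs_scal (f x) i)%:C * gs_coef (f x) i 0 j.
    by apply/funext => x; rewrite gs_trigE.
  rewrite gs_trigE; apply: cvgC_mul; first exact: cvg_real_complex.
  have := iffRL (cvg_mxP (fun x => gs_coef (f x) i) (gs_coef g i)) (cc i).
  exact.
exact: (iffLR (cvg_mxP (fun x => gs_trig (f x)) (gs_trig g)) key).
Qed.

Lemma cvg_gs (f : T -> 'M[C]_k) (g : 'M[C]_k) : g \in unitmx -> f x @[x --> F] --> g ->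
  gs (f x) @[x --> F] --> gs g.
Proof. by move=> gu fg; apply: cvg_mulmx (cvg_gs_trig gu fg) fg. Qed.

End GramSchmidt.

(** * Stability of ADHM representations *)

Section AdhmStability.
Local Open Scope complex_scope.
Variables (R : realType) (k n : nat).
Local Notation C := R[i].
Local Notation Q := (adhm_quiver n).
Local Notation v := (adhm_dim k n).
Local Notation rp := (@rep R Q v).

Definition loop0 : edge Q := inl (inl ord0).
Definition loop1 : edge Q := inl (inl ord_max).
Definition out_edge (c : 'I_n) : edge Q := inl (inr c).
Definition in_edge (c : 'I_n) : edge Q := inr c.

Definition framing (x : rp) : 'M[C]_(k, n) := \matrix_(i, c) (x (in_edge c) : 'M[C]_(k, 1)) i 0.
Definition coframing (x : rp) : 'M[C]_(k, n) := \matrix_(i, c) (x (out_edge c) : 'M[C]_(1, k)) 0 i.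

Definition trip (x : rp) : triple C k n := (x loop0 : 'M_k, x loop1 : 'M_k, framing x).
Definition cotrip (x : rp) : triple C k n :=
  ((x loop0 : 'M[C]_k)^T, (x loop1 : 'M[C]_k)^T, coframing x).

Lemma edge_cases (P : edge Q -> Prop) : P loop0 -> P loop1 ->
  (forall c, P (out_edge c)) -> (forall c, P (in_edge c)) -> forall a, P a.
Proof.
move=> P0 P1 Po Pi [[m|c]|c]; [|exact: Po|exact: Pi].
case: m => -[|[|//]] lt.
  by rewrite (_ : Ordinal lt = ord0); [exact: P0|exact: val_inj].
by rewrite (_ : Ordinal lt = ord_max); [exact: P1|exact: val_inj].
Qed.

Definition zero_param : vertex Q -> R := fun=> 0.

Local Notation st := (stable R v zero_param).

Definition pair_space (W1 : {vspace 'cV[C]_k}) (W0 : {vspace 'cV[C]_1}) :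
    forall i : vertex Q, {vspace 'cV[C]_(v i)} :=
  fun i => if i as b return {vspace 'cV[C]_(adhm_dim k n b)} then W1 else W0.

Lemma slope0 w : slope zero_param w = 0.
Proof. by rewrite /slope big1 ?mul0r// => i _; rewrite oppr0 mul0r. Qed.

(** For the zero parameter all slopes are 0, so the strict inequality fails and no proper nonzero
    subrepresentation can exist. *)
Lemma stable_dim (x : rp) W1 W0 : st x -> subrep x (pair_space W1 W0) ->
  (\dim W1 = 0 /\ \dim W0 = 0)%N \/ (\dim W1 = k /\ \dim W0 = 1)%N.
Proof.
move=> stx sub; apply: contrapT => /not_orP[n0 n1].
have w0 : (fun i => \dim (pair_space W1 W0 i)) <> (fun=> 0%N).
  move=> e; apply: n0; split; first exact: (congr1 (fun w : bool -> nat => w true) e).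
  exact: (congr1 (fun w : bool -> nat => w false) e).
have wv : (fun i => \dim (pair_space W1 W0 i)) <> v.
  move=> e; apply: n1; split; first exact: (congr1 (fun w : bool -> nat => w true) e).
  exact: (congr1 (fun w : bool -> nat => w false) e).
by have := stx _ sub w0 wv; rewrite !slope0 ltxx.
Qed.

Lemma mulmx_framing m (U : 'M[C]_(m, k)) (x : rp) c i :
  (U *m framing x) i c = (U *m (x (in_edge c) : 'M[C]_(k, 1))) i 0.
Proof. by rewrite !mxE; apply: eq_bigr => j _; rewrite !mxE. Qed.

Lemma mulmx_coframing m (U : 'M[C]_(m, k)) (x : rp) c i :
  (U *m coframing x) i c = ((x (out_edge c) : 'M[C]_(1, k)) *m U^T) 0 i.
Proof. by rewrite !mxE; apply: eq_bigr => j _; rewrite !mxE mulrC. Qed.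

(** The column vectors killed by [U], with the whole line at vertex 0, form a nonzero
    subrepresentation. By stability it is everything, so [U] vanishes. *)
Lemma stable_nondegenerate (x : rp) : st x -> ~ degenerate (trip x).
Proof.
move=> stx [U [U0 UI UA UB]].
pose W1 := lker (linfun (mulmx U : 'cV[C]_k -> 'cV[C]_k)).
have inv (A : 'M[C]_k) (c : 'cV[C]_k) : (U *m A <= U)%MS -> c \in W1 -> A *m c \in W1.
  rewrite !memv_ker !lfunE /= => /submxP[D eD] /eqP c0.
  by rewrite mulmxA eD -mulmxA c0 mulmx0.
have sub : subrep x (pair_space W1 fullv).
  apply: edge_cases => [c|c|c d|c d]; [exact: inv|exact: inv|by rewrite memvf|].
  move=> _; rewrite memv_ker lfunE /= mulmxA.
  suff -> : U *m (x (in_edge c) : 'M[C]_(k, 1)) = 0 by rewrite mul0mx.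
  by apply/matrixP => i j; rewrite ord1 -mulmx_framing UI !mxE.
have [[_]|[]] := stable_dim stx sub; first by rewrite dimvf /dim /= mul1n.
move=> dimW _; apply/negP: U0; rewrite negbK.
have WT : W1 = fullv.
  by apply/eqP; rewrite eqEdim subvf /= dimvf /dim /= dimW muln1.
apply/eqP/matrixP => i j; have : delta_mx j 0 \in W1 by rewrite WT memvf.
by rewrite memv_ker lfunE /= -colE => /eqP/matrixP/(_ i 0); rewrite !mxE.
Qed.

(** Dually, the image of the transpose of [U], with 0 at vertex 0, is a proper subrepresentation,
    hence zero. *)
Lemma stable_conondegenerate (x : rp) : st x -> ~ degenerate (cotrip x).
Proof.
move=> stx [U [U0 UI UA UB]].
pose W1 := limg (linfun (mulmx U^T : 'cV[C]_k -> 'cV[C]_k)).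
have inv (A : 'M[C]_k) (c : 'cV[C]_k) : (U *m A^T <= U)%MS -> c \in W1 -> A *m c \in W1.
  move=> /submxP[D eD] /memv_imgP[d _ ->]; rewrite lfunE /= mulmxA.
  have -> : A *m U^T = U^T *m D^T by rewrite -trmx_mul -eD trmx_mul trmxK.
  rewrite -mulmxA; have := memv_img (linfun (mulmx U^T : 'cV[C]_k -> 'cV[C]_k)) (memvf (D^T *m d)).
  by rewrite lfunE.
have sub : subrep x (pair_space W1 0%VS).
  apply: edge_cases => [c|c|c d|c d]; [exact: inv|exact: inv| |]; last first.
    by rewrite memv0 => /eqP ->; rewrite mulmx0 mem0v.
  move=> /memv_imgP[d' _ ->]; rewrite lfunE /= mulmxA.
  suff -> : (x (out_edge c) : 'M[C]_(1, k)) *m U^T = 0 by rewrite mul0mx mem0v.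
  by apply/matrixP => i j; rewrite ord1 -mulmx_coframing UI !mxE.
have [[dimW _]|[_]] := stable_dim stx sub; last by rewrite dimv0.
apply/negP: U0; rewrite negbK -trmx_eq0; apply/eqP/matrixP => i j.
have : U^T *m delta_mx j 0 \in W1.
  have := memv_img (linfun (mulmx U^T : 'cV[C]_k -> 'cV[C]_k)) (memvf (delta_mx j 0)).
  by rewrite lfunE.
move/eqP: dimW; rewrite dimv_eq0 => /eqP ->; rewrite memv0 -colE => /eqP/matrixP/(_ i 0).
by rewrite !mxE.
Qed.

Lemma gram_image (x : rp) (W : {vspace 'cV[C]_k}) l (c : 'cV[C]_k) :
  (forall b, (x (in_edge b) : 'M[C]_(k, 1)) \in W) ->
  (forall d : 'cV[C]_k, d \in W -> (x loop0 : 'M[C]_k) *m d \in W) ->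
  (forall d : 'cV[C]_k, d \in W -> (x loop1 : 'M[C]_k) *m d \in W) ->
  gram (trip x) (trip x) l *m c \in W.
Proof.
move=> WI WA WB.
have frW (d : 'cV[C]_n) : framing x *m d \in W.
  rewrite (_ : framing x *m d = \sum_b d b 0 *: (x (in_edge b) : 'M[C]_(k, 1))).
    by apply: memv_suml => b _; apply: memvZ; exact: WI.
  apply/matrixP => i j; rewrite ord1 mxE summxE; apply: eq_bigr => b _.
  by rewrite !mxE mulrC.
elim: l c => [|l IH] c /=; first by rewrite addr0 -mulmxA frW.
rewrite !mulmxDl memvD//; first by rewrite -mulmxA frW.
by rewrite memvD// -!mulmxA ?WA ?WB// mulmxA; rewrite -mulmxA IH.
Qed.

Lemma gram_kernel (x : rp) (W : {vspace 'cV[C]_k}) l (c : 'cV[C]_k) :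
  (forall b (d : 'cV[C]_k), d \in W -> (x (out_edge b) : 'M[C]_(1, k)) *m d = 0) ->
  (forall d : 'cV[C]_k, d \in W -> (x loop0 : 'M[C]_k) *m d \in W) ->
  (forall d : 'cV[C]_k, d \in W -> (x loop1 : 'M[C]_k) *m d \in W) ->
  c \in W -> c^T *m gram (cotrip x) (cotrip x) l = 0.
Proof.
move=> WJ WA WB; elim: l c => [|l IH] c cW /=.
  rewrite addr0 mulmxA (_ : c^T *m coframing x = 0) ?mul0mx//.
  by apply/matrixP => i b; rewrite mulmx_coframing trmxK WJ// !mxE.
rewrite !mulmxDr !mulmxA (_ : c^T *m coframing x = 0) ?mul0mx ?add0r; last first.
  by apply/matrixP => i b; rewrite mulmx_coframing trmxK WJ// !mxE.
by rewrite -!trmx_mul !IH ?mul0mx ?addr0// ?WA ?WB.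
Qed.

(** Vertex 0 carries a line. A subrepresentation missing it is annihilated at vertex 1 by the
    invertible Gram matrix of [cotrip x]; one containing it contains at vertex 1 the image of the
    invertible Gram matrix of [trip x]. *)
Lemma gram_stable (x : rp) : (0 < k)%N ->
  gram (trip x) (trip x) k \in unitmx -> gram (cotrip x) (cotrip x) k \in unitmx ->
  st x.
Proof.
move=> k0 gu gu' V sub w w0 wv; exfalso.
have WA : forall d : 'cV[C]_k, d \in V true -> (x loop0 : 'M[C]_k) *m d \in V true.
  exact: (sub loop0).
have WB : forall d : 'cV[C]_k, d \in V true -> (x loop1 : 'M[C]_k) *m d \in V true.
  exact: (sub loop1).
have dim1 : (\dim (V false) <= 1)%N by have := dimvS (subvf (V false)); rewrite dimvf.
have [V0|V0] := eqVneq (V false) 0%VS.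
  apply: w0; apply/funext => -[]; last by rewrite /w V0 dimv0.
  apply/eqP; rewrite /w dimv_eq0 -subv0; apply/subvP => c cV; rewrite memv0.
  have /(congr1 (mulmx^~ (invmx (gram (cotrip x) (cotrip x) k)))) :
      (c : 'cV[C]_k)^T *m gram (cotrip x) (cotrip x) k = 0.
    apply: (@gram_kernel x (V true)) => // b d dV.
    by have := sub (out_edge b) d dV; rewrite V0 memv0 => /eqP.
  by rewrite mulmxK// mul0mx => /eqP; rewrite trmx_eq0.
have VT : V false = fullv.
  by apply/eqP; rewrite eqEdim subvf /= dimvf /dim /= mul1n lt0n dimv_eq0.
apply: wv; apply/funext => -[]; last by rewrite /w VT dimvf.
suff VT1 : V true = fullv by rewrite /w VT1 dimvf /dim /= muln1.
apply/eqP; rewrite eqEsubv subvf /=; apply/subvP => c _.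
rewrite -[c](mulKVmx gu); apply: gram_image => // b.
have := sub (in_edge b) 1%:M; rewrite VT memvf mulmx1; exact.
Qed.

(** Stability becomes the invertibility of two matrices that are continuous in [x] and transform
    simply under the gauge group; openness and invariance of the stable locus follow. *)
Lemma stable_gramP (x : rp) : (0 < k)%N ->
  st x <-> gram (trip x) (trip x) k \in unitmx /\ gram (cotrip x) (cotrip x) k \in unitmx.
Proof.
move=> k0; split=> [stx|[]]; last exact: gram_stable.
by split; apply: nondegenerate_gram; [exact: stable_nondegenerate|exact: stable_conondegenerate].
Qed.

Lemma unstable_degenerate (x : rp) : (0 < k)%N -> ~ st x ->
  degenerate (trip x) \/ degenerate (cotrip x).
Proof.
move=> k0 nst; apply: contrapT => /not_orP[d1 d2]; apply: nst.
by apply/stable_gramP => //; split; exact: nondegenerate_gram.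
Qed.

End AdhmStability.

(** * Filling spheres of stable representations *)

Lemma small_reindex (R : realType) (T I I' : Type) (c : T -> I -> R) (c' : T -> I' -> R)
    (s : I -> I') (S : T -> Prop) D :
  (forall x i, c x i = c' x (s i)) -> small c' S D -> small c S D.
Proof.
move=> cc [C h]; exists C => m /h[J [q [qJ hq]]]; exists J, q; split=> // x y Sx Sy e i.
by rewrite !cc; exact: hq.
Qed.

Section Embedding.
Local Open Scope complex_scope.
Variables (R : realType) (k n : nat).
Hypotheses (k0 : (0 < k)%N) (n0 : (0 < n)%N).
Local Notation C := R[i].
Local Notation Q := (adhm_quiver n).
Local Notation v := (adhm_dim k n).
Local Notation rp := (@rep R Q v).
Local Notation st := (stable R v (@zero_param R n)).

Definition coord_index := (entry_index k n k n * bool)%type.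

Definition real_dim := #|{: coord_index}|.

Definition rep_coord (x : rp) : coord_index -> R :=
  entry_coord (fun x : rp => x (loop0 n) : 'M[C]_k) (fun x : rp => x (loop1 n) : 'M[C]_k)
    (@framing R k n) (@coframing R k n) x.

Definition emb (x : rp) : 'rV[R]_real_dim := \row_i rep_coord x (enum_val i).

Definition ccoord (z : 'rV[R]_real_dim) (s : entry_index k n k n) : C :=
  z 0 (enum_rank (s, true)) +i* z 0 (enum_rank (s, false)).

Definition unemb (z : 'rV[R]_real_dim) : rp := fun a =>
  match a return 'M[C]_(v (@qhead Q a), v (@qtail Q a)) with
  | inl (inl m) => \matrix_(i < k, j < k)
      ccoord z (if m == ord0 then inl (inl (inl (i, j))) else inl (inl (inr (i, j))))
  | inl (inr c) => \matrix_(i < 1, j < k) ccoord z (inr (j, c))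
  | inr c => \matrix_(i < k, j < 1) ccoord z (inl (inr (i, c)))
  end.

Lemma ccoord_emb x s : ccoord (emb x) s =
  entry (fun x : rp => x (loop0 n) : 'M[C]_k) (fun x : rp => x (loop1 n) : 'M[C]_k)
    (@framing R k n) (@coframing R k n) x s.
Proof.
rewrite /ccoord !mxE !enum_rankK /rep_coord /entry_coord /=.
by case: (entry _ _ _ _ _ _).
Qed.

Lemma embK : cancel emb unemb.
Proof.
move=> x; apply: functional_extensionality_dep; apply: edge_cases => [|| c | c];
  apply/matrixP => i j; rewrite mxE ccoord_emb //= mxE; congr (x _ _ _);
  by rewrite ord1.
Qed.

Lemma unembK : cancel unemb emb.
Proof.
move=> z; apply/rowP => i; rewrite mxE -[in RHS](enum_valK i).
case: (enum_val i) => -[[[s|s]|s]|s] []; rewrite /rep_coord /entry_coord /= !mxE //=;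
  by rewrite -?surjective_pairing.
Qed.


Lemma cvg_adhm_rep (T : Type) (F : set_system T) {FF : Filter F} (f : T -> rp) (A : rp) :
  (forall a i j, f x a i j @[x --> F] --> A a i j) -> f x @[x --> F] --> A.
Proof. by move=> h; apply/cvg_repP => a; apply/cvg_mxP => i j; exact: h. Qed.

Lemma cvg_adhm_entry (T : Type) (F : set_system T) {FF : Filter F} (f : T -> rp) (A : rp) a i j :
  f x @[x --> F] --> A -> f x a i j @[x --> F] --> A a i j.
Proof.
move=> fA; have fAa : f x a @[x --> F] --> A a by apply: (iffRL (cvg_repP f A) fA).
exact: (iffRL (cvg_mxP (fun x => f x a) (A a)) fAa).
Qed.

Lemma cvg_framing (T : Type) (F : set_system T) {FF : Filter F} (f : T -> rp) (A : rp) :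
  f x @[x --> F] --> A -> framing (f x) @[x --> F] --> framing A.
Proof.
move=> fA; apply: (iffLR (cvg_mxP (fun x => framing (f x)) (framing A))) => i j.
rewrite /framing mxE (_ : (fun x => _) = fun x => f x (in_edge j) i 0); last first.
  by apply/funext => x; rewrite mxE.
exact: (@cvg_adhm_entry _ _ _ f A (in_edge j) i 0).
Qed.

Lemma cvg_coframing (T : Type) (F : set_system T) {FF : Filter F} (f : T -> rp) (A : rp) :
  f x @[x --> F] --> A -> coframing (f x) @[x --> F] --> coframing A.
Proof.
move=> fA; apply: (iffLR (cvg_mxP (fun x => coframing (f x)) (coframing A))) => i j.
rewrite /coframing mxE (_ : (fun x => _) = fun x => f x (out_edge j) 0 i); last first.
  by apply/funext => x; rewrite mxE.
exact: (@cvg_adhm_entry _ _ _ f A (out_edge j) 0 i).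
Qed.

Lemma cvg_emb (T : Type) (F : set_system T) {FF : Filter F} (f : T -> rp) (A : rp) :
  f x @[x --> F] --> A -> emb (f x) @[x --> F] --> emb A.
Proof.
move=> fA; apply: (iffLR (cvg_mxP (fun x => emb (f x)) (emb A))) => i j.
rewrite mxE (_ : (fun x => emb (f x) i j) = fun x => rep_coord (f x) (enum_val j)); last first.
  by apply/funext => x; rewrite mxE.
case: (enum_val j) => s t; rewrite /rep_coord /entry_coord /re_im /=.
set en := entry _ _ _ _.
have ce : en (f x) s @[x --> F] --> en A s.
  rewrite /en; case: s => [[[s|s]|s]|s] /=.
  - exact: (@cvg_adhm_entry _ _ _ f A (loop0 n)).
  - exact: (@cvg_adhm_entry _ _ _ f A (loop1 n)).
  - exact: (iffRL (cvg_mxP (fun x => framing (f x)) (framing A)) (cvg_framing fA)).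
  - exact: (iffRL (cvg_mxP (fun x => coframing (f x)) (coframing A)) (cvg_coframing fA)).
by case: t; [exact: cvg_Re|exact: cvg_Im].
Qed.

Lemma cvg_unemb (T : Type) (F : set_system T) {FF : Filter F}
    (f : T -> 'rV[R]_real_dim) (z : 'rV[R]_real_dim) :
  f x @[x --> F] --> z -> unemb (f x) @[x --> F] --> unemb z.
Proof.
move=> fz; have cc s : ccoord (f x) s @[x --> F] --> ccoord z s.
  have fzi := iffRL (cvg_mxP f z) fz.
  by apply: cvg_complex; exact: fzi.
apply: cvg_adhm_rep => -[[m|c]|c] i j; rewrite /unemb mxE.
- rewrite (_ : (fun x => _) = fun x => ccoord (f x)
    (if m == ord0 then inl (inl (inl (i, j))) else inl (inl (inr (i, j))))); first exact: cc.
  by apply/funext => x; rewrite mxE.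
- rewrite (_ : (fun x => _) = fun x => ccoord (f x) (inr (j, c))); first exact: cc.
  by apply/funext => x; rewrite mxE.
- rewrite (_ : (fun x => _) = fun x => ccoord (f x) (inl (inr (i, c)))); first exact: cc.
  by apply/funext => x; rewrite mxE.
Qed.

Definition cvg_triple (T : Type) (F : set_system T) (f : T -> triple C k n) (t : triple C k n) :=
  [/\ (f x).1.1 @[x --> F] --> t.1.1, (f x).1.2 @[x --> F] --> t.1.2 &
      (f x).2 @[x --> F] --> t.2].

Lemma cvg_gram (T : Type) (F : set_system T) {FF : Filter F} (f g : T -> triple C k n) s t l :
  cvg_triple F f s -> cvg_triple F g t ->
  gram (f x) (g x) l @[x --> F] --> gram s t l.
Proof.
move=> [fA fB fI] [gA gB gI].
have cI : (f x).2 *m (g x).2^t* @[x --> F] --> s.2 *m t.2^t*.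
  exact: cvg_mulmx fI (cvg_adjmx gI).
elim: l => [|l IH]; first by apply: cvg_addmx cI _; exact: cvg_cst.
have cA : (f x).1.1 *m gram (f x) (g x) l *m (g x).1.1^t* @[x --> F]
    --> s.1.1 *m gram s t l *m t.1.1^t*.
  exact: cvg_mulmx (cvg_mulmx fA IH) (cvg_adjmx gA).
have cB : (f x).1.2 *m gram (f x) (g x) l *m (g x).1.2^t* @[x --> F]
    --> s.1.2 *m gram s t l *m t.1.2^t*.
  exact: cvg_mulmx (cvg_mulmx fB IH) (cvg_adjmx gB).
exact: cvg_addmx cI (cvg_addmx cA cB).
Qed.

Lemma cvg_trip (T : Type) (F : set_system T) {FF : Filter F} (f : T -> rp) (A : rp) :
  f x @[x --> F] --> A -> cvg_triple F (fun x => trip (f x)) (trip A).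
Proof.
move=> fA; split; last exact: cvg_framing.
  exact: (iffRL (cvg_repP f A) fA (loop0 n)).
exact: (iffRL (cvg_repP f A) fA (loop1 n)).
Qed.

Lemma cvg_cotrip (T : Type) (F : set_system T) {FF : Filter F} (f : T -> rp) (A : rp) :
  f x @[x --> F] --> A -> cvg_triple F (fun x => cotrip (f x)) (cotrip A).
Proof.
move=> fA; split; last exact: cvg_coframing.
  by apply: cvg_trmx; exact: (iffRL (cvg_repP f A) fA (loop0 n)).
by apply: cvg_trmx; exact: (iffRL (cvg_repP f A) fA (loop1 n)).
Qed.

Lemma near_stable (T : Type) (F : set_system T) {FF : Filter F} (f : T -> rp) (A : rp) :
  f x @[x --> F] --> A -> st A -> \forall x \near F, st (f x).
Proof.
move=> fA /stable_gramP[//|u u'].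
have c1 : gram (trip (f x)) (trip (f x)) k @[x --> F] --> gram (trip A) (trip A) k.
  exact: cvg_gram (cvg_trip fA) (cvg_trip fA).
have c2 : gram (cotrip (f x)) (cotrip (f x)) k @[x --> F] --> gram (cotrip A) (cotrip A) k.
  exact: cvg_gram (cvg_cotrip fA) (cvg_cotrip fA).
have n1 : F [set x | gram (trip (f x)) (trip (f x)) k \in unitmx].
  exact: near_unitmx u c1.
have n2 : F [set x | gram (cotrip (f x)) (cotrip (f x)) k \in unitmx].
  exact: near_unitmx u' c2.
change (F [set x | st (f x)]); apply: filterS2 n1 n2 => x /= ux ux'.
exact: (iffRL (stable_gramP _ k0)).
Qed.

Let Z := [set z : 'rV[R]_real_dim | ~ st (unemb z)].

Lemma closed_unstable : closed Z.
Proof.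
rewrite -openC openE => z; rewrite /Z /= => /contrapT stz.
have nst : nbhs z [set y | st (unemb y)].
  exact: near_stable (cvg_unemb (@cvg_id _ (nbhs z))) stz.
by apply: filterS nst => y sty; rewrite /setC /=.
Qed.

Lemma card_real_dim : real_dim = (2 * (k * k + k * k + k * n + k * n))%N.
Proof. by rewrite /real_dim !(card_prod, card_sum) !card_ord card_bool mulnC. Qed.

Lemma small_unstable (M : nat) :
  small (fun p : 'rV[R]_real_dim => p 0)
     (fun z => Z z /\ forall i, `|z 0 i| <= M%:R) (real_dim - 2 * (k - 1 + n)).
Proof.
have dimD d : (0 < d <= k)%N -> (frame_dim k n k n d <= real_dim - 2 * (k - 1 + n))%N.
  by move=> dk; have := frame_dim_codim k n n0 dk; rewrite card_real_dim; lia.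
pose S (b : bool) (z : 'rV[R]_real_dim) :=
  (if b then degenerate (trip (unemb z)) else degenerate (cotrip (unemb z))) /\
  forall i, `|z 0 i| <= M%:R.
apply: (@small_sub _ _ _ _ _ (fun z => exists b, S b z)) => [z [nst zM]|].
  by have [dz|dz] := unstable_degenerate k0 nst; [exists true|exists false].
apply: small_bigcup => -[].
- have := @small_degenerate R k n k n _ (fun z => unemb z (loop0 n)) (fun z => unemb z (loop1 n))
    (fun z => framing (unemb z)) (fun z => coframing (unemb z)) M _ dimD.
  set cd := entry_coord _ _ _ _ => sm.
  have cdE z s : cd z s = z 0 (enum_rank s).
    have := congr1 (fun y : 'rV__ => y 0 (enum_rank s)) (unembK z).
    by rewrite mxE enum_rankK.
  apply: (@small_reindex _ _ _ _ _ cd enum_val) => [z i|].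
    by rewrite cdE enum_valK.
  by apply: small_sub sm => z [dz zM]; split=> // s; rewrite cdE.
- have := @small_degenerate R k n k n _ (fun z => (unemb z (loop0 n) : 'M[C]_k)^T)
    (fun z => (unemb z (loop1 n) : 'M[C]_k)^T)
    (fun z => coframing (unemb z)) (fun z => framing (unemb z)) M _ dimD.
  set cd := entry_coord _ _ _ _ => sm.
  (* The permutation of coordinates that transposes the loops and exchanges framing with
     coframing. *)
  pose tr (s : coord_index) : coord_index := (match s.1 with
    | inl (inl (inl ij)) => inl (inl (inl (ij.2, ij.1)))
    | inl (inl (inr ij)) => inl (inl (inr (ij.2, ij.1)))
    | inl (inr ij) => inr ij
    | inr ij => inl (inr ij) end, s.2).
  have cdE z s : cd z s = z 0 (enum_rank (tr s)).
    have := congr1 (fun y : 'rV__ => y 0 (enum_rank (tr s))) (unembK z).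
    rewrite mxE enum_rankK => <-.
    by case: s => -[[[s|s]|s]|s] b; rewrite /cd /rep_coord /entry_coord /= ?mxE.
  have trK : involutive tr by move=> [[[[[i j]|[i j]]|[i j]]|[i j]] b].
  apply: (@small_reindex _ _ _ _ _ cd (fun i => tr (enum_val i))) => [z i|].
    by rewrite cdE trK enum_valK.
  by apply: small_sub sm => z [dz zM]; split=> // s; rewrite cdE.
Qed.

Lemma stable_extension e (f : 'rV[R]_e -> 'rV[R]_real_dim) : (e < 2 * (k - 1 + n))%N ->
  {within @cube R e, continuous f} -> (forall t, cube_boundary t -> st (unemb (f t))) ->
  exists f' : 'rV[R]_e -> 'rV[R]_real_dim,
    [/\ {within @cube R e, continuous f'}, (forall t, cube t -> st (unemb (f' t))) &
        forall t, cube_boundary t -> f' t = f t].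
Proof.
move=> ec cf bf.
(* Needed because subtraction is truncated; it is read off the count for [d = 1]. *)
have codim : (2 * (k - 1 + n) <= real_dim)%N.
  have := @frame_dim_codim k n k n 1 n0 k0; rewrite card_real_dim; lia.
have DE : (real_dim - 2 * (k - 1 + n) + e < real_dim)%N by lia.
have nZ t : cube_boundary t -> ~ Z (f t) by move=> /bf ?; exact.
have [f' [cf' sf' bf']] := general_position closed_unstable small_unstable DE cf nZ.
by exists f'; split=> // t ct; apply: contrapT => /sf'; apply.
Qed.

End Embedding.

Lemma within_comp_cvg (T S X : topologicalType) (A : set T) (B : set S)
    (phi : T -> S) (f : S -> X) (x : T) :
  A x -> (forall y, A y -> B (phi y)) ->
  phi y @[y --> within A (nbhs x)] --> phi x ->
  {within B, continuous f} ->
  f (phi y) @[y --> within A (nbhs x)] --> f (phi x).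
Proof.
move=> Ax AB cphi /subspace_continuousP/(_ (phi x) (AB x Ax)) cf W nW.
have nB : within B (nbhs (phi x)) [set y | W (f y)] := cf W nW.
have nphi : within A (nbhs x) [set y | B (phi y) -> W (f (phi y))] := cphi _ nB.
change (nbhs x [set y | A y -> W (f (phi y))]).
by apply: (@filterS _ (nbhs x) _ _ _ _ nphi) => y h Ay; exact: h Ay (AB y Ay).
Qed.

Lemma within_cvg (T X : topologicalType) (A : set T) (f : T -> X) (x : T) :
  A x -> {within A, continuous f} -> f y @[y --> within A (nbhs x)] --> f x.
Proof. by move=> Ax /subspace_continuousP; apply. Qed.

Lemma within_cvgP (T X : topologicalType) (A : set T) (f : T -> X) :
  (forall x, A x -> f y @[y --> within A (nbhs x)] --> f x) -> {within A, continuous f}.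
Proof. by move=> h; apply/subspace_continuousP. Qed.

(** * Cubes as cylinders over their faces *)

Section InsertCoordinate.
Variables (R : realType) (j : nat) (h : 'I_j.+1).

Definition ins (u : R) (t : 'rV[R]_j) : 'rV[R]_j.+1 :=
  \row_i oapp (t 0) u (unlift h i).

Lemma ins_at u t : ins u t 0 h = u.
Proof. by rewrite mxE unlift_none. Qed.

Lemma ins_lift u t i : ins u t 0 (lift h i) = t 0 i.
Proof. by rewrite mxE liftK. Qed.

Lemma ins_col' (t : 'rV[R]_j.+1) : ins (t 0 h) (col' h t) = t.
Proof. by apply/rowP => i; rewrite mxE; case: unliftP => [l ->|->] //=; rewrite mxE. Qed.

Lemma col'_ins u t : col' h (ins u t) = t.
Proof. by apply/rowP => i; rewrite mxE ins_lift. Qed.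

Lemma cube_ins u t : cube (ins u t) <-> 0 <= u <= 1 /\ cube t.
Proof.
split=> [c|[u01 ct] i]; last by rewrite mxE; case: unlift => [l|] //=.
by split=> [|i]; [have := c h; rewrite ins_at|have := c (lift h i); rewrite ins_lift].
Qed.

Lemma cube_boundary_ins u t : cube_boundary (ins u t) <->
  (0 <= u <= 1 /\ cube t) /\ (u = 0 \/ u = 1 \/ cube_boundary t).
Proof.
split=> [[/cube_ins cc [i hi]]|[cc b]].
  split=> //; have [_ ct] := cc; move: hi; case: (unliftP h i) => [l ->|->].
    by rewrite ins_lift => hl; right; right; split=> //; exists l.
  by rewrite ins_at => -[]; [left|right; left].
split; first exact/cube_ins.
case: b => [u0|[u1|[_ [i hi]]]]; first by exists h; rewrite ins_at; left.
  by exists h; rewrite ins_at; right.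
by exists (lift h i); rewrite ins_lift.
Qed.

Lemma cvg_ins (T : Type) (F : set_system T) {FF : Filter F} (f : T -> R)
    (g : T -> 'rV[R]_j) (u : R) (t : 'rV[R]_j) :
  f x @[x --> F] --> u -> g x @[x --> F] --> t ->
  ins (f x) (g x) @[x --> F] --> ins u t.
Proof.
move=> fu gt; apply: (iffLR (cvg_mxP (fun x => ins (f x) (g x)) (ins u t))) => i l.
rewrite ord1 mxE; rewrite (_ : (fun x => _) = fun x => oapp (g x 0) (f x) (unlift h l)).
  by case: unlift => [m|] //=; exact: (iffRL (cvg_mxP g t) gt).
by apply/funext => x; rewrite mxE.
Qed.

Lemma cvg_col' (T : Type) (F : set_system T) {FF : Filter F}
    (g : T -> 'rV[R]_j.+1) (t : 'rV[R]_j.+1) :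
  g x @[x --> F] --> t -> col' h (g x) @[x --> F] --> col' h t.
Proof.
move=> gt; apply: (iffLR (cvg_mxP (fun x => col' h (g x)) (col' h t))) => i l.
rewrite mxE (_ : (fun x => _) = fun x => g x i (lift h l)).
  exact: (iffRL (cvg_mxP g t) gt).
by apply/funext => x; rewrite mxE.
Qed.

Lemma continuous_col' : continuous (fun t : 'rV[R]_j.+1 => col' h t).
Proof. by move=> t; exact: (@cvg_col' _ (nbhs t) _ id t (@cvg_id _ (nbhs t))). Qed.

Lemma continuous_split : continuous (fun t : 'rV[R]_j.+1 => (t 0 h, col' h t)).
Proof. by apply: pair_continuous; [exact: coord_cont|exact: continuous_col']. Qed.

Lemma continuous_ins : continuous (fun p : R * 'rV[R]_j => ins p.1 p.2).
Proof. by move=> p; apply: cvg_ins; [exact: cvg_fst|exact: cvg_snd]. Qed.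

Lemma cylinder_split (t : 'rV[R]_j.+1) : cube t -> cylinder (t 0 h, col' h t).
Proof. by rewrite -{1}(ins_col' t) => /cube_ins. Qed.

End InsertCoordinate.

Lemma within_cylinder_snd (R : realType) j (X : topologicalType) (f : 'rV[R]_j -> X)
    (p : R * 'rV[R]_j) : cylinder p -> {within @cube R j, continuous f} ->
  f q.2 @[q --> within (@cylinder R j) (nbhs p)] --> f p.2.
Proof.
move=> cp cf.
have := @within_comp_cvg _ _ _ (@cylinder R j) (@cube R j) snd f p cp.
by apply => // [y []//|]; case: p {cp} => s t; exact: cvg_within_filter cvg_snd.
Qed.

Section StableFilling.
Variables (R : realType) (k n : nat).
Hypotheses (k0 : (0 < k)%N) (n0 : (0 < n)%N).
Local Notation Q := (adhm_quiver n).
Local Notation v := (adhm_dim k n).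
Local Notation rp := (@rep R Q v).
Local Notation st := (stable R v (@zero_param R n)).
Local Notation E := (real_dim k n).

Lemma val_insubd (x0 : st) (A : rp) : st A -> val (insubd x0 A) = A.
Proof. by move=> stA; rewrite insubdK// unfold_in /=; exact/mem_set. Qed.

Lemma stable_val (x : st) : st (val x).
Proof. exact: set_mem (valP x). Qed.

(** The stable locus is open, so [insubd] eventually returns [f x] instead of its default. *)
Lemma cvg_insubd (T : Type) (F : set_system T) {FF : Filter F} (x0 : T -> st) (f : T -> rp)
    (a : st) : f x @[x --> F] --> val a -> insubd (x0 x) (f x) @[x --> F] --> a.
Proof.
move=> fa; apply: (iffRL (cvg_set_typeP _ _)).
have nst : F [set x | st (f x)] :=
  @near_stable R k n k0 T F FF f _ fa (@stable_val a).
apply: (@cvg_near_eq T F FF _ f _ _ _ fa).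
by apply: filterS nst => x stx; rewrite /= val_insubd.
Qed.

Lemma stable_filling e (x0 : st) (f : 'rV[R]_e -> 'rV[R]_E) : (e < 2 * (k - 1 + n))%N ->
  {within @cube R e, continuous f} -> (forall t, cube_boundary t -> st (unemb (f t))) ->
  exists F : 'rV[R]_e -> st, {within @cube R e, continuous F} /\
    forall t, cube_boundary t -> val (F t) = unemb (f t).
Proof.
move=> ec cf bf; have [f' [cf' sf' bf']] := stable_extension k0 n0 ec cf bf.
exists (fun t => insubd x0 (unemb (f' t))); split; last first.
  by move=> t bt; rewrite val_insubd bf'//; exact: bf.
apply/subspace_continuousP => t ct; apply: cvg_insubd.
rewrite val_insubd; last exact: sf'.
by apply: cvg_unemb; exact: (iffLR (subspace_continuousP _ _) cf' t ct).
Qed.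

Lemma stable_cylinder_filling j (x0 : st) (f : R * 'rV[R]_j -> 'rV[R]_E) :
  (j.+1 < 2 * (k - 1 + n))%N ->
  {within @cylinder R j, continuous f} ->
  (forall s t, cylinder (s, t) -> (s = 0 \/ s = 1 \/ cube_boundary t) -> st (unemb (f (s, t)))) ->
  exists F : R * 'rV[R]_j -> st, {within @cylinder R j, continuous F} /\
    forall s t, cylinder (s, t) -> (s = 0 \/ s = 1 \/ cube_boundary t) ->
      val (F (s, t)) = unemb (f (s, t)).
Proof.
move=> jc cf bf; have [||F [cF bF]] := @stable_filling j.+1 x0
  (fun t => f (t 0 ord0, col' ord0 t)) jc.
- apply: (@within_comp _ _ _ _ (@cylinder R j)
    (fun t : 'rV[R]_j.+1 => (t 0 ord0, col' ord0 t)) f) cf => [|t ct].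
    exact: continuous_split.
  exact: cylinder_split.
- move=> t; rewrite -{1}(ins_col' ord0 t) => /cube_boundary_ins[cc b]; exact: bf.
exists (fun p => F (ins ord0 p.1 p.2)); split.
  apply: (@within_comp _ _ _ _ (@cube R j.+1) (fun p : R * 'rV[R]_j => ins ord0 p.1 p.2) F) cF.
    exact: continuous_ins.
  by move=> [s t] cc; exact/cube_ins.
move=> s t cc b; rewrite bF ?ins_at ?col'_ins//=.
exact/cube_boundary_ins.
Qed.

(** The affine homotopy to the constant is stable on the boundary of the cylinder; its interior
    values are replaced by a filling in dimension [j + 1]. *)
Lemma stable_homotopy_trivial j : (j < 2 * (k - 1 + n) - 1)%N ->
  inhabited st -> forall (x : st) (f : gloop R x j), homotopic f (cst_gloop R x j).
Proof.
move=> jc _ x f; have jc' : (j.+1 < 2 * (k - 1 + n))%N by lia.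
pose g (p : R * 'rV[R]_j) := (1 - p.1) *: emb (val (f p.2)) + p.1 *: emb (val x).
have g0 t : unemb (g (0, t)) = val (f t).
  by rewrite /g /= subr0 scale1r scale0r addr0 embK.
have g1 t : unemb (g (1, t)) = val x.
  by rewrite /g /= subrr scale1r scale0r add0r embK.
have gb s t : cube_boundary t -> unemb (g (s, t)) = val x.
  by move=> bt; rewrite /g /= (gloop_bd f bt) -scalerDl subrK scale1r embK.
have cg : {within @cylinder R j, continuous g}.
  apply/subspace_continuousP => -[s t] [s01 ct].
  have c1 : p.1 @[p --> within (@cylinder R j) (nbhs (s, t))] --> s.
    exact: cvg_within_filter cvg_fst.
  apply: cvgD; last by apply: cvgZ c1 _; exact: cvg_cst.
  apply: cvgZ; first by apply: cvgB c1; exact: cvg_cst.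
  have c2 : f p.2 @[p --> within (@cylinder R j) (nbhs (s, t))] --> f t.
    exact: (within_cylinder_snd (conj s01 ct) (@gloop_cont _ _ _ _ f)).
  by apply: cvg_emb; exact: (iffLR (cvg_set_typeP _ _) c2).
have [|F [cF bF]] := stable_cylinder_filling x jc' cg.
  move=> s t cc [->|[->|bt]]; rewrite ?g0 ?g1 ?gb//; exact: stable_val.
have i0 : 0 <= (0 : R) <= 1 by rewrite lexx ler01.
have i1 : 0 <= (1 : R) <= 1 by rewrite lexx ler01.
exists F; split=> // [t ct|t ct|s t s01 bt]; apply: val_inj.
- by rewrite bF ?g0//; left.
- by rewrite bF ?g1//; right; left.
- by rewrite bF ?gb//; [split=> //; exact: bt.1|right; right].
Qed.

End StableFilling.

(** * Gauge action and local sections *)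

(** Extension over the cube of dimension 0, a point with empty boundary: the zero representation is
    replaced by a stable one. *)
Lemma stable_inhabited (R : realType) k n : (0 < k)%N -> (0 < n)%N ->
  inhabited (stable R (adhm_dim k n) (@zero_param R n)).
Proof.
move=> k0 n0; have e0 : (0 < 2 * (k - 1 + n))%N by lia.
have bd (t : 'rV[R]_0) : ~ cube_boundary t by move=> [_ [[]]].
have [||f' [_ sf' _]] := @stable_extension R k n k0 n0 0 (fun=> 0) e0.
- by apply/subspace_continuousP => x _; exact: cvg_cst.
- by move=> t /bd.
have sx : stable R (adhm_dim k n) (@zero_param R n) (unemb (f' 0)) by apply: sf' => -[].
by constructor; exists (unemb (f' 0)); exact/mem_set.
Qed.

Section GaugeAction.
Variables (R : realType) (k n : nat).
Hypotheses (k0 : (0 < k)%N) (n0 : (0 < n)%N).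
Local Notation C := R[i].
Local Notation Q := (adhm_quiver n).
Local Notation v := (adhm_dim k n).
Local Notation rp := (@rep R Q v).
Local Notation st := (stable R v (@zero_param R n)).
Local Notation mod := (moduli R v (@zero_param R n)).

Definition gauge (g : 'M[C]_k) (l : 'M[C]_1) : forall i : vertex Q, 'M[C]_(v i) :=
  fun i => if i as b return 'M[C]_(adhm_dim k n b) then g else l.

Definition act_rep (g : 'M[C]_k) (A : rp) : rp := gauge_act (gauge g 1%:M) A.

Lemma act_rep_loop0 g A : act_rep g A (loop0 n) = g *m (A (loop0 n) : 'M[C]_k) *m invmx g.
Proof. by []. Qed.

Lemma act_rep_loop1 g A : act_rep g A (loop1 n) = g *m (A (loop1 n) : 'M[C]_k) *m invmx g.
Proof. by []. Qed.

Lemma act_rep_in g A c : act_rep g A (in_edge c) = g *m (A (in_edge c) : 'M[C]_(k, 1)).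
Proof. by rewrite /act_rep /gauge_act /= invmx1 mulmx1. Qed.

Lemma act_rep_out g A c : act_rep g A (out_edge c) = (A (out_edge c) : 'M[C]_(1, k)) *m invmx g.
Proof. by rewrite /act_rep /gauge_act /= mul1mx. Qed.

Lemma trip_act g A : trip (act_rep g A) = triple_act g (trip A).
Proof.
rewrite /trip /triple_act /=; congr (_, _, _).
apply/matrixP => i c; rewrite mulmx_framing -act_rep_in.
by rewrite mxE.
Qed.

Lemma cotrip_act g A : g \in unitmx ->
  cotrip (act_rep g A) = triple_act (invmx g)^T (cotrip A).
Proof.
move=> gu; rewrite /cotrip /triple_act /= !act_rep_loop0 !act_rep_loop1 !trmx_mul.
rewrite trmx_inv invmxK !mulmxA; congr (_, _, _).
apply/matrixP => i c; rewrite mulmx_coframing -trmx_inv trmxK -act_rep_out.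
by rewrite mxE.
Qed.

Lemma stable_act g (A : rp) : g \in unitmx -> st A -> st (act_rep g A).
Proof.
move=> gu /stable_gramP[//|u u']; apply: (iffRL (stable_gramP _ k0)).
have gu' : (invmx g)^T \in unitmx by rewrite unitmx_tr unitmx_inv.
rewrite trip_act (cotrip_act _ gu) (gram_act _ _ _ gu gu) (gram_act _ _ _ gu' gu').
by rewrite !unitmx_mul (adjmx_unit gu) (adjmx_unit gu') gu gu' u u'.
Qed.

(** Total in [g]: the default [x] can only occur for singular [g]. *)
Definition actP (g : 'M[C]_k) (x : st) : st := insubd x (act_rep g (val x)).

Lemma val_actP g x : g \in unitmx -> val (actP g x) = act_rep g (val x).
Proof. by move=> gu; rewrite val_insubd//; apply: stable_act => //; exact: stable_val. Qed.

Lemma act_repM g h A : g \in unitmx -> h \in unitmx ->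
  act_rep g (act_rep h A) = act_rep (g *m h) A.
Proof.
move=> gu hu; apply: functional_extensionality_dep; apply: edge_cases => [| | c | c].
- by rewrite !act_rep_loop0 invmx_mul// !mulmxA.
- by rewrite !act_rep_loop1 invmx_mul// !mulmxA.
- by rewrite !act_rep_out invmx_mul// !mulmxA.
- by rewrite !act_rep_in !mulmxA.
Qed.

Lemma act_rep1 A : act_rep 1%:M A = A.
Proof.
apply: functional_extensionality_dep; apply: edge_cases => [| | c | c].
- by rewrite act_rep_loop0 invmx1 mul1mx mulmx1.
- by rewrite act_rep_loop1 invmx1 mul1mx mulmx1.
- by rewrite act_rep_out invmx1 mulmx1.
- by rewrite act_rep_in mul1mx.
Qed.

Lemma actPM g h x : g \in unitmx -> h \in unitmx -> actP g (actP h x) = actP (g *m h) x.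
Proof.
move=> gu hu; apply: val_inj; have ghu : g *m h \in unitmx by rewrite unitmx_mul gu.
apply: etrans (val_actP (actP h x) gu) _.
apply: etrans (congr1 (act_rep g) (val_actP x hu)) _.
exact: etrans (act_repM _ gu hu) (esym (val_actP x ghu)).
Qed.

Lemma actP1 x : actP 1%:M x = x.
Proof. by apply: val_inj; rewrite val_actP ?unitmx1// act_rep1. Qed.

Lemma cvg_actP (T : Type) (F : set_system T) {FF : Filter F}
    (g : T -> 'M[C]_k) (x : T -> st) (h : 'M[C]_k) (a : st) : h \in unitmx ->
  g t @[t --> F] --> h -> x t @[t --> F] --> a ->
  actP (g t) (x t) @[t --> F] --> actP h a.
Proof.
move=> hu gh /(iffLR (cvg_set_typeP _ _)) xa; apply: cvg_insubd => //.
rewrite val_actP//.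
have xaa e : val (x t) e @[t --> F] --> val a e.
  exact: (iffRL (cvg_repP (fun t => val (x t)) (val a)) xa e).
have gi : invmx (g t) @[t --> F] --> invmx h by exact: cvg_invmx.
apply: (iffLR (cvg_repP (fun t => act_rep (g t) (val (x t))) (act_rep h (val a)))).
apply: edge_cases => [| | c | c].
- exact: cvg_mulmx (cvg_mulmx gh (xaa (loop0 n))) gi.
- exact: cvg_mulmx (cvg_mulmx gh (xaa (loop1 n))) gi.
- rewrite act_rep_out (_ : (fun t => _) = fun t =>
    (val (x t) (out_edge c) : 'M[C]_(1, k)) *m invmx (g t)); last first.
    by apply/funext => t; rewrite act_rep_out.
  exact: cvg_mulmx (xaa (out_edge c)) gi.
- rewrite act_rep_in (_ : (fun t => _) = fun t =>
    g t *m (val (x t) (in_edge c) : 'M[C]_(k, 1))); last first.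
    by apply/funext => t; rewrite act_rep_in.
  exact: cvg_mulmx gh (xaa (in_edge c)).
Qed.

(* [transl y z] is [G_yz G_zz^-1] for the mixed Gram matrices [G]: it is
   equivariant in both arguments and equals 1 on the diagonal, so it is the
   [g] with [y = g z] on a single orbit and a coarse parallel transport between
   nearby orbits. *)
Definition transl (y z : st) : 'M[C]_k :=
  gram (trip (val y)) (trip (val z)) k *m invmx (gram (trip (val z)) (trip (val z)) k).

Lemma gram_unit (x : st) : gram (trip (val x)) (trip (val x)) k \in unitmx.
Proof. by have /stable_gramP[] := @stable_val R k n x. Qed.

Lemma transl_act g h y z : g \in unitmx -> h \in unitmx ->
  transl (actP g y) (actP h z) = g *m transl y z *m invmx h.
Proof.
move=> gu hu; rewrite /transl (val_actP _ gu) (val_actP _ hu) !trip_act.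
rewrite (gram_act _ _ _ gu hu) (gram_act _ _ _ hu hu).
have hu' := adjmx_unit hu; have zu := gram_unit z.
by rewrite !invmx_mul ?unitmx_mul ?hu ?zu// !mulmxA mulmxK.
Qed.

Lemma transl_self z : transl z z = 1%:M.
Proof. by rewrite /transl mulmxV// gram_unit. Qed.

(** The action is therefore free, and the group element is a continuous function of the two
    points. *)
Lemma transl_actl g z : g \in unitmx -> transl (actP g z) z = g.
Proof.
by move=> gu; rewrite -{2}(actP1 z) transl_act ?unitmx1// transl_self invmx1 !mulmx1.
Qed.

Lemma cvg_transl (T : Type) (F : set_system T) {FF : Filter F} (y z : T -> st) (a b : st) :
  y t @[t --> F] --> a -> z t @[t --> F] --> b ->
  transl (y t) (z t) @[t --> F] --> transl a b.
Proof.
move=> /(iffLR (cvg_set_typeP _ _)) ya /(iffLR (cvg_set_typeP _ _)) zb.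
have c1 : gram (trip (val (y t))) (trip (val (z t))) k @[t --> F]
    --> gram (trip (val a)) (trip (val b)) k.
  exact: cvg_gram (cvg_trip ya) (cvg_trip zb).
have c2 : gram (trip (val (z t))) (trip (val (z t))) k @[t --> F]
    --> gram (trip (val b)) (trip (val b)) k.
  exact: cvg_gram (cvg_trip zb) (cvg_trip zb).
by apply: cvg_mulmx c1 _; apply: cvg_invmx c2; exact: gram_unit.
Qed.

Definition orbit (x : st) : mod :=
  \pi_(quotient_topology {eq_quot (orbit_equiv v (@zero_param R n))}) x.

Lemma orbitP x y : orbit x = orbit y <-> exists2 g, g \in unitmx & y = actP g x.
Proof.
split=> [/eqquotP/asboolP[g [gu gB]]|[g gu ->]].
  have lu : (g false : 'M[C]_1) \in unitmx := gu false.
  have l0 : (g false : 'M[C]_1) 0 0 != 0.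
    by move: lu; rewrite unitmxE unitfE det_mx11.
  pose l := (g false : 'M[C]_1) 0 0.
  have gE : (g false : 'M[C]_1) = l%:M by rewrite [LHS]mx11_scalar.
  have hu : l^-1 *: (g true : 'M[C]_k) \in unitmx.
    by rewrite unitmxZ ?unitfE ?invr_eq0//; exact: gu true.
  exists (l^-1 *: (g true : 'M[C]_k)) => //; apply: val_inj; rewrite (val_actP _ hu) gB.
  have iE (A : 'M[C]_k) : A \in unitmx -> invmx (l^-1 *: A) = l *: invmx A.
    by move=> Au; rewrite invmxZ ?invrK// unitmxZ ?unitfE ?invr_eq0.
  apply: functional_extensionality_dep; apply: edge_cases => [| | c | c].
  - rewrite act_rep_loop0 /gauge_act /= iE; last exact: gu true.
    by rewrite -!scalemxAl -scalemxAr scalerA mulVf// scale1r.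
  - rewrite act_rep_loop1 /gauge_act /= iE; last exact: gu true.
    by rewrite -!scalemxAl -scalemxAr scalerA mulVf// scale1r.
  - rewrite act_rep_out /gauge_act /= iE; last exact: gu true.
    by rewrite -scalemxAr gE mul_scalar_mx -scalemxAl.
  - rewrite act_rep_in /gauge_act /= gE invmx_scalar mul_mx_scalar.
    by rewrite -scalemxAl.
apply/eqquotP/asboolP; exists (gauge g 1%:M); split; last by rewrite val_actP.
by move=> [|] /=; [exact: gu|exact: unitmx1].
Qed.

Lemma orbit_act g x : g \in unitmx -> orbit (actP g x) = orbit x.
Proof. by move=> gu; apply/esym/orbitP; exists g. Qed.

Lemma transl_orbit y z : orbit y = orbit z ->
  transl y z \in unitmx /\ y = actP (transl y z) z.
Proof. by move=> /esym/orbitP[g gu ->]; rewrite transl_actl. Qed.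

Lemma orbit_surj m : exists x, orbit x = m.
Proof. by exists (repr m); exact: reprK. Qed.

Lemma orbit_continuous : continuous orbit.
Proof. exact: pi_continuous. Qed.

(** The saturation of an open set is a union of its translates, which are open by continuity of the
    action. *)
Lemma orbit_open (x : st) (U : set st) : nbhs x U -> nbhs (orbit x) (orbit @` U).
Proof.
rewrite nbhsE => -[V [oV Vx] VU].
have sub : orbit @` V `<=` orbit @` U by move=> _ [y Vy <-]; exists y => //; exact: VU.
apply: filterS sub _; apply: open_nbhs_nbhs; split; last by exists x.
rewrite /open /= /quotient_open openE => y [z Vz /esym/orbitP[g gu zE]].
have cg : actP g w @[w --> nbhs y] --> z.
  rewrite zE; apply: (@cvg_actP _ (nbhs y) _ (fun=> g) id g y gu); first exact: cvg_cst.
  exact: (@cvg_id _ (nbhs y)).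
have nV : nbhs z V by apply: open_nbhs_nbhs.
have : nbhs y [set w | V (actP g w)] := cg V nV.
by apply: filterS => w Vw; exists (actP g w); rewrite ?orbit_act.
Qed.

End GaugeAction.

Arguments orbit {R k n} x.

(** * Lifting to stable representations *)

Section Lifting.
Variables (R : realType) (k n : nat).
Hypothesis k0 : (0 < k)%N.
Local Notation C := R[i].
Local Notation v := (adhm_dim k n).
Local Notation st := (stable R v (@zero_param R n)).
Local Notation mod := (moduli R v (@zero_param R n)).

Definition transport (y z : st) : st := actP (transl y z) z.

Lemma transport_orbit (y z : st) : transl y z \in unitmx -> orbit (transport y z) = orbit z.
Proof. by move=> u; rewrite /transport orbit_act. Qed.

(** The factor [invmx h] in [transl y (actP h z)] cancels [h]: transport depends on [z] only through
    its orbit. *)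
Lemma transport_inv h (y z : st) : h \in unitmx -> transl y z \in unitmx ->
  transport y (actP h z) = transport y z.
Proof.
move=> hu u; have e : transl y (actP h z) = transl y z *m invmx h.
  apply: etrans (congr1 (fun w => transl w (actP h z)) (esym (actP1 k0 y))) _.
  by apply: etrans (transl_act k0 y z (unitmx1 _ _) hu) _; rewrite mul1mx.
have uh : transl y z *m invmx h \in unitmx by rewrite unitmx_mul u unitmx_inv.
rewrite /transport e; apply: etrans (actPM k0 z uh hu) _.
by rewrite mulmxKV.
Qed.

(** Only the orbits of [z t] converge. As [orbit] is open, [z t] can be replaced in its orbit by a
    point near [z0] without changing the transport. *)
Lemma cvg_transport (T : Type) (F : set_system T) {FF : Filter F}
    (y z : T -> st) (y0 z0 : st) :
  transl y0 z0 \in unitmx ->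
  y t @[t --> F] --> y0 -> orbit (z t) @[t --> F] --> orbit z0 ->
  transport (y t) (z t) @[t --> F] --> transport y0 z0.
Proof.
move=> u yy0 zz0 W nW.
have ct : transport p.1 p.2 @[p --> nbhs (y0, z0)] --> transport y0 z0.
  apply: cvg_actP => //; last exact: cvg_snd.
  by apply: cvg_transl => //; [exact: cvg_fst|exact: cvg_snd].
have cu : transl p.1 p.2 @[p --> nbhs (y0, z0)] --> transl y0 z0.
  by apply: cvg_transl => //; [exact: cvg_fst|exact: cvg_snd].
have nWu : nbhs (y0, z0) [set p | W (transport p.1 p.2) /\ transl p.1 p.2 \in unitmx].
  apply: filterI; first exact: ct W nW.
  exact: near_unitmx u cu.
have [[U V] [/= nU nV] UV] := nWu.
have FU : F [set t | U (y t)] := yy0 U nU.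
have FV : F [set t | (orbit @` V) (orbit (z t))] := zz0 _ (orbit_open k0 nV).
change (F [set t | W (transport (y t) (z t))]).
apply: filterS2 FU FV => t /= Ut [z' Vz' /(orbitP k0)[g gu zE]].
have [/= Wt ut] := UV (y t, z') (conj Ut Vz').
by rewrite zE transport_inv.
Qed.

(** The lift is carried outward along the rays from 0 in [m] steps, each transporting the previous
    point to the next orbit. The section [sec] is arbitrary. *)
Lemma orbit_lift (T : normedModType R) (D : set T) (f : T -> mod) :
  compact D -> D 0 -> (forall s t, 0 <= s <= 1 -> D t -> D (s *: t)) ->
  {within D, continuous f} ->
  exists F : T -> st, {within D, continuous F} /\ forall t, D t -> orbit (F t) = f t.
Proof.
move=> cD D0 Dstar cf.
have [sec secK] := choice (@orbit_surj R k n).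
(* One [eta] serves all representatives: acting on [y] and [z] multiplies [transl y z] by invertible
   matrices. *)
have [eta eta0 unif] : exists2 eta : R, 0 < eta & forall t t', D t -> D t' ->
    `|t - t'| < eta -> forall y z, orbit y = f t -> orbit z = f t' -> transl y z \in unitmx.
  apply: compact_uniform => // t0 Dt0.
  have u1 : transl (sec (f t0)) (sec (f t0)) \in unitmx by rewrite transl_self ?unitmx1.
  have cu : transl p.1 p.2 @[p --> nbhs (sec (f t0), sec (f t0))]
      --> transl (sec (f t0)) (sec (f t0)).
    by apply: cvg_transl => //; [exact: cvg_fst|exact: cvg_snd].
  have [[U V] [/= nU nV] UV] := near_unitmx u1 cu.
  have cft := within_cvg Dt0 cf.
  have nU' : nbhs (f t0) (orbit @` U) by rewrite -[f t0]secK; exact: orbit_open.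
  have nUf : within D (nbhs t0) [set t | (orbit @` U) (f t)] := cft _ nU'.
  have nV' : nbhs (f t0) (orbit @` V) by rewrite -[f t0]secK; exact: orbit_open.
  have nVf : within D (nbhs t0) [set t | (orbit @` V) (f t)] := cft _ nV'.
  exists [set t | (D t -> (orbit @` U) (f t)) /\ (D t -> (orbit @` V) (f t))].
    exact: (@filterI _ (nbhs t0) _ _ _ nUf nVf).
  move=> t t' [/= h _] [/= _ h'] Dt Dt' y z.
  have [y' Uy' <-] := h Dt; have [z' Vz' <-] := h' Dt'.
  move=> /esym/(orbitP k0)[g gu ->] /esym/(orbitP k0)[g' gu' ->].
  rewrite (transl_act k0 y' z' gu gu') unitmx_mul [X in X && _]unitmx_mul.
  rewrite gu unitmx_inv gu' andbT.
  exact: (UV (y', z') (conj Uy' Vz')).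
have [M [M0 MD]] : exists M, 0 <= M /\ forall t, D t -> `|t| <= M.
  have [N [_ hN]] := compact_bounded cD; exists (`|N| + 1); split; first by rewrite addr_ge0.
  by move=> t Dt; apply: (hN (`|N| + 1)) => //; rewrite (le_lt_trans (ler_norm N))// ltrDl.
(* Each step along a ray has length at most [M / m], less than [eta]. *)
pose m := (Num.truncn (M / eta)).+1.
have Mm : M / eta < m%:R by rewrite truncnS_gt.
have m0 : 0 < m%:R :> R by rewrite ltr0n.
pose G := fix G (l : nat) (t : T) : st := if l is l'.+1
  then transport (G l' t) (sec (f ((l%:R / m%:R) *: t))) else sec (f 0).
have Dl l t : (l <= m)%N -> D t -> D ((l%:R / m%:R) *: t).
  move=> lm Dt; apply: Dstar => //; rewrite divr_ge0//= ler_pdivrMr// mul1r.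
  by rewrite ler_nat.
have key l : (l <= m)%N -> (forall t, D t -> orbit (G l t) = f ((l%:R / m%:R) *: t)) /\
    {within D, continuous (G l)}.
  elim: l => [|l IH] lm.
    split=> [t _|]; first by rewrite mul0r scale0r secK.
    by apply: within_cvgP => x _; exact: cvg_cst.
  have [IHo IHc] := IH (ltnW lm).
  have ul t : D t -> transl (G l t) (sec (f ((l.+1%:R / m%:R) *: t))) \in unitmx.
    move=> Dt; apply: (unif ((l%:R / m%:R) *: t) ((l.+1%:R / m%:R) *: t)).
    - exact: Dl (ltnW lm) Dt.
    - exact: Dl.
    - rewrite -scalerBl -mulrBl -natr1 opprD addNKr normrZ normrM normrN normr1 mul1r.
      rewrite ger0_norm ?invr_ge0//.
      rewrite mulrC ltr_pdivrMr//; apply: le_lt_trans (MD t Dt) _.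
      by rewrite -ltr_pdivrMl// mulrC.
    - exact: IHo.
    - exact: secK.
  split=> [t Dt|].
    by rewrite /= transport_orbit ?secK//; exact: ul.
  apply: within_cvgP => t Dt; apply: cvg_transport; first exact: ul.
    exact: within_cvg Dt IHc.
  rewrite secK (_ : (fun t => _) = fun t => f ((l.+1%:R / m%:R) *: t)); last first.
    by apply/funext => t'; rewrite secK.
  apply: (@within_comp_cvg _ _ _ D D (fun t => (l.+1%:R / m%:R) *: t) f t Dt _ _ cf).
    by move=> y; exact: Dl.
  apply: cvg_within_filter; apply: (@cvgZ _ _ _ (nbhs t)) => //; exact: cvg_cst.
exists (G m); have [Go Gc] := key m (leqnn m); split=> // t Dt.
by rewrite Go// divff ?scale1r// gt_eqF.
Qed.

End Lifting.

(** * Radial retraction of a cylinder onto all faces but one *)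

Section Retraction.
Variables (R : realType) (j : nat).
Implicit Types p : R * 'rV[R]_j.

Local Notation ctr := (const_mx 2^-1 : 'rV[R]_j).

Definition side p := p.1 = 1 \/ cube_boundary p.2.

(** The gauge of [p] seen from the projection center: the larger of its relative distances towards
    the lateral faces and towards the top, equal to 1 exactly on these faces. On the cylinder the
    second term keeps it at least 1/2. *)
Definition retr_scale p : R := Num.max (2 * `|p.2 - ctr|) ((p.1 + 1) / 2).

(* Radial projection from the point [(-1, ctr)] onto the union of all the faces
   of the cylinder but [p.1 = 0]. *)
Definition retr p : R * 'rV[R]_j :=
  ((p.1 + 1) / retr_scale p - 1, ctr + (retr_scale p)^-1 *: (p.2 - ctr)).

Lemma depth_cube (t : 'rV[R]_j) : 0 <= depth t -> cube t.
Proof.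
rewrite subr_ge0 => d i; have := le_trans (coord_norm_le _ i) d.
by rewrite !mxE ler_norml; lra.
Qed.

Lemma retr_scale_bounds p : cylinder p -> 2^-1 <= retr_scale p <= 1.
Proof.
move=> [/= p01 /depth_ge0]; rewrite /depth /retr_scale le_max ge_max => d.
by apply/andP; split; [apply/orP; right|apply/andP; split]; lra.
Qed.

Lemma retr_cylinder p : cylinder p -> cylinder (retr p) /\ side (retr p).
Proof.
move=> cp; have /andP[s1 s2] := retr_scale_bounds cp.
have s0 : 0 < retr_scale p by apply: lt_le_trans s1; rewrite invr_gt0.
have [/= p01 cp2] := cp.
have dE : depth (retr p).2 = 2^-1 - (retr_scale p)^-1 * `|p.2 - ctr|.
  have -> : (retr p).2 = ctr + (retr_scale p)^-1 *: (p.2 - ctr) by [].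
  by rewrite /depth [X in `|X - _|]addrC addrK normrZ ger0_norm// invr_ge0 ltW.
have h1 : 2 * `|p.2 - ctr| <= retr_scale p by rewrite le_max lexx.
have h2 : (p.1 + 1) / 2 <= retr_scale p by rewrite le_max lexx orbT.
have d0 : 0 <= depth (retr p).2.
  by rewrite dE subr_ge0 mulrC ler_pdivrMr//; lra.
have c2 := depth_cube d0.
split; first split=> //=.
- by rewrite lerBrDr add0r ler_pdivlMr// lerBlDr ler_pdivrMr//; lra.
rewrite /side; have [m1|m2] := leP (2 * `|p.2 - ctr|) ((p.1 + 1) / 2).
  left; rewrite /= {1}/retr_scale max_r// invf_div mulrCA divff ?mulr1; last lra.
  lra.
right; apply: depth_eq0 => //; rewrite dE.
have e : retr_scale p = 2 * `|p.2 - ctr| by rewrite /retr_scale max_l// ltW.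
have q0 : `|p.2 - ctr| != 0 by move: s0; rewrite e => /gt_eqF; lra.
by rewrite e invfM -mulrA mulVf// mulr1 subrr.
Qed.

Lemma retr_id p : cylinder p -> side p -> retr p = p.
Proof.
move=> cp sp; have s1 : retr_scale p = 1.
  apply/eqP; rewrite eq_le; have /andP[_ ->] := retr_scale_bounds cp; rewrite /= le_max.
  case: sp => [e|b]; apply/orP; [right; rewrite e; lra|left].
  by have := depth_boundary b; rewrite /depth; lra.
case: p cp sp s1 => s t /= _ _ s1; rewrite /retr s1 /= invr1 mulr1 addrK scale1r.
by rewrite addrC subrK.
Qed.

Lemma cvg_retr p : cylinder p ->
  retr q @[q --> within (@cylinder R j) (nbhs p)] --> retr p.
Proof.
move=> cp; have /andP[s1 _] := retr_scale_bounds cp.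
have s0 : retr_scale p != 0 by rewrite gt_eqF//; apply: lt_le_trans s1; rewrite invr_gt0.
have cf : q.1 @[q --> nbhs p] --> p.1 by case: (p) => ? ?; exact: cvg_fst.
have cs : q.2 @[q --> nbhs p] --> p.2 by case: (p) => ? ?; exact: cvg_snd.
have cd : q.2 - ctr @[q --> nbhs p] --> p.2 - ctr by apply: cvgB cs _; exact: cvg_cst.
have c1 : q.1 + 1 @[q --> nbhs p] --> p.1 + 1 by apply: cvgD cf _; exact: cvg_cst.
have cr : retr_scale q @[q --> nbhs p] --> retr_scale p.
  apply: cvg_max; last by apply: cvgMr_tmp.
  by apply: cvgMl_tmp; exact: cvg_norm.
have ci : (retr_scale q)^-1 @[q --> nbhs p] --> (retr_scale p)^-1 by exact: cvgV.
have c3 : (q.1 + 1) / retr_scale q - 1 @[q --> nbhs p] --> (p.1 + 1) / retr_scale p - 1.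
  by apply: cvgB; [exact: cvgM|exact: cvg_cst].
have c4 : ctr + (retr_scale q)^-1 *: (q.2 - ctr) @[q --> nbhs p]
    --> ctr + (retr_scale p)^-1 *: (p.2 - ctr).
  by apply: cvgD; [exact: cvg_cst|exact: cvgZ].
by apply: cvg_within_filter; exact: (cvg_pair c3 c4).
Qed.

Lemma compact_cylinder : compact (@cylinder R j).
Proof.
have := compact_setX (@segment_compact R 0 1) (@compact_cube R j).
by congr compact; apply/seteqP; split=> [[s t]]; rewrite /cylinder /= in_itv /=.
Qed.

Lemma cylinder_star (s : R) p : 0 <= s <= 1 -> cylinder p -> cylinder (s *: p).
Proof.
have st (a : R) : 0 <= s <= 1 -> 0 <= a <= 1 -> 0 <= s * a <= 1.
  by move=> /andP[s0 s1] /andP[a0 a1]; rewrite mulr_ge0//= mulr_ile1.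
by move=> s01 [/= p01 cp]; split=> [|i] /=; rewrite ?mxE; apply: st.
Qed.

Lemma cylinder0 : cylinder (0 : R * 'rV[R]_j).
Proof. by split=> [|i] /=; rewrite ?mxE lexx ler01. Qed.

End Retraction.

Section NormalizedLift.
Variables (R : realType) (k n : nat).
Hypothesis k0 : (0 < k)%N.
Local Notation C := R[i].
Local Notation v := (adhm_dim k n).
Local Notation st := (stable R v (@zero_param R n)).
Local Notation mod := (moduli R v (@zero_param R n)).

(* Any lift takes its values in the orbit of [x0] on the image of the
   retraction, where it is moved to [x0] by a function into [GL_k] that the
   retraction extends. *)
Lemma normalized_lift (T : normedModType R) (D : set T) (r : T -> T) (f : T -> mod) (x0 : st) :
  compact D -> D 0 -> (forall s t, 0 <= s <= 1 -> D t -> D (s *: t)) ->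
  {within D, continuous f} ->
  (forall t, D t -> D (r t) /\ f (r t) = orbit x0) ->
  (forall t, D t -> r s @[s --> within D (nbhs t)] --> r t) ->
  exists F : T -> st, [/\ {within D, continuous F},
    (forall t, D t -> orbit (F t) = f t) &
    (forall t, D t -> r t = t -> F t = x0)].
Proof.
move=> cD D0 Dstar cf rD cr.
have [F [cF oF]] := orbit_lift k0 cD D0 Dstar cf.
have u t : D t -> transl x0 (F (r t)) \in unitmx.
  move=> Dt; have [Drt frt] := rD t Dt.
  by have [] := @transl_orbit R k n k0 x0 (F (r t)); rewrite ?oF.
exists (fun t => actP (transl x0 (F (r t))) (F t)); split.
- apply: within_cvgP => t Dt; apply: cvg_actP => //; [exact: u| |exact: within_cvg].
  apply: cvg_transl => //; first exact: cvg_cst.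
  apply: (@within_comp_cvg _ _ _ D D r F t Dt _ (cr t Dt) cF) => y Dy.
  by have [] := rD y Dy.
- by move=> t Dt; rewrite orbit_act ?oF//; exact: u.
- move=> t Dt rt; rewrite rt; have [_] := rD t Dt; rewrite rt => ft.
  by have [_ <-] := @transl_orbit R k n k0 x0 (F t) (esym (etrans (oF t Dt) ft)).
Qed.

End NormalizedLift.

(** * The boundary map by clutching *)

Lemma homotopic_ext (R : realType) (X : topologicalType) (x0 : X) j (f g : gloop R x0 j) :
  (forall t, cube t -> f t = g t) -> homotopic f g.
Proof.
move=> fg; have [H [cH H0 H1 Hb]] := homotopic_refl f.
by exists H; split=> // t ct; rewrite H1 ?fg.
Qed.

Section BoundaryMap.
Local Open Scope complex_scope.
Variables (R : realType) (k n : nat).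
Hypotheses (k0 : (0 < k)%N) (n0 : (0 < n)%N).
Local Notation C := R[i].
Local Notation v := (adhm_dim k n).
Local Notation st := (stable R v (@zero_param R n)).
Local Notation mod := (moduli R v (@zero_param R n)).
Local Notation U := (unitary_group R k).
Variables (x0 : st) (u0 : U).

Lemma unitaryP (u : U) : val u \is unitarymx.
Proof. exact: set_mem (valP u). Qed.

Lemma val_unitary (A : 'M[C]_k) : A \is unitarymx -> val (insubd u0 A : U) = A.
Proof. by move=> uA; rewrite insubdK// unfold_in /=; exact/mem_set. Qed.

Lemma within_unitary (T : topologicalType) (D : set T) (A : T -> 'M[C]_k) :
  (forall t, D t -> A t \is unitarymx) ->
  (forall t, D t -> A s @[s --> within D (nbhs t)] --> A t) ->
  {within D, continuous (fun t => insubd u0 (A t) : U)}.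
Proof.
move=> uA cA; apply: within_cvgP => t Dt; apply: (iffRL (cvg_set_typeP _ _)).
have cB B : B = A t -> A s @[s --> within D (nbhs t)] --> B by move=> ->; exact: cA.
have nD : within D (nbhs t) [set s | A s = val (insubd u0 (A s) : U)].
  apply: (@filterS _ (nbhs t) _ _ _ _ filterT) => s _ Ds.
  exact: esym (val_unitary (uA s Ds)).
exact: (@cvg_near_eq _ _ _ _ _ _ _ nD (cB _ (val_unitary (uA t Dt)))).
Qed.

Section Degree.
Variable j : nat.
Local Notation cyl := (@cylinder R j).
Local Notation last := (@ord_max j).

(** The last coordinate of the loop is the homotopy parameter. Only the face where it is 0 is left
    free, and there [F] stays in the orbit of [x0]. *)
Definition lift_of (f : gloop R (orbit x0) j.+1) (F : R * 'rV[R]_j -> st) :=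
  [/\ {within cyl, continuous F},
      (forall p, cyl p -> orbit (F p) = f (ins last p.1 p.2)) &
      (forall p, cyl p -> side p -> F p = x0)].

(* [w] is the clutching map of [f]: [f] lifts to a homotopy in the space of
   stable representations from [u0^* w x0] to the constant [x0]. *)
Definition clutches (f : gloop R (orbit x0) j.+1) (w : gloop R u0 j) :=
  exists2 F, lift_of f F &
    forall t, cube t -> F (0, t) = actP ((val u0)^t* *m val (w t)) x0.

Lemma unitary_adjK (A : 'M[C]_k) : val u0 *m ((val u0)^t* *m A) = A.
Proof. by rewrite mulmxA (unitarymxP (unitaryP u0)) mul1mx. Qed.

Lemma unitary_adj_mul (u : U) : (val u0)^t* *m val u \is unitarymx.
Proof. by rewrite mul_unitarymx ?trmxC_unitary ?unitaryP. Qed.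

Lemma unitary_adj_self : (val u0)^t* *m val u0 = 1%:M.
Proof. by rewrite -invmx_unitary ?mulVmx ?unitarymx_unit ?unitaryP. Qed.

(** Left multiplication by [u0] moves the base point from 1 to [u0]. *)
Definition twist (A : 'M[C]_k) : U := insubd u0 (val u0 *m gs A).

Lemma val_twist A : A \in unitmx -> val (twist A) = val u0 *m gs A.
Proof. by move=> uA; rewrite val_unitary// mul_unitarymx ?unitaryP// gs_unitary. Qed.

Lemma twist1 : twist 1%:M = u0.
Proof.
apply: val_inj; rewrite val_twist ?unitmx1// gs_id ?mulmx1//.
by apply/unitarymxP; rewrite mul1mx trmx1 map_mx1.
Qed.

Lemma twist_adj (u : U) : twist ((val u0)^t* *m val u) = u.
Proof.
have uu := unitary_adj_mul u; apply: val_inj.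
by rewrite val_twist ?unitarymx_unit// (gs_id uu) unitary_adjK.
Qed.

Lemma within_twist (T : topologicalType) (D : set T) (A : T -> 'M[C]_k) :
  (forall t, D t -> A t \in unitmx) ->
  (forall t, D t -> A s @[s --> within D (nbhs t)] --> A t) ->
  {within D, continuous (fun t => twist (A t))}.
Proof.
move=> uA cA; apply: within_unitary => t Dt.
  by rewrite mul_unitarymx ?unitaryP// gs_unitary//; exact: uA.
by apply: cvg_mulmx; [exact: cvg_cst|apply: cvg_gs; [exact: uA|exact: cA]].
Qed.

Lemma bottom_cvg (F : R * 'rV[R]_j -> st) t : {within cyl, continuous F} -> cube t ->
  F (0, s) @[s --> within (@cube R j) (nbhs t)] --> F (0, t).
Proof.
move=> cF ct; apply: (@within_comp_cvg _ _ _ (@cube R j) cyl (fun s => (0, s)) F t ct _ _ cF).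
  by move=> s cs; split=> //=; rewrite lexx ler01.
apply: cvg_within_filter.
exact: (cvg_pair (cvg_cst (0 : R)) (@cvg_id _ (nbhs t))).
Qed.

Definition attach (F : R * 'rV[R]_j -> st) (t : 'rV[R]_j) : 'M[C]_k := transl (F (0, t)) x0.

Lemma cyl0 (t : 'rV[R]_j) : cube t -> cyl (0, t).
Proof. by split=> //=; rewrite lexx ler01. Qed.

Lemma cyl1 (t : 'rV[R]_j) : cube t -> cyl (1, t).
Proof. by split=> //=; rewrite lexx ler01. Qed.

Section OneLift.
Variables (f : gloop R (orbit x0) j.+1) (F : R * 'rV[R]_j -> st).
Hypothesis fF : lift_of f F.

Lemma attachP t : cube t -> attach F t \in unitmx /\ F (0, t) = actP (attach F t) x0.
Proof.
move=> ct; apply: transl_orbit => //; have [_ oF _] := fF.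
rewrite oF; last exact: cyl0.
apply: gloop_bd; apply/cube_boundary_ins; split; first exact: cyl0.
by left.
Qed.

Lemma attach_boundary t : cube_boundary t -> attach F t = 1%:M.
Proof.
move=> bt; have [_ _ sF] := fF; rewrite /attach sF ?transl_self//; last by right.
exact: cyl0 bt.1.
Qed.

Lemma cvg_attach t : cube t ->
  attach F s @[s --> within (@cube R j) (nbhs t)] --> attach F t.
Proof.
move=> ct; have [cF _ _] := fF; apply: cvg_transl => //; last exact: cvg_cst.
exact: bottom_cvg.
Qed.

Lemma clutch_cont : {within @cube R j, continuous (fun t => twist (attach F t))}.
Proof. by apply: within_twist => t ct; [have [] := attachP ct|exact: cvg_attach]. Qed.

Lemma clutch_bd t : cube_boundary t -> twist (attach F t) = u0.
Proof. by move=> bt; rewrite attach_boundary// twist1. Qed.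

Definition clutch : gloop R u0 j := Gloop clutch_cont clutch_bd.

End OneLift.

Lemma clutches_clutch f (w : gloop R u0 j) F (fF : lift_of f F) :
  (forall t, cube t -> F (0, t) = actP ((val u0)^t* *m val (w t)) x0) ->
  homotopic w (clutch fF).
Proof.
move=> wF; apply: homotopic_ext => t ct /=; rewrite /attach wF//.
have uw := unitarymx_unit (unitary_adj_mul (w t)).
by rewrite (transl_actl k0 _ uw) twist_adj.
Qed.


Lemma lift_exists (f : gloop R (orbit x0) j.+1) : exists F, lift_of f F.
Proof.
have [|||F [cF oF sF]] := @normalized_lift R k n k0 _ cyl (@retr R j)
  (fun p => f (ins last p.1 p.2)) x0 (@compact_cylinder R j) (@cylinder0 R j)
  (@cylinder_star R j).
- apply: (@within_comp _ _ _ _ (@cube R j.+1) (fun p : R * 'rV[R]_j => ins last p.1 p.2) f)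
    (@gloop_cont _ _ _ _ f); first exact: continuous_ins.
  by move=> p cp; exact/cube_ins.
- move=> p cp; have [cr sr] := retr_cylinder cp; split=> //.
  by apply: gloop_bd; apply/cube_boundary_ins; split=> //; case: sr; [right; left|right; right].
- exact: cvg_retr.
by exists F; split=> // p cp sp; apply: sF => //; exact: retr_id.
Qed.

Lemma clutches_of_gloop (f : gloop R (orbit x0) j.+1) : exists w, clutches f w.
Proof.
have [F fF] := lift_exists f; have [cF oF sF] := fF.
(* Acting by [T] turns the bottom values [attach F t] into their unitary parts [gs (attach F t)];
   [T] is 1 on the other faces, so the normalization there survives. *)
exists (clutch fF); pose T p : 'M[C]_k :=
  (1 - p.1)%:C *: gs_trig (attach F p.2) + (p.1)%:C *: 1%:M.
have uT p : cyl p -> T p \in unitmx.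
  by move=> [p1 p2]; apply: gs_trig_convex => //; have [] := attachP fF p2.
have cT p : cyl p -> T q @[q --> within cyl (nbhs p)] --> T p.
  move=> cp; have c1 : q.1 @[q --> within cyl (nbhs p)] --> p.1.
    by apply: cvg_within_filter; case: (p) => ? ?; exact: cvg_fst.
  have ca : attach F q.2 @[q --> within cyl (nbhs p)] --> attach F p.2.
    have cA : {within @cube R j, continuous (attach F)}.
      by apply: within_cvgP => t ct; have := cvg_attach fF ct.
    exact: (within_cylinder_snd cp cA).
  apply: cvg_addmx; apply: cvg_scalemx; last exact: cvg_cst.
  - by apply: cvg_real_complex; apply: cvgB c1; exact: cvg_cst.
  - by apply: cvg_gs_trig ca; have [] := attachP fF cp.2.
  - exact: cvg_real_complex.
exists (fun p => actP (T p) (F p)); first split.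
- apply: within_cvgP => p cp; apply: cvg_actP => //; [exact: uT|exact: cT|exact: within_cvg].
- by move=> p cp; rewrite orbit_act ?oF//; exact: uT.
- move=> p cp sp; rewrite (sF p cp sp); suff -> : T p = 1%:M by exact: actP1.
  rewrite /T; case: sp => [->|bp]; first by rewrite subrr scale0r scale1r add0r.
  rewrite (attach_boundary fF bp) gs_trig1 -scalerDl -rmorphD.
  by rewrite subrK scale1r.
move=> t ct; have [ua Fa] := attachP fF ct.
have -> : T (0, t) = gs_trig (attach F t).
  by rewrite /T /= subr0 scale1r scale0r addr0.
have e : (val u0)^t* *m val (clutch fF t) = gs (attach F t).
  apply: etrans (congr1 (mulmx _) (val_twist ua)) _.
  by rewrite mulmxA unitary_adj_self mul1mx.
apply: etrans _ (congr1 (fun g => actP g x0) (esym e)).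
apply: etrans (congr1 (actP _) Fa) _; exact: (actPM k0 x0 (gs_trig_unit ua) ua).
Qed.

(** Surjectivity: the translates of [x0] by [u0^* w] form a contractible sphere of stable
    representations, and the orbits of its null homotopy form the loop. *)
Lemma gloop_of_clutch (w : gloop R u0 j) : (j < 2 * (k - 1 + n) - 1)%N ->
  exists f : gloop R (orbit x0) j.+1, clutches f w.
Proof.
move=> jc; pose g t := actP ((val u0)^t* *m val (w t)) x0.
have uu t := unitarymx_unit (unitary_adj_mul (w t)).
have cg : {within @cube R j, continuous g}.
  apply: within_cvgP => t ct; apply: cvg_actP => //; last exact: cvg_cst.
  apply: cvg_mulmx; first exact: cvg_cst.
  apply: (iffLR (cvg_set_typeP _ _)).
  exact: within_cvg ct (@gloop_cont _ _ _ _ w).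
have bg t : cube_boundary t -> g t = x0.
  by move=> bt; rewrite /g (gloop_bd w bt) unitary_adj_self; exact: actP1.
have [F [cF F0 F1 Fb]] := stable_homotopy_trivial k0 n0 jc (stable_inhabited R k0 n0) (Gloop cg bg).
pose f (t : 'rV[R]_j.+1) := orbit (F (t 0 last, col' last t)).
have cf : {within @cube R j.+1, continuous f}.
  apply: within_cvgP => t ct.
  have cFt : (fun s : 'rV[R]_j.+1 => F (s 0 last, col' last s)) s
      @[s --> within (@cube R j.+1) (nbhs t)] --> F (t 0 last, col' last t).
    apply: (@within_comp_cvg _ _ _ (@cube R j.+1) cyl
      (fun s : 'rV[R]_j.+1 => (s 0 last, col' last s)) F t ct _ _ cF).
      by move=> s; exact: cylinder_split.
    by apply: cvg_within_filter; exact: continuous_split.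
  exact: (continuous_cvg _ (@orbit_continuous R k n _) cFt).
have bf t : cube_boundary t -> f t = orbit x0.
  rewrite -{1}(ins_col' last t) => /cube_boundary_ins[[/= t01 ct] [e|[e|b]]]; rewrite /f.
  - by rewrite e F0//= orbit_act.
  - by rewrite e F1.
  - by rewrite Fb.
exists (Gloop cf bf); exists F => //; split=> // p cp.
  by rewrite /= /f ins_at col'_ins -surjective_pairing.
by case: p cp => s t [/= s01 ct] [/= ->|bt]; [exact: F1|exact: Fb].
Qed.

End Degree.

End BoundaryMap.

Section BoundaryIsomorphism.
Local Open Scope complex_scope.
Variables (R : realType) (k n : nat).
Hypotheses (k0 : (0 < k)%N) (n0 : (0 < n)%N).
Local Notation C := R[i].
Local Notation v := (adhm_dim k n).
Local Notation st := (stable R v (@zero_param R n)).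
Local Notation mod := (moduli R v (@zero_param R n)).
Local Notation U := (unitary_group R k).
Variables (x0 : st) (u0 : U) (j : nat).
Local Notation cyl := (@cylinder R j).
Local Notation last := (@ord_max j).

(* The path [twist (b (1 - s) (attach F))] from one clutching map to the other,
   where [F' = b F]. *)
Lemma clutch_unique (f : gloop R (orbit x0) j.+1) F F'
    (fF : lift_of f F) (fF' : lift_of f F') :
  homotopic (clutch k0 u0 fF) (clutch k0 u0 fF').
Proof.
have [cF oF sF] := fF; have [cF' oF' sF'] := fF'.
pose b p := transl (F' p) (F p).
have bP p : cyl p -> b p \in unitmx /\ F' p = actP (b p) (F p).
  by move=> cp; apply: transl_orbit => //; rewrite oF ?oF'.
(* Time is reversed because [b] is 1 on the top face, while on the bottom face it takes
   [attach x0 F] to [attach x0 F']. *)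
pose fl (p : R * 'rV[R]_j) : R * 'rV[R]_j := (1 - p.1, p.2).
have cfl p : cyl p -> cyl (fl p) by move=> [/= p1 p2]; split=> //=; exact: itv_flip.
pose A p := b (fl p) *m attach x0 F p.2.
have uA p : cyl p -> A p \in unitmx.
  move=> cp; rewrite /A unitmx_mul (bP _ (cfl p cp)).1.
  by have [] := attachP k0 fF cp.2.
have fl_cvg p : fl q @[q --> nbhs p] --> fl p.
  have c1 : q.1 @[q --> nbhs p] --> p.1 by case: (p) => ? ?; exact: cvg_fst.
  have c2 : q.2 @[q --> nbhs p] --> p.2 by case: (p) => ? ?; exact: cvg_snd.
  have c3 : 1 - q.1 @[q --> nbhs p] --> 1 - p.1 by apply: cvgB c1; exact: cvg_cst.
  exact: (cvg_pair c3 c2).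
have cA p : cyl p -> A q @[q --> within cyl (nbhs p)] --> A p.
  move=> cp; apply: cvg_mulmx.
    have c1 (G : R * 'rV[R]_j -> st) : {within cyl, continuous G} ->
        G (fl q) @[q --> within cyl (nbhs p)] --> G (fl p).
      move=> cG; apply: (@within_comp_cvg _ _ _ cyl cyl fl G p cp cfl _ cG).
      exact: cvg_within_filter (fl_cvg p).
    by apply: cvg_transl => //; exact: c1.
  have cat : {within @cube R j, continuous (attach x0 F)}.
    by apply: within_cvgP => t ct; have := cvg_attach k0 fF ct.
  exact: (within_cylinder_snd cp cat).
exists (fun p => twist u0 (A p)); split.
- exact: within_twist.
- move=> t ct; rewrite /A /b /fl /= subr0.
  have s1 : side (1 : R, t) by left.
  by rewrite (sF _ (cyl1 ct) s1) (sF' _ (cyl1 ct) s1) (transl_self k0) mul1mx.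
- move=> t ct /=; congr twist; rewrite /A /fl /= subrr.
  have [ub Fb] := bP _ (cyl0 ct); have [ua Fa] := attachP k0 fF ct.
  rewrite [RHS]/attach Fb Fa; apply: esym.
  have uba : b (0, t) *m attach x0 F t \in unitmx by rewrite unitmx_mul ub.
  apply: etrans (congr1 (fun y => transl y x0) (actPM k0 x0 ub ua)) _.
  exact: transl_actl uba.
- move=> s t s01 bt; have cst : cyl (s, t) by split=> //; exact: bt.1.
  have sd r : side (r, t) by right.
  rewrite /A (attach_boundary k0 fF bt) mulmx1 /b.
  by rewrite (sF _ (cfl _ cst) (sd _)) (sF' _ (cfl _ cst) (sd _)) (transl_self k0) twist1.
Qed.

(** The whole homotopy is lifted at once, retracting the cylinder factor only. Its end slices lift
    [f] and [f'], and [clutch_unique] compares them with the given lifts. *)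
Lemma clutch_homotopic (f f' : gloop R (orbit x0) j.+1) F F'
    (fF : lift_of f F) (fF' : lift_of f' F') :
  homotopic f f' -> homotopic (clutch k0 u0 fF) (clutch k0 u0 fF').
Proof.
move=> [h [ch h0 h1 hb]].
pose D : set (R * (R * 'rV[R]_j)) := [set q | 0 <= q.1 <= 1 /\ cyl q.2].
pose hl (q : R * (R * 'rV[R]_j)) := h (q.1, ins last q.2.1 q.2.2).
pose rr (q : R * (R * 'rV[R]_j)) := (q.1, retr q.2).
have cD : compact D.
  have := compact_setX (@segment_compact R 0 1) (@compact_cylinder R j).
  by congr compact; apply/seteqP; split=> [[s t]]; rewrite /D /= in_itv /=.
have D0 : D 0 by split; [rewrite /= lexx ler01|exact: cylinder0].
have Dstar s q : 0 <= s <= 1 -> D q -> D (s *: q).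
  move=> s01 [q1 q2]; split; last exact: cylinder_star.
  have /andP[s0 s1] := s01; have /andP[a0 a1] := q1.
  by rewrite /= mulr_ge0//= mulr_ile1.
have chl : {within D, continuous hl}.
  apply: (@within_comp _ _ _ _ (@cylinder R j.+1)
    (fun q : R * (R * 'rV[R]_j) => (q.1, ins last q.2.1 q.2.2)) h) ch.
    apply: pair_continuous => -[s p]; first exact: cvg_fst.
    exact: (continuous_cvg _ (@continuous_ins R j last p) (@cvg_snd _ _ (nbhs s) (nbhs p) _)).
  by move=> q [q1 q2]; split=> //; exact/cube_ins.
have rrD q : D q -> D (rr q) /\ hl (rr q) = orbit x0.
  move=> [q1 q2]; have [cr sr] := retr_cylinder q2; split=> //.
  apply: hb => //; apply/cube_boundary_ins; split=> //.
  by case: sr; [right; left|right; right].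
have crr q : D q -> rr p @[p --> within D (nbhs q)] --> rr q.
  move=> Dq; have c1 : p.1 @[p --> within D (nbhs q)] --> q.1.
    by apply: cvg_within_filter; case: (q) => ? ?; exact: cvg_fst.
  have cret : {within cyl, continuous (@retr R j)}.
    by apply: within_cvgP => p cp; exact: cvg_retr.
  have c2 : retr p.2 @[p --> within D (nbhs q)] --> retr q.2.
    apply: (@within_comp_cvg _ _ _ D cyl snd (@retr R j) q Dq _ _ cret).
      by move=> p [].
    by apply: cvg_within_filter; case: (q) => ? ?; exact: cvg_snd.
  exact: (cvg_pair c1 c2).
have [HH [cHH oHH sHH]] := normalized_lift k0 cD D0 Dstar chl rrD crr.
have HHside s p : 0 <= s <= 1 -> cyl p -> side p -> HH (s, p) = x0.
  by move=> s01 cp sp; apply: sHH => //; rewrite /rr /= retr_id.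
have i0 : 0 <= (0 : R) <= 1 by rewrite lexx ler01.
have i1 : 0 <= (1 : R) <= 1 by rewrite lexx ler01.
have slice s : 0 <= s <= 1 -> {within cyl, continuous (fun p => HH (s, p))}.
  move=> s01; apply: (@within_comp _ _ _ _ D (fun p => (s, p)) HH) cHH => // p.
  exact: (cvg_pair (cvg_cst s) (@cvg_id _ (nbhs p))).
have l0 : lift_of f (fun p => HH (0, p)).
  split=> [|p cp|p cp sp]; [exact: slice| |exact: HHside].
  by rewrite oHH// /hl h0//; exact/cube_ins.
have l1 : lift_of f' (fun p => HH (1, p)).
  split=> [|p cp|p cp sp]; [exact: slice| |exact: HHside].
  by rewrite oHH// /hl h1//; exact/cube_ins.
apply: homotopic_trans (clutch_unique fF l0) _.
apply: homotopic_trans _ (clutch_unique l1 fF').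
(* The bottom face of the lifted homotopy is a homotopy of clutching data. *)
pose A (p : R * 'rV[R]_j) := transl (HH (p.1, (0, p.2))) x0.
have AP p : cyl p -> A p \in unitmx.
  move=> [p1 p2]; have c0 := cyl0 p2.
  have [] // := @transl_orbit R k n k0 (HH (p.1, (0, p.2))) x0.
  rewrite oHH; last by split.
  apply: hb => //; apply/cube_boundary_ins; split=> //.
  by left.
have cA p : cyl p -> A q @[q --> within cyl (nbhs p)] --> A p.
  move=> cp; apply: cvg_transl => //; last exact: cvg_cst.
  apply: (@within_comp_cvg _ _ _ cyl D (fun q => (q.1, (0, q.2))) HH p cp _ _ cHH).
    by move=> q [q1 q2]; split=> //; exact: cyl0.
  apply: cvg_within_filter.
  have c1 : q.1 @[q --> nbhs p] --> p.1 by case: (p) => ? ?; exact: cvg_fst.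
  have c2 : q.2 @[q --> nbhs p] --> p.2 by case: (p) => ? ?; exact: cvg_snd.
  exact: (cvg_pair c1 (cvg_pair (cvg_cst (0 : R)) c2)).
exists (fun p => twist u0 (A p)); split=> //; first exact: within_twist.
move=> s t s01 bt; rewrite /A HHside//=; last by right.
  by rewrite (transl_self k0) twist1.
exact: cyl0 bt.1.
Qed.

(** Makes the boundary map well defined on homotopy classes. *)
Lemma clutches_homotopic (f f' : gloop R (orbit x0) j.+1) (w w' : gloop R u0 j) :
  homotopic f f' -> clutches f w -> clutches f' w' -> homotopic w w'.
Proof.
move=> ff' [F fF wF] [F' fF' wF'].
apply: homotopic_trans (clutches_clutch k0 fF wF) _.
apply: homotopic_trans (clutch_homotopic fF fF' ff') _.
exact: homotopic_sym (clutches_clutch k0 fF' wF').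
Qed.

End BoundaryIsomorphism.

(** * Bijectivity of the boundary map *)

Section ClutchingBijection.
Local Open Scope complex_scope.
Variables (R : realType) (k n : nat).
Hypotheses (k0 : (0 < k)%N) (n0 : (0 < n)%N).
Local Notation C := R[i].
Local Notation v := (adhm_dim k n).
Local Notation st := (stable R v (@zero_param R n)).
Local Notation mod := (moduli R v (@zero_param R n)).
Local Notation U := (unitary_group R k).
Variables (x0 : st) (u0 : U).

(* The transfinite interpolation [I] of the two lifts and of the homotopy of
   clutching maps is stable on the boundary of its cube, so its boundary values
   extend to the whole cube. *)
Lemma gloops_homotopic j (f f' : gloop R (orbit x0) j.+1) (w w' : gloop R u0 j) :
  (j.+1 < 2 * (k - 1 + n) - 1)%N ->
  homotopic w w' -> clutches f w -> clutches f' w' -> homotopic f f'.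
Proof.
move=> jc [W [cW W0 W1 Wb]] [F [cF oF sF] wF] [F' [cF' oF' sF'] wF'].
pose last := @ord_max j; pose tl (t : 'rV[R]_j.+1) := col' last t.
pose g (p : R * 'rV[R]_j) := actP ((val u0)^t* *m val (W p)) x0.
(* The first two terms join the lifts linearly. The third corrects the face [t_last = 0] to [g] and
   fades out at [t_last = 1]; it vanishes at both ends of the homotopy, where [g] agrees with the
   lifts. *)
pose I (q : R * 'rV[R]_j.+1) : 'rV[R]_(real_dim k n) :=
  (1 - q.1) *: emb (val (F (q.2 0 last, tl q.2))) +
  q.1 *: emb (val (F' (q.2 0 last, tl q.2))) +
  (1 - q.2 0 last) *: (emb (val (g (q.1, tl q.2)))
    - ((1 - q.1) *: emb (val (F (0, tl q.2))) + q.1 *: emb (val (F' (0, tl q.2))))).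
have cyl_tl s t : @cylinder R j.+1 (s, t) -> [/\ 0 <= s <= 1, 0 <= t 0 last <= 1 & cube (tl t)].
  by move=> [/= s01 ct]; have [] := cylinder_split last ct; split.
have g0 t : cube t -> g (0, t) = F (0, t) by move=> ct; rewrite /g W0// wF.
have g1 t : cube t -> g (1, t) = F' (0, t) by move=> ct; rewrite /g W1// wF'.
have gb s t : 0 <= s <= 1 -> cube_boundary t -> g (s, t) = x0.
  by move=> s01 bt; rewrite /g Wb// unitary_adj_self; exact: actP1.
have og p : orbit (g p) = orbit x0.
  by rewrite orbit_act//; exact: unitarymx_unit (unitary_adj_mul _ _).
have I0 t : cube t -> I (0, t) = emb (val (F (t 0 last, tl t))).
  move=> ct; have [_ ctl] := cylinder_split last ct.
  by rewrite /I /= subr0 !scale1r !scale0r !addr0 g0// subrr scaler0 addr0.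
have I1 t : cube t -> I (1, t) = emb (val (F' (t 0 last, tl t))).
  move=> ct; have [_ ctl] := cylinder_split last ct.
  by rewrite /I /= subrr !scale1r !scale0r !add0r g1// subrr scaler0 addr0.
have Iu0 s t : @cylinder R j.+1 (s, t) -> t 0 last = 0 -> I (s, t) = emb (val (g (s, tl t))).
  by move=> _ t0; rewrite /I /= t0 subr0 scale1r addrC subrK.
have Iside s t : @cylinder R j.+1 (s, t) -> t 0 last = 1 \/ cube_boundary (tl t) ->
    I (s, t) = emb (val x0).
  move=> cst; have [s01 t01 ctl] := cyl_tl _ _ cst.
  have comb (a : 'rV[R]_(real_dim k n)) : (1 - s) *: a + s *: a = a.
    by rewrite -scalerDl subrK scale1r.
  rewrite /I /= => -[t1|bt].
    have sd : side (t 0 last, tl t) by left.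
    by rewrite sF// sF'// comb t1 subrr scale0r addr0.
  have sd u : side (u, tl t) by right.
  have c0 := cyl0 ctl.
  rewrite (sF _ _ (sd _)) ?(sF' _ _ (sd _)) ?(sF _ _ (sd _)) ?(sF' _ _ (sd _))//.
  by rewrite (gb _ _ s01 bt) comb subrr scaler0 addr0.
have bdcases s t : @cylinder R j.+1 (s, t) -> (s = 0 \/ s = 1 \/ cube_boundary t) ->
    exists y : st, I (s, t) = emb (val y).
  move=> cst [e|[e|bt]].
  - by exists (F (t 0 last, tl t)); rewrite e I0//; exact: cst.2.
  - by exists (F' (t 0 last, tl t)); rewrite e I1//; exact: cst.2.
  - have := bt; rewrite -{1}(ins_col' last t) => /cube_boundary_ins[_ [t0|[t1|b]]].
    + by exists (g (s, tl t)); exact: Iu0.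
    + by exists x0; apply: Iside => //; left.
    + by exists x0; apply: Iside => //; right.
have stI s t : @cylinder R j.+1 (s, t) -> (s = 0 \/ s = 1 \/ cube_boundary t) ->
    stable R v (@zero_param R n) (unemb (I (s, t))).
  by move=> cst b; have [y ->] := bdcases s t cst b; rewrite embK; exact: stable_val.
have cI : {within @cylinder R j.+1, continuous I}.
  apply: within_cvgP => q cq; have c1 : p.1 @[p --> within (@cylinder R j.+1) (nbhs q)] --> q.1.
    by apply: cvg_within_filter; case: (q) => ? ?; exact: cvg_fst.
  have c2 : p.2 @[p --> within (@cylinder R j.+1) (nbhs q)] --> q.2.
    by apply: cvg_within_filter; case: (q) => ? ?; exact: cvg_snd.
  pose lastc (p : R * 'rV[R]_j.+1) : R := p.2 0 last.
  have cl : lastc p @[p --> within (@cylinder R j.+1) (nbhs q)] --> lastc q.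
    exact: (continuous_cvg _ (@coord_continuous _ _ _ 0 last q.2) c2).
  have ct : tl p.2 @[p --> within (@cylinder R j.+1) (nbhs q)] --> tl q.2 by exact: cvg_col'.
  have comp (G : R * 'rV[R]_j -> st) (phi : R * 'rV[R]_j.+1 -> R * 'rV[R]_j) :
      {within @cylinder R j, continuous G} ->
      (forall p, @cylinder R j.+1 p -> @cylinder R j (phi p)) ->
      phi p @[p --> within (@cylinder R j.+1) (nbhs q)] --> phi q ->
      emb (val (G (phi p))) @[p --> within (@cylinder R j.+1) (nbhs q)] --> emb (val (G (phi q))).
    move=> cG phiD cphi; apply: cvg_emb.
    exact: (iffLR (cvg_set_typeP _ _) (within_comp_cvg cq phiD cphi cG)).
  have cg : {within @cylinder R j, continuous g}.
    apply: within_cvgP => p cp; apply: cvg_actP => //; last exact: cvg_cst.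
      exact: unitarymx_unit (unitary_adj_mul _ _).
    apply: cvg_mulmx; first exact: cvg_cst.
    exact: (iffLR (cvg_set_typeP _ _) (within_cvg cp cW)).
  have d1 p : @cylinder R j.+1 p -> @cylinder R j (lastc p, tl p.2).
    by case: p => s t /cyl_tl[].
  have d2 p : @cylinder R j.+1 p -> @cylinder R j (p.1, tl p.2).
    by case: p => s t /cyl_tl[].
  have d3 p : @cylinder R j.+1 p -> @cylinder R j (0, tl p.2).
    by case: p => s t /cyl_tl[_ _]; exact: cyl0.
  have e1 : (lastc p, tl p.2) @[p --> within (@cylinder R j.+1) (nbhs q)] --> (lastc q, tl q.2).
    exact: (cvg_pair cl ct).
  have e2 : (p.1, tl p.2) @[p --> within (@cylinder R j.+1) (nbhs q)] --> (q.1, tl q.2).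
    exact: (cvg_pair c1 ct).
  have e3 : (0 : R, tl p.2) @[p --> within (@cylinder R j.+1) (nbhs q)] --> (0 : R, tl q.2).
    exact: (cvg_pair (cvg_cst (0 : R)) ct).
  have n1 : 1 - p.1 @[p --> within (@cylinder R j.+1) (nbhs q)] --> 1 - q.1.
    by apply: cvgB c1; exact: cvg_cst.
  have n2 : 1 - lastc p @[p --> within (@cylinder R j.+1) (nbhs q)] --> 1 - lastc q.
    by apply: cvgB cl; exact: cvg_cst.
  apply: cvgD.
    apply: cvgD; first exact: cvgZ n1 (comp F _ cF d1 e1).
    exact: cvgZ c1 (comp F' _ cF' d1 e1).
  apply: cvgZ n2 _; apply: cvgB; first exact: (comp g _ cg d2 e2).
  apply: cvgD; first exact: cvgZ n1 (comp F _ cF d3 e3).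
  exact: cvgZ c1 (comp F' _ cF' d3 e3).
(* A homotopy of loops of dimension [j + 1] fills a cube of dimension [j + 2]: this uses the whole
   range of the hypothesis. *)
have jc' : (j.+2 < 2 * (k - 1 + n))%N by lia.
have [G [cG GI]] := stable_cylinder_filling k0 n0 x0 jc' cI stI.
have i0 : 0 <= (0 : R) <= 1 by rewrite lexx ler01.
have i1 : 0 <= (1 : R) <= 1 by rewrite lexx ler01.
have GE s t y : @cylinder R j.+1 (s, t) -> (s = 0 \/ s = 1 \/ cube_boundary t) ->
    I (s, t) = emb (val y) -> G (s, t) = y.
  by move=> cst b Iy; apply: val_inj; rewrite GI// Iy embK.
exists (fun q => orbit (G q)); split.
- apply: within_cvgP => q cq.
  exact: (continuous_cvg _ (@orbit_continuous R k n _) (within_cvg cq cG)).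
- move=> t ct; rewrite (GE 0 t _ _ _ (I0 t ct)) //; last by left.
  by rewrite oF ?ins_col'//; exact: cylinder_split.
- move=> t ct; rewrite (GE 1 t _ _ _ (I1 t ct)) //; last by right; left.
  by rewrite oF' ?ins_col'//; exact: cylinder_split.
- move=> s t s01 bt; have cst : @cylinder R j.+1 (s, t) by split=> //; exact: bt.1.
  have b : s = 0 \/ s = 1 \/ cube_boundary t by right; right.
  have := bt; rewrite -{1}(ins_col' last t) => /cube_boundary_ins[_ [t0|[t1|bb]]].
  + by rewrite (GE s t _ cst b (Iu0 s t cst t0)) og.
  + by rewrite (GE s t _ cst b (Iside s t cst (or_introl t1))).
  + by rewrite (GE s t _ cst b (Iside s t cst (or_intror bb))).
Qed.

Lemma stretch_ins j (a s : R) (t : 'rV[R]_j.+1) :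
  stretch a (ins ord_max s t) = ins ord_max s (stretch a t).
Proof.
apply/rowP => i; rewrite [LHS]mxE [RHS]mxE; case: (unliftP ord_max i) => [l ->|->].
  have -> : (lift ord_max l == 0 :> 'I_j.+2) = (l == 0).
    by rewrite -!val_eqE /= /bump leqNgt ltn_ord.
  by rewrite ins_lift /= mxE.
by rewrite /= ins_at.
Qed.

(** Concatenation acts on coordinate 0 and lifting on the last one. These differ for loops of
    dimension at least 2, so the lifts concatenate in the same way. *)
Lemma clutches_concat j (f f' : gloop R (orbit x0) j.+2) (w w' : gloop R u0 j.+1) :
  clutches f w -> clutches f' w' -> clutches (concat f f') (concat w w').
Proof.
move=> [F [cF oF sF] wF] [F' [cF' oF' sF'] wF'].
pose G (p : R * 'rV[R]_j.+1) := if p.2 0 0 <= 2^-1 then F (p.1, stretch 0 p.2)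
                 else F' (p.1, stretch 1 p.2).
have cs a : continuous (fun p : R * 'rV[R]_j.+1 => (p.1, stretch a p.2)).
  apply: pair_continuous => p; first exact: cvg_fst.
  by apply: (cvg_comp snd (stretch a)); [exact: cvg_snd|exact: stretch_continuous].
have st0 (p : R * 'rV[R]_j.+1) : cylinder p -> p.2 0 0 <= 2^-1 -> cylinder (p.1, stretch 0 p.2).
  move=> [p1 p2] th; split=> //=; apply: stretch_cube => //.
  exact: itv_stretch0 (p2 0) th.
have st1 (p : R * 'rV[R]_j.+1) : cylinder p -> 2^-1 <= p.2 0 0 -> cylinder (p.1, stretch 1 p.2).
  move=> [p1 p2] th; split=> //=; apply: stretch_cube => //.
  exact: itv_hi (p2 0) th.
have h0 (p : R * 'rV[R]_j.+1) : (ins ord_max p.1 p.2) 0 0 = p.2 0 0.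
  rewrite -(ins_lift ord_max p.1 p.2 0); congr (ins _ _ _ _ _).
  exact: val_inj.
exists G; first split.
- apply: (@within_glue R _ _ (@cylinder R j.+1) (fun p : R * 'rV[R]_j.+1 => p.2 0 0) 2^-1
    (fun p => F (p.1, stretch 0 p.2)) (fun p => F' (p.1, stretch 1 p.2))).
  + exact: closed_cylinder.
  + move=> p; apply: (cvg_comp snd (fun t : 'rV[R]_j.+1 => t 0 0)); first exact: cvg_snd.
    exact: coord_cont.
  + apply: (@within_comp _ _ _ (@cylinder R j.+1 `&` _) (@cylinder R j.+1)
      (fun p => (p.1, stretch 0 p.2)) F) cF; first exact: cs.
    by move=> p [cp th]; exact: st0.
  + apply: (@within_comp _ _ _ (@cylinder R j.+1 `&` _) (@cylinder R j.+1)
      (fun p => (p.1, stretch 1 p.2)) F') cF'; first exact: cs.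
    by move=> p [cp th]; exact: st1.
  + move=> [s t] cp th; have [b0 b1] := stretch_half cp.2 th.
    have th' : t 0 0 <= 2^-1 by rewrite /= in th; rewrite th.
    have th'' : 2^-1 <= t 0 0 by rewrite /= in th; rewrite th.
    by rewrite sF ?sF'//; [exact: st1| |exact: st0|]; right.
- move=> p cp; rewrite /G /= /concat_fun h0; case: ifPn => th.
    by rewrite oF ?stretch_ins//; exact: st0.
  by rewrite oF' ?stretch_ins//; apply: st1 => //; exact: itv_gt.
- move=> p cp sp; have p01 := cp.2 0; rewrite /G; case: ifPn => th.
    apply: sF; first exact: st0.
    by case: sp => [e|b]; [left|right; apply: stretch_boundary => //=; lra].
  have th' := itv_gt th; apply: sF'; first exact: st1.
  by case: sp => [e|b]; [left|right; apply: stretch_boundary => //=; lra].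
move=> t ct; have p01 := ct 0; rewrite /G /= /concat_fun; case: ifPn => th.
  by apply: wF; apply: stretch_cube => //; lra.
have th' := itv_gt th.
by apply: wF'; apply: stretch_cube => //; lra.
Qed.

Lemma clutches_cst j : clutches (cst_gloop R (orbit x0) j.+1) (cst_gloop R u0 j).
Proof.
exists (fun=> x0); first split=> //.
  by apply: within_cvgP => p _; exact: cvg_cst.
by move=> t _ /=; rewrite unitary_adj_self; exact: esym (actP1 k0 x0).
Qed.

Lemma moduli_homotopy_iso j : (0 < j)%N -> (j < 2 * (k - 1 + n) - 1)%N ->
  homotopy_iso R (orbit x0) u0 j (j - 1).
Proof.
case: j => // j _ jc; rewrite subn1 /=.
have jc' : (j < 2 * (k - 1 + n) - 1)%N by lia.
have [W hW] := choice (@clutches_of_gloop R k n k0 x0 u0 j).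
have /choice[G hG] : forall w : gloop R u0 j,
    exists f : gloop R (orbit x0) j.+1, clutches f w.
  by move=> w; have := @gloop_of_clutch R k n k0 n0 x0 u0 j w jc'.
pose phi (c : homotopy_group R (orbit x0) j.+1) : homotopy_group R u0 j :=
  homotopy_class (W (repr c)).
pose psi (d : homotopy_group R u0 j) : homotopy_group R (orbit x0) j.+1 :=
  homotopy_class (G (repr d)).
have reprE (X : topologicalType) (x : X) l (c : homotopy_group R x l) :
  homotopy_class (repr c) = c by exact: reprK.
have phiE f w : clutches f w -> phi (homotopy_class f) = homotopy_class w.
  move=> fw; apply/homotopy_class_eq; apply: clutches_homotopic (hW _) fw => //.
  by apply/homotopy_class_eq; rewrite reprE.
have bij : bijective phi.
  exists psi => [c|d].
    rewrite -[RHS](reprE _ _ _ c); apply/homotopy_class_eq.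
    apply: gloops_homotopic jc _ (hG _) (hW _).
    by apply/homotopy_class_eq; rewrite reprE.
  by rewrite (phiE _ _ (hG _)) reprE.
have phi_repr c : phi c = homotopy_class (W (repr c)) by [].
move: phi {psi} phiE bij phi_repr.
(* For [j = 0] the target is the pointed set of components of U(k) and only the base point is to be
   preserved; otherwise products are. *)
case: j jc jc' W hW G hG => [|j] jc jc' W hW G hG phi phiE bij phi_repr.
  by exists phi; split=> //; exact: phiE (clutches_cst _).
exists phi; split=> // c d.
rewrite {1}/homotopy_mul (phiE _ _ (clutches_concat (hW _) (hW _))).
by rewrite homotopy_class_concat !phi_repr.
Qed.

End ClutchingBijection.

Theorem theorem4p2 (R : realType) (k n : nat) (hk : (1 <= k)%N) (hn : (1 <= n)%N) :
  let v := adhm_dim k n in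
  let alpha := (fun=> 0%R) : vertex (adhm_quiver n) -> R in
  (forall j : nat, (j < 2 * (k - 1 + n) - 1)%N ->
     homotopy_trivial R (stable R v alpha) j) /\
  (forall j : nat, (1 <= j)%N -> (j < 2 * (k - 1 + n) - 1)%N ->
     forall (m : moduli R v alpha) (u : unitary_group R k),
       homotopy_iso R m u j (j - 1)).
Proof.
split=> [j jc|j j0 jc m u].
  have inh := stable_inhabited R hk hn; split=> // x c.
  rewrite -[c]reprK; apply/homotopy_class_eq.
  exact: stable_homotopy_trivial.
have [x <-] := @orbit_surj R k n m.
exact: moduli_homotopy_iso.
Qed.
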